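(* Let $\overline{p}(n)$ denote the number of overpartitions of $n$. For all integers $n\geq 18$, \[ \overline{p}(n+1)\overline{p}(n)^2-2\overline{p}(n-1)\overline{p}(n+1)^2+\overline{p}(n-1)\overline{p}(n)\overline{p}(n+2)>0. \]
   Context: An overpartition of $n$ is a partition of $n$ (weakly decreasing sequence of positive integers summing to $n$) in which the first occurrence of each distinct part may optionally be overlined; $\overline{p}(n)$ counts overpartitions of $n$ (e.g. $\overline{p}(3)=8$). *)

(* Defs.v *)
From mathcomp Require Import all_boot all_order all_algebra.

Set Implicit Arguments.
Unset Strict Implicit.
Unset Printing Implicit Defensive.

(* An entry (k, b) is the part k, overlined when b = true. *)
Definition parts (s : seq (nat * bool)) : seq nat := unzip1 s.

Definition overlined_at (s : seq (nat * bool)) (i : nat) : bool :=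
  nth false (unzip2 s) i.

Definition first_occurrence (s : seq nat) (i : nat) : bool :=
  nth 0 s i \notin take i s.

Definition is_partition (n : nat) (s : seq nat) : bool :=
  [&& sorted geq s, all (leq 1) s & sumn s == n].

Definition is_overpartition (n : nat) (s : seq (nat * bool)) : bool :=
  is_partition n (parts s) &&
  all (fun i => overlined_at s i ==> first_occurrence (parts s) i)
      (iota 0 (size s)).

Definition forget_bounds (n : nat) (s : seq ('I_n.+1 * bool)) :
    seq (nat * bool) :=
  [seq (nat_of_ord x.1, x.2) | x <- s].

(* An overpartition of n has at most n parts, each at most n, so counting over
   this finite type loses nothing: see forget_bounds_inj and
   overpartition_bounded. *)
Definition overpartitions (n : nat) : {set n.-bseq ('I_n.+1 * bool)} :=
  [set s : n.-bseq ('I_n.+1 * bool) | is_overpartition n (forget_bounds s)].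

Definition pbar (n : nat) : nat := #|overpartitions n|.

Lemma forget_bounds_inj (n : nat) : injective (@forget_bounds n).
Proof.
by apply: inj_map => -[i b] [j c] [/val_inj -> ->].
Qed.

Lemma overpartition_bounded (n : nat) (s : seq (nat * bool)) :
  is_overpartition n s ->
  exists2 t, t \in overpartitions n & forget_bounds t = s.
Proof.
move=> ops; have /andP[/and3P[_ pos /eqP sums] _] := ops.
have size_s : size s <= n.
  rewrite -sums; elim: s pos {ops sums} => //= x s IHs /andP[x_gt0 /IHs].
  by move/(leq_add x_gt0).
have le_n : all (fun x : nat * bool => x.1 <= n) s.
  rewrite -sums; elim: s {pos ops sums size_s} => //= x s IHs.
  rewrite leq_addr /=; apply: sub_all IHs => y /leq_trans-> //.
  exact: leq_addl.
pose t0 := [seq (inord x.1 : 'I_n.+1, x.2) | x <- s].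
have size_t0 : size t0 <= n by rewrite size_map.
have t0K : forget_bounds t0 = s.
  rewrite /forget_bounds -map_comp -[RHS]map_id.
  by apply/eq_in_map => -[x b] /(allP le_n) /= le_xn; rewrite inordK.
by exists (Bseq size_t0); rewrite ?inE /= ?t0K.
Qed.

(* Main.v *)
(* With a, b, c, d the values of pbar at n - 1, n, n + 1, n + 2, the AM-GM inequality
   (c b^2 + a b d)^2 >= 4 a b^3 c d reduces the theorem to a c^3 < b^3 d, a statement on the third
   difference of log pbar. For n < 2500 it is read off a table computed from Gauss's recurrence
   pbar n = 2 (pbar (n - 1) - pbar (n - 4) + pbar (n - 9) - ...). For larger n, put q = e^(-z) and
   let A be the generating function prod (1 + q^i) / (1 - q^i). The partial fractions of
   1 / (e^w - 1), differentiated and summed over odd multiples of z, give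
   A' / A = 1 / (2 z) - pi^2 / (4 z^2) + (exponentially small). An entire function y of 1 / z solves
   this equation up to the term - pi / (2 z), and y differs from the generating function F of the
   main term f(n) = (d/dn) (sinh (pi sqrt n) / sqrt n) by O(1 / Re z). Gronwall's inequality on the
   line Re z = pi / (2 sqrt n) then shows that A stays close to la F on the major arc, where la is
   the ratio at the real point, while A is small on the minor arc. So pbar n is close to la f(n).
   The factor la is never computed: it cancels in the third difference, which for log f has
   order n^(-5/2), far above the exponentially small relative error. *)

From Stdlib Require Import Reals Lra Lia ZArith List.
From Coquelicot Require Import Coquelicot.
Local Open Scope R_scope.

(** The classical route reads the behaviour of the product near q = 1 off the modular transformation
    law, with its branch of sqrt z and its explicit constant. The logarithmic derivative avoids
    both: a differential equation fixes the shape of the main term, and the constant is absorbed in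
    the value at one real point. No infinite product is needed either: [gf] has finitely many
    factors, enough of them for the discarded tail to stay below the bound for the dual nome, and
    its coefficients of index up to their number are those of all overpartitions.

    The arcs meet at Im z = 12/5 Re z, where |z| = 13/5 Re z is rational. With s = Re z, the major
    arc error gains exp (-50/169 pi^2 / s) and the product on the minor arc loses a factor exp
    (61/50 / s); at s = pi / (2 x), x = sqrt n, the gains are about exp (-1.86 x) and exp (-0.78 x).
    The second one decides: x^7 exp (-19/25 x) must be small enough for the third difference to win,
    which holds from x = 50 on and puts the end of the table at n = 2500. *)

(** * Complex exponential and elementary inequalities *)

Definition cexp (z : C) : C := (exp (Re z) * cos (Im z), exp (Re z) * sin (Im z)).

Lemma C_eq (a b : C) : Re a = Re b -> Im a = Im b -> a = b.
Proof. destruct a, b; simpl; intros; subst; reflexivity. Qed.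

Ltac csimp := unfold cexp, Re, Im; simpl.

Lemma cexp_add (a b : C) : cexp (a + b)%C = (cexp a * cexp b)%C.
Proof. apply C_eq; csimp; rewrite exp_plus, ?cos_plus, ?sin_plus; ring. Qed.

Lemma cexp_0 : cexp 0 = 1%C.
Proof. apply C_eq; csimp; rewrite exp_0, ?cos_0, ?sin_0; ring. Qed.

Lemma Cmod_cexp (z : C) : Cmod (cexp z) = exp (Re z).
Proof.
pose proof (sin2_cos2 (Im z)) as H; unfold Rsqr in H.
pose proof (exp_pos (Re z)) as H0.
rewrite <- (sqrt_pow2 (exp (Re z))) by lra.
unfold Cmod, cexp; simpl fst; simpl snd; f_equal; nra.
Qed.

Lemma cexp_neq_0 (z : C) : cexp z <> 0%C.
Proof.
intros H; pose proof (Cmod_cexp z) as E; rewrite H, Cmod_0 in E.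
pose proof (exp_pos (Re z)); lra.
Qed.

Lemma cexp_opp (z : C) : cexp (- z) = (/ cexp z)%C.
Proof.
pose proof (cexp_neq_0 z) as H.
assert (E : (cexp z * cexp (- z) = 1)%C).
  rewrite <- cexp_add, <- cexp_0; f_equal; ring.
replace (cexp (- z)) with (/ cexp z * (cexp z * cexp (- z)))%C by (field; exact H).
rewrite E; ring.
Qed.

Lemma cexp_nat (n : nat) (z : C) : cexp (INR n * z)%C = (cexp z ^ n)%C.
Proof.
induction n as [|n IH].
  simpl; rewrite <- cexp_0; f_equal; ring.
rewrite S_INR, RtoC_plus; simpl Cpow; rewrite <- IH, <- cexp_add; f_equal; ring.
Qed.

Lemma cexp_iPI : cexp (PI * Ci)%C = (- 1)%C.
Proof.
apply C_eq; csimp;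
  replace (PI * 0 - 0 * 1) with 0 by ring; replace (PI * 1 + 0 * 0) with PI by ring;
  rewrite exp_0, ?cos_PI, ?sin_PI; ring.
Qed.

Lemma cexp_2iPI : cexp (2 * PI * Ci)%C = 1%C.
Proof.
replace (2 * PI * Ci)%C with (PI * Ci + PI * Ci)%C by ring.
rewrite cexp_add, cexp_iPI; ring.
Qed.

Lemma cexp_2iPI_nat (n : nat) : cexp (INR n * (2 * PI * Ci))%C = 1%C.
Proof.
rewrite cexp_nat, cexp_2iPI; induction n as [|n IH]; simpl; [|rewrite IH]; ring.
Qed.

(** Each Taylor bound for sin and cos below follows from the preceding one through this; it serves
    again in [gronwall], [factor_log] and [incr_ge]. *)
Lemma le_of_deriv (f f' : R -> R) (a b : R) : a <= b ->
  (forall t, a <= t <= b -> is_derive f t (f' t)) ->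
  (forall t, a <= t <= b -> 0 <= f' t) -> f a <= f b.
Proof.
intros Hab Hd Hpos.
destruct (MVT_gen f a b f') as [c [Hc E]].
- intros t Ht; rewrite Rmin_left, Rmax_right in Ht by lra; apply Hd; lra.
- intros t Ht; rewrite Rmin_left, Rmax_right in Ht by lra.
  apply continuity_pt_filterlim, (ex_derive_continuous f); exists (f' t); apply Hd; lra.
- rewrite Rmin_left, Rmax_right in Hc by lra.
  assert (0 <= f' c * (b - a)) by (apply Rmult_le_pos; [apply Hpos; lra|lra]); lra.
Qed.

Lemma exp_taylor1 (a : R) : Rabs (exp a - 1 - a) <= a ^ 2 * exp (Rabs a).
Proof.
pose proof (exp_ineq1_le a) as H1; pose proof (exp_ineq1_le (- a)) as H2.
assert (E : exp a * exp (- a) = 1) by (rewrite <- exp_plus, <- exp_0; f_equal; ring).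
pose proof (exp_pos a) as H3.
assert (H4 : exp a - 1 <= a * exp a) by nra.
rewrite Rabs_pos_eq by lra.
destruct (Rle_or_lt 0 a) as [Ha|Ha].
  rewrite Rabs_pos_eq by lra; nra.
rewrite Rabs_left by lra; pose proof (exp_pos (- a)); nra.
Qed.

Lemma sin_le_id (b : R) : 0 <= b -> sin b <= b.
Proof.
intros Hb.
assert (H : 0 - sin 0 <= b - sin b); [|rewrite sin_0 in H; lra].
apply (le_of_deriv (fun t => t - sin t) (fun t => 1 - cos t)); [lra| |].
- intros t _; auto_derive; [easy|ring].
- intros t _; pose proof (COS_bound t); lra.
Qed.

Lemma cos_ge_quad (b : R) : 1 - b ^ 2 / 2 <= cos b.
Proof.
assert (W : forall b, 0 <= b -> 1 - b ^ 2 / 2 <= cos b).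
  clear b; intros b Hb.
  assert (H : cos 0 - 1 + 0 ^ 2 / 2 <= cos b - 1 + b ^ 2 / 2); [|rewrite cos_0 in H; lra].
  apply (le_of_deriv (fun t => cos t - 1 + t ^ 2 / 2) (fun t => t - sin t)); [lra| |].
  - intros t _; auto_derive; [easy|field].
  - intros t Ht; pose proof (sin_le_id t); lra.
destruct (Rle_or_lt 0 b) as [Hb|Hb]; [auto|].
rewrite <- cos_neg; replace (b ^ 2) with ((- b) ^ 2) by ring; apply W; lra.
Qed.

Lemma sin_ge_cubic (b : R) : 0 <= b -> b - b ^ 3 / 6 <= sin b.
Proof.
intros Hb.
assert (H : sin 0 - 0 + 0 ^ 3 / 6 <= sin b - b + b ^ 3 / 6); [|rewrite sin_0 in H; lra].
apply (le_of_deriv (fun t => sin t - t + t ^ 3 / 6) (fun t => cos t - 1 + t ^ 2 / 2)); [lra| |].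
- intros t _; auto_derive; [easy|field].
- intros t _; pose proof (cos_ge_quad t); lra.
Qed.

Lemma sin_ge_quad (b : R) : 0 <= b -> b - b ^ 2 / 2 <= sin b.
Proof.
intros Hb.
(* The cubic bound implies the quadratic one only for b <= 3; beyond that, b - b^2 / 2 is below
   -1. *)
destruct (Rle_or_lt b 3) as [H|H].
  pose proof (sin_ge_cubic b Hb); nra.
pose proof (SIN_bound b); nra.
Qed.

Lemma Cmod_le_sum (z : C) : Cmod z <= Rabs (Re z) + Rabs (Im z).
Proof.
unfold Cmod, Re, Im; simpl.
pose proof (Rabs_pos (fst z)); pose proof (Rabs_pos (snd z)).
rewrite <- (sqrt_pow2 (Rabs (fst z) + Rabs (snd z))) by lra.
apply sqrt_le_1_alt; rewrite <- (pow2_abs (fst z)), <- (pow2_abs (snd z)) at 1.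
rewrite <- !Rsqr_pow2; unfold Rsqr; nra.
Qed.

Lemma im_le_Cmod (z : C) : Rabs (Im z) <= Cmod z.
Proof.
eapply Rle_trans; [|apply Rmax_Cmod]; unfold Im; apply Rmax_r.
Qed.

Lemma cis_taylor1 (b : R) : Cmod (cexp (b * Ci) - 1 - b * Ci)%C <= b ^ 2.
Proof.
eapply Rle_trans; [apply Cmod_le_sum|].
csimp; replace (b * 0 - 0 * 1) with 0 by ring; replace (b * 1 + 0 * 0) with b by ring.
rewrite exp_0.
assert (H : forall b, 0 <= b -> Rabs (sin b - b) <= b ^ 2 / 2).
  intros c Hc; pose proof (sin_le_id c Hc); pose proof (sin_ge_quad c Hc).
  rewrite Rabs_left1; lra.
assert (H1 : Rabs (sin b - b) <= b ^ 2 / 2).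
  destruct (Rle_or_lt 0 b) as [Hb|Hb]; [auto|].
  specialize (H (- b)); rewrite sin_neg in H.
  replace (- sin b - - b) with (- (sin b - b)) in H by ring.
  rewrite Rabs_Ropp in H; replace ((- b) ^ 2) with (b ^ 2) in H by ring; apply H; lra.
pose proof (cos_ge_quad b); pose proof (COS_bound b).
rewrite Rabs_left1 by (ring_simplify; lra).
match goal with |- _ + Rabs ?u <= _ => replace u with (sin b - b) by ring end.
lra.
Qed.

Lemma cis_lipschitz (b : R) : Cmod (cexp (b * Ci) - 1)%C <= Rabs b.
Proof.
rewrite <- (sqrt_pow2 (Rabs b)) by apply Rabs_pos.
unfold Cmod; apply sqrt_le_1_alt; rewrite pow2_abs.
csimp; replace (b * 0 - 0 * 1) with 0 by ring; replace (b * 1 + 0 * 0) with b by ring.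
rewrite exp_0; pose proof (cos_ge_quad b); pose proof (sin2_cos2 b) as E; unfold Rsqr in E; nra.
Qed.

Lemma cexp_decomp (z : C) : cexp z = (exp (Re z) * cexp (Im z * Ci))%C.
Proof.
apply C_eq; csimp; replace (snd z * 0 - 0 * 1) with 0 by ring;
  replace (snd z * 1 + 0 * 0) with (snd z) by ring; rewrite exp_0; ring.
Qed.

Lemma cexp_taylor1 (z : C) : Cmod (cexp z - 1 - z)%C <= 2 * Cmod z ^ 2 * exp (Cmod z).
Proof.
set (a := Re z); set (b := Im z).
assert (Ez : z = (a + b * Ci)%C).
  apply C_eq; unfold a, b; csimp; ring.
replace (cexp z - 1 - z)%C with
  ((exp a - 1 - a)%R * cexp (b * Ci) + (cexp (b * Ci) - 1 - b * Ci) + a * (cexp (b * Ci) - 1))%C.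
2:{ rewrite (cexp_decomp z); fold a b; rewrite !RtoC_minus; rewrite Ez at 1; ring. }
eapply Rle_trans; [apply Cmod_triangle|].
eapply Rle_trans; [apply Rplus_le_compat_r, Cmod_triangle|].
rewrite !Cmod_mult, !Cmod_R, Cmod_cexp.
replace (Re (b * Ci)) with 0 by (csimp; ring); rewrite exp_0.
pose proof (exp_taylor1 a); pose proof (cis_taylor1 b); pose proof (cis_lipschitz b).
assert (Ha : Rabs a <= Cmod z) by apply re_le_Cmod.
assert (Hb : Rabs b <= Cmod z) by apply im_le_Cmod.
assert (He : exp (Rabs a) <= exp (Cmod z)).
  destruct Ha as [Ha|Ha]; [left; apply exp_increasing; exact Ha|rewrite Ha; lra].
pose proof (Rabs_pos a); pose proof (Rabs_pos b).
assert (Hq : a ^ 2 + b ^ 2 = Cmod z ^ 2) by (rewrite Cmod2_alt; reflexivity).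
assert (He1 : 1 <= exp (Cmod z)) by (pose proof (exp_ineq1_le (Cmod z)); lra).
rewrite <- (pow2_abs a), <- (pow2_abs b) in Hq; rewrite <- (pow2_abs a) in H; rewrite <- (pow2_abs b) in H0.
set (A := Rabs a) in *; set (B := Rabs b) in *; set (X := exp (Cmod z)) in *.
assert (A ^ 2 * exp A <= A ^ 2 * X) by nra.
assert (A * Cmod (cexp (b * Ci) - 1)%C <= A * B) by nra.
nra.
Qed.

Lemma cos_le_quartic (b : R) : 0 <= b -> cos b <= 1 - b ^ 2 / 2 + b ^ 4 / 24.
Proof.
intros Hb.
assert (H : 1 - 0 ^ 2 / 2 + 0 ^ 4 / 24 - cos 0 <= 1 - b ^ 2 / 2 + b ^ 4 / 24 - cos b);
  [|rewrite cos_0 in H; lra].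
apply (le_of_deriv (fun t => 1 - t ^ 2 / 2 + t ^ 4 / 24 - cos t)
  (fun t => sin t - t + t ^ 3 / 6)); [lra| |].
- intros t _; auto_derive; [easy|field].
- intros t Ht; pose proof (sin_ge_cubic t); lra.
Qed.

Lemma sin_le_quintic (b : R) : 0 <= b -> sin b <= b - b ^ 3 / 6 + b ^ 5 / 120.
Proof.
intros Hb.
assert (H : 0 - 0 ^ 3 / 6 + 0 ^ 5 / 120 - sin 0 <= b - b ^ 3 / 6 + b ^ 5 / 120 - sin b);
  [|rewrite sin_0 in H; lra].
apply (le_of_deriv (fun t => t - t ^ 3 / 6 + t ^ 5 / 120 - sin t)
  (fun t => 1 - t ^ 2 / 2 + t ^ 4 / 24 - cos t)); [lra| |].
- intros t _; auto_derive; [easy|field].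
- intros t Ht; pose proof (cos_le_quartic t); lra.
Qed.

Lemma cos_ge_sextic (b : R) : 0 <= b -> 1 - b ^ 2 / 2 + b ^ 4 / 24 - b ^ 6 / 720 <= cos b.
Proof.
intros Hb.
assert (H : cos 0 - (1 - 0 ^ 2 / 2 + 0 ^ 4 / 24 - 0 ^ 6 / 720)
  <= cos b - (1 - b ^ 2 / 2 + b ^ 4 / 24 - b ^ 6 / 720)); [|rewrite cos_0 in H; lra].
apply (le_of_deriv (fun t => cos t - (1 - t ^ 2 / 2 + t ^ 4 / 24 - t ^ 6 / 720))
  (fun t => t - t ^ 3 / 6 + t ^ 5 / 120 - sin t)); [lra| |].
- intros t _; auto_derive; [easy|field].
- intros t Ht; pose proof (sin_le_quintic t); lra.
Qed.

(** cos is nonnegative up to PI / 2, but its Taylor majorant of degree 4 is negative at 8/5. [PI_gt]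
    tests the minorant of degree 6 at 313/200 in the same way. *)
Lemma PI_lt : PI < 16 / 5.
Proof.
destruct (Rlt_or_le PI (16 / 5)) as [H|H]; [exact H|exfalso].
pose proof (cos_le_quartic (8 / 5)).
assert (0 <= cos (8 / 5)) by (apply cos_ge_0; pose proof PI_RGT_0; lra).
lra.
Qed.

Lemma PI_gt : 313 / 100 < PI.
Proof.
destruct (Rlt_or_le (313 / 100) PI) as [H|H]; [exact H|exfalso].
pose proof (cos_ge_sextic (313 / 200)) as H1.
assert (cos (313 / 200) <= cos (PI / 2)).
  apply cos_decr_1; pose proof PI2_3_2; lra.
rewrite cos_PI2 in H0; lra.
Qed.

(** Separates radius from angle. It bounds |exp a - 1| below near 0, tells distinct roots of unity
    apart, and measures 1 - q on the minor arc. *)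
Lemma Cmod_cexp_m1_sqr (a : C) :
  Cmod (cexp a - 1)%C ^ 2 = (exp (Re a) - 1) ^ 2 + 4 * exp (Re a) * sin (Im a / 2) ^ 2.
Proof.
rewrite Cmod2_alt; csimp.
assert (Es : sin (snd a) = 2 * sin (snd a / 2) * cos (snd a / 2)).
  rewrite <- sin_2a; f_equal; field.
assert (Eq : cos (snd a) = cos (snd a / 2) * cos (snd a / 2) - sin (snd a / 2) * sin (snd a / 2)).
  rewrite <- cos_2a; f_equal; field.
rewrite Es, Eq.
pose proof (sin2_cos2 (snd a / 2)) as E; unfold Rsqr in E.
set (S := sin (snd a / 2)) in *; set (X := exp (fst a)).
assert (Ec : cos (snd a / 2) * cos (snd a / 2) = 1 - S * S) by lra.
set (K := cos (snd a / 2)) in *.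
transitivity ((X * (K * K - S * S) - 1) ^ 2 + 4 * X ^ 2 * S ^ 2 * (K * K)); [ring|].
rewrite Ec; ring.
Qed.

(** The range of Im a reaches past PI because the scaled lattice points of [Cmod_cexp_scaled_ge]
    have modulus up to 1/2 + PI. *)
Lemma Cmod_cexp_m1_ge (a : C) : Rabs (Re a) <= 1 -> Rabs (Im a) <= 4 ->
  Cmod a / 6 <= Cmod (cexp a - 1)%C.
Proof.
intros Hr Hi.
assert (H : (Cmod a / 6) ^ 2 <= Cmod (cexp a - 1)%C ^ 2).
  rewrite Cmod_cexp_m1_sqr.
  replace ((Cmod a / 6) ^ 2) with (Cmod a ^ 2 / 36) by field; rewrite Cmod2_alt.
  set (x := Re a) in *; set (y := Im a) in *.
  assert (Hx : exp (-1) >= 1 / 3).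
    pose proof exp_le_3; assert (E : exp 1 * exp (-1) = 1) by (rewrite <- exp_plus; replace (1 + -1) with 0 by ring; apply exp_0).
    pose proof (exp_pos (-1)); nra.
  apply Rabs_le_between in Hr; apply Rabs_le_between in Hi.
  assert (Hex : exp x >= 1 / 3).
    assert (Hr1 : -1 <= x) by lra; destruct Hr1 as [H|H]; [pose proof (exp_increasing _ _ H); lra|rewrite <- H; lra].
  assert (H1 : x ^ 2 / 9 <= (exp x - 1) ^ 2).
    pose proof (exp_ineq1_le x); destruct (Rle_or_lt 0 x) as [H0|H0]; [nra|].
    pose proof (exp_ineq1_le (- x)).
    assert (E : exp x * exp (- x) = 1) by (rewrite <- exp_plus, <- exp_0; f_equal; ring).
    assert (1 - exp x >= - x / 3) by nra; nra.
  assert (H2 : y ^ 2 / 36 <= sin (y / 2) ^ 2).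
    assert (W : forall t, 0 <= t <= 2 -> t / 3 <= sin t).
      intros t Ht; pose proof (sin_ge_cubic t); nra.
    destruct (Rle_or_lt 0 y) as [H0|H0].
      specialize (W (y / 2)); nra.
    specialize (W (- (y / 2))); rewrite sin_neg in W; nra.
  pose proof (pow2_ge_0 y); pose proof (pow2_ge_0 x); pose proof (pow2_ge_0 (sin (y / 2))); nra.
destruct (Rle_or_lt (Cmod a / 6) (Cmod (cexp a - 1)%C)) as [G|G]; [exact G|].
pose proof (Cmod_ge_0 (cexp a - 1)%C); nra.
Qed.

Lemma exp_nat (n : nat) (x : R) : exp (INR n * x) = exp x ^ n.
Proof.
induction n as [|n IH]; [simpl; rewrite Rmult_0_l; apply exp_0|].
rewrite S_INR, Rmult_plus_distr_r, exp_plus, IH, Rmult_1_l; simpl; ring.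
Qed.

Lemma exp_le (x y : R) : x <= y -> exp x <= exp y.
Proof. intros [H|H]; [left; apply exp_increasing, H|rewrite H; lra]. Qed.

(** * Complex series *)

Fixpoint rfsum (u : nat -> R) (n : nat) : R :=
  match n with O => 0 | S n => rfsum u n + u n end.

Fixpoint cfsum (u : nat -> C) (n : nat) : C :=
  match n with O => 0%C | S n => (cfsum u n + u n)%C end.

Definition csum (a : nat -> C) : C :=
  (Series (fun n => Re (a n)), Series (fun n => Im (a n))).

(** Absolute convergence, the only kind used: sums that converge conditionally are first paired or
    telescoped. *)
Definition csummable (a : nat -> C) : Prop := ex_series (fun n => Cmod (a n)).

Definition clim (u : nat -> C) (l : C) : Prop := is_lim_seq (fun n => Cmod (u n - l)%C) 0.

Lemma sum_n_rfsum (u : nat -> R) (n : nat) : sum_n u n = rfsum u (S n).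
Proof.
induction n as [|n IH]; [rewrite sum_O; simpl; ring|].
rewrite sum_Sn, IH; reflexivity.
Qed.

Lemma ex_series_dom (a b : nat -> R) :
  (forall n, Rabs (a n) <= b n) -> ex_series b -> ex_series a.
Proof. intros H; apply (@ex_series_le R_AbsRing R_CompleteNormedModule); exact H. Qed.

Lemma ex_series_Rscal (c : R) (a : nat -> R) : ex_series a -> ex_series (fun n => c * a n).
Proof. exact (ex_series_scal (V := R_NormedModule) c a). Qed.

Lemma ex_series_Rscal_r (c : R) (a : nat -> R) : ex_series a -> ex_series (fun n => a n * c).
Proof.
intros H; apply ex_series_ext with (fun n => c * a n); [intros; apply Rmult_comm|].
apply ex_series_Rscal, H.
Qed.

Lemma ex_series_shift (b : nat -> R) (m : nat) :
  ex_series b -> ex_series (fun k => b (m + k)%nat).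
Proof. apply ex_series_incr_n. Qed.

Lemma Series_rfsum (b : nat -> R) (m : nat) : ex_series b ->
  Series b = rfsum b m + Series (fun k => b (m + k)%nat).
Proof.
intros Hb; induction m as [|m IH].
  simpl; rewrite Rplus_0_l; apply Series_ext; intros; reflexivity.
rewrite IH; simpl; rewrite (Series_incr_1 (fun k => b (m + k)%nat)) by (apply ex_series_shift; exact Hb).
replace (m + 0)%nat with m by lia; rewrite Rplus_assoc; do 2 f_equal.
apply Series_ext; intros; f_equal; lia.
Qed.

Lemma rfsum_lim (b : nat -> R) : ex_series b -> is_lim_seq (rfsum b) (Series b).
Proof.
intros Hb; apply is_lim_seq_incr_1.
apply is_lim_seq_ext with (sum_n b); [intros n; apply sum_n_rfsum|].
apply (Series_correct b Hb).
Qed.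

Lemma Series_tail_lim (b : nat -> R) : ex_series b ->
  is_lim_seq (fun m => Series (fun k => b (m + k)%nat)) 0.
Proof.
intros Hb; apply is_lim_seq_ext with (fun m => Series b - rfsum b m).
  intros m; rewrite (Series_rfsum b m Hb) at 1; ring.
replace (Finite 0) with (Finite (Series b - Series b)) by (f_equal; ring).
apply is_lim_seq_minus'; [apply is_lim_seq_const|apply rfsum_lim, Hb].
Qed.

Lemma is_series_zero : is_series (fun _ => 0) 0.
Proof.
apply filterlim_ext with (fun _ : nat => 0); [|apply filterlim_const].
intros n; rewrite sum_n_const; ring.
Qed.

Lemma Series_zero : Series (fun _ => 0) = 0.
Proof. apply is_series_unique, is_series_zero. Qed.

Lemma rfsum_le_Series (b : nat -> R) (m : nat) : (forall k, 0 <= b k) -> ex_series b ->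
  rfsum b m <= Series b.
Proof.
intros H Hb; rewrite (Series_rfsum b m Hb).
assert (0 <= Series (fun k => b (m + k)%nat)); [|lra].
rewrite <- Series_zero.
apply Series_le; [intros n; split; [lra|apply H]|apply ex_series_shift, Hb].
Qed.

Lemma Series_nonneg (b : nat -> R) : (forall k, 0 <= b k) -> ex_series b -> 0 <= Series b.
Proof. intros H Hb; apply (rfsum_le_Series b 0 H Hb). Qed.

Lemma ex_series_bounded (b : nat -> R) (B : R) :
  (forall k, 0 <= b k) -> (forall n, rfsum b n <= B) -> ex_series b.
Proof.
intros H HB.
destruct (ex_finite_lim_seq_incr (rfsum b) B) as [l Hl].
- intros n; simpl; specialize (H n); lra.
- exact HB.
- exists l; change (is_lim_seq (sum_n b) l).
  apply is_lim_seq_ext with (fun n => rfsum b (S n)); [intros; symmetry; apply sum_n_rfsum|].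
  apply (is_lim_seq_incr_1 (rfsum b)), Hl.
Qed.

Lemma csummable_re (a : nat -> C) : csummable a -> ex_series (fun n => Re (a n)).
Proof. apply ex_series_dom; intros; apply re_le_Cmod. Qed.

Lemma csummable_im (a : nat -> C) : csummable a -> ex_series (fun n => Im (a n)).
Proof. apply ex_series_dom; intros; apply im_le_Cmod. Qed.

Lemma csummable_dom (a : nat -> C) (b : nat -> R) :
  (forall n, Cmod (a n) <= b n) -> ex_series b -> csummable a.
Proof.
intros H; apply ex_series_dom; intros n; rewrite Rabs_pos_eq by apply Cmod_ge_0; apply H.
Qed.

Lemma csummable_plus (a b : nat -> C) :
  csummable a -> csummable b -> csummable (fun n => a n + b n)%C.
Proof.
intros Ha Hb; apply csummable_dom with (fun n => Cmod (a n) + Cmod (b n)).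
  intros; apply Cmod_triangle.
apply (ex_series_plus (fun n => Cmod (a n)) (fun n => Cmod (b n))); assumption.
Qed.

Lemma csummable_scal (c : C) (a : nat -> C) :
  csummable a -> csummable (fun n => c * a n)%C.
Proof.
intros Ha; apply csummable_dom with (fun n => Cmod c * Cmod (a n)).
  intros; rewrite Cmod_mult; lra.
apply (ex_series_Rscal (Cmod c) (fun n => Cmod (a n))); exact Ha.
Qed.

Lemma csummable_ext (a b : nat -> C) : (forall n, a n = b n) -> csummable a -> csummable b.
Proof. intros H; apply ex_series_ext; intros; rewrite H; reflexivity. Qed.

Lemma csummable_minus (a b : nat -> C) :
  csummable a -> csummable b -> csummable (fun n => a n - b n)%C.
Proof.
intros Ha Hb; apply csummable_ext with (fun n => a n + (- (1)) * b n)%C; [intros; ring|].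
apply csummable_plus, csummable_scal; assumption.
Qed.

Lemma csummable_shift (a : nat -> C) (m : nat) :
  csummable a -> csummable (fun k => a (m + k)%nat).
Proof. apply (ex_series_shift (fun n => Cmod (a n))). Qed.

Lemma csum_ext (a b : nat -> C) : (forall n, a n = b n) -> csum a = csum b.
Proof. intros H; unfold csum; f_equal; apply Series_ext; intros; rewrite H; reflexivity. Qed.

Lemma csum_plus (a b : nat -> C) : csummable a -> csummable b ->
  csum (fun n => a n + b n)%C = (csum a + csum b)%C.
Proof.
intros Ha Hb; apply C_eq; unfold csum; simpl.
- rewrite <- Series_plus; [reflexivity|apply csummable_re, Ha|apply csummable_re, Hb].
- rewrite <- Series_plus; [reflexivity|apply csummable_im, Ha|apply csummable_im, Hb].
Qed.

Lemma csum_scal (c : C) (a : nat -> C) : csummable a ->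
  csum (fun n => c * a n)%C = (c * csum a)%C.
Proof.
intros Ha.
pose proof (csummable_re a Ha) as Hr; pose proof (csummable_im a Ha) as Hi.
apply C_eq; unfold csum; simpl.
- rewrite <- !Series_scal_l, <- Series_minus; [reflexivity| |];
    apply ex_series_Rscal; assumption.
- rewrite <- !Series_scal_l, <- Series_plus; [reflexivity| |];
    apply ex_series_Rscal; assumption.
Qed.

Lemma csum_minus (a b : nat -> C) : csummable a -> csummable b ->
  csum (fun n => a n - b n)%C = (csum a - csum b)%C.
Proof.
intros Ha Hb; transitivity (csum (fun n => a n + (- (1)) * b n)%C).
  apply csum_ext; intros; ring.
rewrite csum_plus, csum_scal; [ring|exact Hb|exact Ha|apply csummable_scal, Hb].
Qed.

Lemma csum_incr_1 (a : nat -> C) : csummable a -> csum a = (a O + csum (fun k => a (S k)))%C.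
Proof.
intros Ha; apply C_eq; unfold csum; simpl; apply Series_incr_1;
  [apply csummable_re|apply csummable_im]; exact Ha.
Qed.

Lemma csum_0 : csum (fun _ => 0%C) = 0%C.
Proof. apply C_eq; unfold csum; simpl; apply Series_zero. Qed.

Lemma csum_cfsum (a : nat -> C) (m : nat) : csummable a ->
  csum a = (cfsum a m + csum (fun k => a (m + k)%nat))%C.
Proof.
intros Ha; induction m as [|m IH].
  simpl; rewrite Cplus_0_l; apply csum_ext; reflexivity.
rewrite IH; simpl; rewrite (csum_incr_1 (fun k => a (m + k)%nat)) by (apply csummable_shift; exact Ha).
replace (m + 0)%nat with m by lia; rewrite Cplus_assoc; f_equal.
apply csum_ext; intros; f_equal; lia.
Qed.

(** Multiplying the terms by the conjugate of the sum l turns |l|^2 into a series of real parts,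
    which is compared term by term with |l| times the series of moduli. *)
Lemma Cmod_csum (a : nat -> C) : csummable a -> Cmod (csum a) <= Series (fun n => Cmod (a n)).
Proof.
intros Ha; set (l := csum a).
destruct (Req_dec (Cmod l) 0) as [H0|H0].
  rewrite H0; apply Series_nonneg; [intros; apply Cmod_ge_0|exact Ha].
assert (Hl : 0 < Cmod l) by (pose proof (Cmod_ge_0 l); lra).
apply Rmult_le_reg_l with (Cmod l); [exact Hl|].
assert (E : Cmod l * Cmod l = Re (csum (fun n => Cconj l * a n)%C)).
  rewrite csum_scal by exact Ha; fold l.
  replace (Cmod l * Cmod l) with (Cmod l ^ 2) by ring; rewrite Cmod2_alt.
  unfold Cconj; csimp; ring.
rewrite E, <- Series_scal_l.
change (Re (csum (fun n => Cconj l * a n)%C)) with (Series (fun n => Re (Cconj l * a n)%C)).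
clearbody l.
assert (Hc : csummable (fun n => Cconj l * a n)%C) by (apply csummable_scal, Ha).
eapply Rle_trans; [apply Rle_abs|].
eapply Rle_trans; [apply Series_Rabs|].
  apply ex_series_dom with (fun n => Cmod (Cconj l * a n)%C); [|exact Hc].
  intros n; rewrite Rabs_Rabsolu; apply re_le_Cmod.
apply Series_le.
- intros n; split; [apply Rabs_pos|].
  eapply Rle_trans; [apply (re_le_Cmod (Cconj l * a n)%C)|].
  rewrite Cmod_mult, Cmod_conj; lra.
- apply (ex_series_Rscal (Cmod l) (fun n => Cmod (a n))); exact Ha.
Qed.

Lemma Cmod_csum_le (a : nat -> C) (b : nat -> R) :
  (forall n, Cmod (a n) <= b n) -> ex_series b -> Cmod (csum a) <= Series b.
Proof.
intros H Hb; eapply Rle_trans; [apply Cmod_csum, (csummable_dom a b H Hb)|].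
apply Series_le; [intros n; split; [apply Cmod_ge_0|apply H]|exact Hb].
Qed.

Lemma clim_squeeze (u : nat -> C) (l : C) (e : nat -> R) :
  (forall n, Cmod (u n - l)%C <= e n) -> is_lim_seq e 0 -> clim u l.
Proof.
intros H He; apply is_lim_seq_le_le with (fun _ => 0) e; [|apply is_lim_seq_const|exact He].
intros n; split; [apply Cmod_ge_0|apply H].
Qed.

Lemma clim_ext (u v : nat -> C) (l : C) : (forall n, u n = v n) -> clim u l -> clim v l.
Proof. intros H; apply is_lim_seq_ext; intros; rewrite H; reflexivity. Qed.

Lemma clim_const (l : C) : clim (fun _ => l) l.
Proof.
apply clim_squeeze with (fun _ => 0); [|apply is_lim_seq_const].
intros _; replace (l - l)%C with (RtoC 0) by ring; rewrite Cmod_0; lra.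
Qed.

Lemma clim_plus (u v : nat -> C) (l m : C) :
  clim u l -> clim v m -> clim (fun n => u n + v n)%C (l + m)%C.
Proof.
intros Hu Hv; apply clim_squeeze with (fun n => Cmod (u n - l)%C + Cmod (v n - m)%C).
  intros n; replace (u n + v n - (l + m))%C with ((u n - l) + (v n - m))%C by ring.
  apply Cmod_triangle.
replace (Finite 0) with (Finite (0 + 0)) by (f_equal; ring).
apply is_lim_seq_plus'; assumption.
Qed.

Lemma clim_scal (c : C) (u : nat -> C) (l : C) :
  clim u l -> clim (fun n => c * u n)%C (c * l)%C.
Proof.
intros Hu; apply clim_squeeze with (fun n => Cmod c * Cmod (u n - l)%C).
  intros n; rewrite <- Cmod_mult; right; f_equal; ring.
replace (Finite 0) with (Rbar_mult (Cmod c) 0) by (simpl; f_equal; ring).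
apply is_lim_seq_scal_l, Hu.
Qed.

Lemma clim_minus (u v : nat -> C) (l m : C) :
  clim u l -> clim v m -> clim (fun n => u n - v n)%C (l - m)%C.
Proof.
intros Hu Hv; apply clim_ext with (fun n => u n + (- (1)) * v n)%C; [intros; ring|].
replace (l - m)%C with (l + (- (1)) * m)%C by ring.
apply clim_plus, clim_scal; assumption.
Qed.

Lemma clim_unique (u : nat -> C) (l m : C) : clim u l -> clim u m -> l = m.
Proof.
intros Hl Hm.
assert (H : clim (fun n => u n - u n)%C (l - m)%C) by (apply clim_minus; assumption).
assert (E : Cmod (l - m)%C = 0).
  assert (H' : is_lim_seq (fun _ => Cmod (l - m)%C) 0).
    eapply is_lim_seq_ext; [|exact H]; intros n; simpl.
    rewrite <- Cmod_opp; f_equal; ring.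
  apply is_lim_seq_unique in H'; rewrite Lim_seq_const in H'; injection H'; auto.
apply Cmod_eq_0 in E; replace l with (l - m + m)%C by ring; rewrite E; ring.
Qed.

Lemma clim_incr (u : nat -> C) (l : C) (m : nat) : clim u l -> clim (fun n => u (n + m)%nat) l.
Proof. apply (is_lim_seq_incr_n (fun n => Cmod (u n - l)%C)). Qed.

Lemma Cmod_clim_le (u : nat -> C) (l : C) (B : R) :
  (forall n, Cmod (u n) <= B) -> clim u l -> Cmod l <= B.
Proof.
intros H Hu.
assert (H1 : is_lim_seq (fun n => B + Cmod (u n - l)%C) (B + 0)).
  apply is_lim_seq_plus'; [apply is_lim_seq_const|exact Hu].
rewrite Rplus_0_r in H1.
assert (H2 : Rbar_le (Cmod l) B); [|exact H2].
apply is_lim_seq_le with (fun _ => Cmod l) (fun n => B + Cmod (u n - l)%C);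
  [|apply is_lim_seq_const|exact H1].
intros n; specialize (H n).
pose proof (Cmod_triangle (u n) (- (u n - l))%C) as T; rewrite Cmod_opp in T.
replace (u n + - (u n - l))%C with l in T by ring; lra.
Qed.

Lemma cfsum_lim (a : nat -> C) : csummable a -> clim (cfsum a) (csum a).
Proof.
intros Ha; apply clim_squeeze with (fun m => Series (fun k => Cmod (a (m + k)%nat))).
  intros m; rewrite (csum_cfsum a m Ha).
  replace (_ - _)%C with (- csum (fun k => a (m + k)%nat))%C by ring.
  rewrite Cmod_opp; apply Cmod_csum, csummable_shift, Ha.
apply (Series_tail_lim (fun n => Cmod (a n))), Ha.
Qed.

Lemma rfsum_lim_0 (d : nat -> nat -> R) (m : nat) :
  (forall k, is_lim_seq (fun n => d n k) 0) -> is_lim_seq (fun n => rfsum (d n) m) 0.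
Proof.
intros H; induction m as [|m IH]; simpl; [apply is_lim_seq_const|].
replace (Finite 0) with (Finite (0 + 0)) by (f_equal; ring).
apply is_lim_seq_plus'; [exact IH|apply H].
Qed.

(** Beyond a rank m the majorant sums to less than eps / 2, and the first m terms tend to 0
    together. *)
Lemma tannery_0 (d : nat -> nat -> R) (b : nat -> R) : ex_series b ->
  (forall n k, 0 <= d n k <= b k) -> (forall k, is_lim_seq (fun n => d n k) 0) ->
  is_lim_seq (fun n => Series (d n)) 0.
Proof.
intros Hb Hd Hl; apply is_lim_seq_spec; intros eps.
assert (He : 0 < eps / 2) by (destruct eps; simpl; lra).
destruct (proj2 (is_lim_seq_spec _ _) (Series_tail_lim b Hb) (mkposreal _ He)) as [m Hm].
specialize (Hm m (le_n m)); simpl in Hm.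
destruct (proj2 (is_lim_seq_spec _ _) (rfsum_lim_0 d m Hl) (mkposreal _ He)) as [N HN].
exists N; intros n Hn; specialize (HN n Hn); simpl in HN.
assert (Hs : ex_series (d n)).
  apply ex_series_dom with b; [|exact Hb]; intros k; rewrite Rabs_pos_eq; apply Hd.
rewrite Rminus_0_r in *.
rewrite Rabs_pos_eq by (apply Series_nonneg; [intros; apply Hd|exact Hs]).
rewrite (Series_rfsum (d n) m Hs).
assert (Series (fun k => d n (m + k)%nat) <= Series (fun k => b (m + k)%nat)).
  apply Series_le; [intros; apply Hd|apply ex_series_shift, Hb].
pose proof (Rle_abs (rfsum (d n) m)); pose proof (Rle_abs (Series (fun k => b (m + k)%nat))).
lra.
Qed.

Lemma tannery (a : nat -> nat -> C) (b : nat -> C) (M : nat -> R) : ex_series M ->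
  (forall n k, Cmod (a n k) <= M k) -> (forall k, clim (fun n => a n k) (b k)) ->
  clim (fun n => csum (a n)) (csum b).
Proof.
intros HM Ha Hl.
assert (Hb : forall k, Cmod (b k) <= M k).
  intros k; apply Cmod_clim_le with (fun n => a n k); [intros; apply Ha|apply Hl].
pose proof (csummable_dom b M Hb HM) as Sb.
assert (Sa : forall n, csummable (a n)) by (intros n; apply (csummable_dom _ M (Ha n) HM)).
apply clim_squeeze with (fun n => Series (fun k => Cmod (a n k - b k)%C)).
  intros n; rewrite <- csum_minus by auto; apply Cmod_csum, csummable_minus; auto.
apply tannery_0 with (fun k => 2 * M k).
- apply (ex_series_Rscal 2 M); exact HM.
- intros n k; split; [apply Cmod_ge_0|].
  eapply Rle_trans; [apply Cmod_triangle|]; rewrite Cmod_opp; specialize (Ha n k); specialize (Hb k); lra.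
- exact Hl.
Qed.

Lemma csum_cfsum_swap (c : nat -> nat -> C) (m : nat) : (forall l, csummable (c l)) ->
  csummable (fun k => cfsum (fun l => c l k) m) /\
  cfsum (fun l => csum (c l)) m = csum (fun k => cfsum (fun l => c l k) m).
Proof.
intros H; induction m as [|m [IH1 IH2]]; simpl.
  split; [|rewrite csum_0; reflexivity].
  apply csummable_dom with (fun _ => 0); [intros; rewrite Cmod_0; lra|].
  exists 0; exact is_series_zero.
split; [apply csummable_plus; auto|].
rewrite csum_plus by auto; rewrite IH2; reflexivity.
Qed.

Lemma Cmod_cfsum (u : nat -> C) (m : nat) : Cmod (cfsum u m) <= rfsum (fun k => Cmod (u k)) m.
Proof.
induction m as [|m IH]; simpl; [rewrite Cmod_0; lra|].
eapply Rle_trans; [apply Cmod_triangle|lra].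
Qed.

Lemma rfsum_le (u v : nat -> R) (m : nat) : (forall k, (k < m)%nat -> u k <= v k) -> rfsum u m <= rfsum v m.
Proof.
induction m as [|m IH]; simpl; intros H; [lra|].
apply Rplus_le_compat; [apply IH; intros; apply H; lia|apply H; lia].
Qed.

Lemma rfsum_scal_r (u : nat -> R) (c : R) (m : nat) : rfsum (fun k => u k * c) m = rfsum u m * c.
Proof. induction m as [|m IH]; simpl; [|rewrite IH]; ring. Qed.

(** Fubini from [tannery]: the partial sums over l, taken inside the sum over k, are dominated by v
    k times the sum of u. *)
Lemma csum_swap (c : nat -> nat -> C) (u v : nat -> R) : ex_series u -> ex_series v ->
  (forall l k, Cmod (c l k) <= u l * v k) ->
  csum (fun l => csum (c l)) = csum (fun k => csum (fun l => c l k)).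
Proof.
intros Hu Hv H.
assert (Nv : forall l k, 0 <= u l * v k).
  intros l k; eapply Rle_trans; [apply Cmod_ge_0|apply H].
assert (Sv : forall l, ex_series (fun k => u l * v k)).
  intros l; apply (ex_series_Rscal (u l) v); exact Hv.
assert (Su : forall k, ex_series (fun l => u l * v k)).
  intros k; apply (ex_series_Rscal_r (v k) u); exact Hu.
assert (S1 : forall l, csummable (c l)) by (intros l; apply (csummable_dom _ _ (H l) (Sv l))).
assert (S2 : forall k, csummable (fun l => c l k)).
  intros k; apply (csummable_dom _ (fun l => u l * v k)); [intros; apply H|apply Su].
apply clim_unique with (cfsum (fun l => csum (c l))).
- apply cfsum_lim, csummable_dom with (fun l => u l * Series v).
  + intros l; rewrite <- Series_scal_l; apply Cmod_csum_le; [apply H|apply Sv].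
  + apply (ex_series_Rscal_r (Series v) u), Hu.
- apply clim_ext with (fun m => csum (fun k => cfsum (fun l => c l k) m)).
    intros m; symmetry; apply csum_cfsum_swap, S1.
  apply tannery with (fun k => Series u * v k).
  + apply (ex_series_Rscal (Series u) v); exact Hv.
  + intros n k; eapply Rle_trans; [apply Cmod_cfsum|].
    eapply Rle_trans; [apply rfsum_le; intros l _; apply (H l k)|].
    rewrite <- Series_scal_r; apply rfsum_le_Series; [intros; apply Nv|apply Su].
  + intros k; apply cfsum_lim, S2.
Qed.

(** * Complex derivatives *)

(* Quadratic remainder rather than [o(h)]: it is what makes termwise
   differentiation a plain domination argument. *)
Definition cderiv (f : C -> C) (z d : C) : Prop :=
  exists delta K : R, 0 < delta /\ 0 <= K /\
    forall h : C, Cmod h < delta -> Cmod (f (z + h) - f z - h * d)%C <= K * Cmod h ^ 2.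

Lemma cderiv_unique (f : C -> C) (z d e : C) : cderiv f z d -> cderiv f z e -> d = e.
Proof.
intros [d1 [K1 [Hd1 [HK1 H1]]]] [d2 [K2 [Hd2 [HK2 H2]]]].
assert (E : Cmod (d - e)%C = 0).
  destruct (Req_dec (Cmod (d - e)%C) 0) as [E|E]; [exact E|exfalso].
  assert (Hp : 0 < Cmod (d - e)%C) by (pose proof (Cmod_ge_0 (d - e)%C); lra).
  set (m := Cmod (d - e)%C) in *.
  (* A step t common to both remainders gives m t <= (K1 + K2) t^2, which this choice of t
     contradicts. *)
  set (t := Rmin (Rmin d1 d2 / 2) (m / (2 * (K1 + K2 + 1)))).
  assert (Ht : 0 < t /\ t < d1 /\ t < d2 /\ t * (2 * (K1 + K2 + 1)) <= m).
    assert (0 < Rmin d1 d2) by (apply Rmin_pos; lra).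
    pose proof (Rmin_l d1 d2); pose proof (Rmin_r d1 d2).
    pose proof (Rmin_l (Rmin d1 d2 / 2) (m / (2 * (K1 + K2 + 1)))); fold t in H4.
    pose proof (Rmin_r (Rmin d1 d2 / 2) (m / (2 * (K1 + K2 + 1)))); fold t in H5.
    assert (0 < m / (2 * (K1 + K2 + 1))) by (apply Rdiv_lt_0_compat; lra).
    split; [unfold t; apply Rmin_pos; lra|].
    split; [lra|split; [lra|]].
    apply Rmult_le_compat_r with (r := 2 * (K1 + K2 + 1)) in H5; [|lra].
    replace (m / (2 * (K1 + K2 + 1)) * (2 * (K1 + K2 + 1))) with m in H5 by (field; lra).
    exact H5.
  destruct Ht as [Ht0 [Ht1 [Ht2 Ht3]]].
  assert (Ct : Cmod t = t) by (rewrite Cmod_R, Rabs_pos_eq; lra).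
  specialize (H1 t); specialize (H2 t); rewrite Ct in H1, H2.
  assert (H3 : Cmod (t * (d - e))%C <= K1 * t ^ 2 + K2 * t ^ 2).
    replace (t * (d - e))%C with
      ((f (z + t) - f z - t * e) + - (f (z + t) - f z - t * d))%C by ring.
    eapply Rle_trans; [apply Cmod_triangle|]; rewrite Cmod_opp; lra.
  rewrite Cmod_mult, Ct in H3; fold m in H3; nra.
apply Cmod_eq_0 in E; replace d with (d - e + e)%C by ring; rewrite E; ring.
Qed.

Lemma cderiv_ext_loc (f g : C -> C) (z d : C) (r : R) : 0 < r ->
  (forall h : C, Cmod h < r -> f (z + h)%C = g (z + h)%C) -> cderiv f z d -> cderiv g z d.
Proof.
intros Hr E [d1 [K1 [Hd1 [HK1 H1]]]].
assert (E0 : f z = g z).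
  specialize (E 0%C); rewrite Cmod_0 in E; rewrite Cplus_0_r in E; auto.
exists (Rmin r d1), K1; split; [apply Rmin_pos; lra|split; [exact HK1|]].
intros h Hh; pose proof (Rmin_l r d1); pose proof (Rmin_r r d1).
rewrite <- E, <- E0 by lra; apply H1; lra.
Qed.

Lemma cderiv_ext (f g : C -> C) (z d : C) :
  (forall u, f u = g u) -> cderiv f z d -> cderiv g z d.
Proof. intros E; apply cderiv_ext_loc with 1; [lra|intros; apply E]. Qed.

Lemma cderiv_const (c z : C) : cderiv (fun _ => c) z 0%C.
Proof.
exists 1, 0; repeat split; try lra; intros h _.
replace (c - c - h * 0)%C with (RtoC 0) by ring; rewrite Cmod_0; lra.
Qed.

Lemma cderiv_plus (f g : C -> C) (z d e : C) : cderiv f z d -> cderiv g z e ->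
  cderiv (fun u => f u + g u)%C z (d + e)%C.
Proof.
intros [d1 [K1 [Hd1 [HK1 H1]]]] [d2 [K2 [Hd2 [HK2 H2]]]].
exists (Rmin d1 d2), (K1 + K2); split; [apply Rmin_pos; lra|split; [lra|]].
intros h Hh; pose proof (Rmin_l d1 d2); pose proof (Rmin_r d1 d2).
replace (_ - _)%C with
  ((f (z + h) - f z - h * d) + (g (z + h) - g z - h * e))%C by ring.
eapply Rle_trans; [apply Cmod_triangle|].
rewrite Rmult_plus_distr_r; apply Rplus_le_compat; [apply H1|apply H2]; lra.
Qed.

Lemma cderiv_bounded (f : C -> C) (z d : C) : cderiv f z d ->
  exists r B, 0 < r /\ 0 <= B /\ forall h, Cmod h < r -> Cmod (f (z + h) - f z)%C <= B * Cmod h.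
Proof.
intros [d1 [K1 [Hd1 [HK1 H1]]]].
exists (Rmin d1 1), (K1 + Cmod d); split; [apply Rmin_pos; lra|].
split; [pose proof (Cmod_ge_0 d); lra|].
intros h Hh; pose proof (Rmin_l d1 1); pose proof (Rmin_r d1 1).
replace (f (z + h) - f z)%C with ((f (z + h) - f z - h * d) + h * d)%C by ring.
eapply Rle_trans; [apply Cmod_triangle|]; rewrite Cmod_mult.
specialize (H1 h); pose proof (Cmod_ge_0 h).
assert (K1 * Cmod h ^ 2 <= K1 * Cmod h) by (apply Rmult_le_compat_l; [lra|nra]).
assert (Cmod h < d1) by lra; specialize (H1 H4); lra.
Qed.

Lemma cderiv_mult (f g : C -> C) (z d e : C) : cderiv f z d -> cderiv g z e ->
  cderiv (fun u => f u * g u)%C z (d * g z + f z * e)%C.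
Proof.
intros Hf Hg.
destruct (cderiv_bounded f z d Hf) as [r [B [Hr [HB Hfb]]]].
destruct (cderiv_bounded g z e Hg) as [r' [B' [Hr' [HB' Hgb]]]].
destruct Hf as [d1 [K1 [Hd1 [HK1 H1]]]]; destruct Hg as [d2 [K2 [Hd2 [HK2 H2]]]].
set (m := Rmin (Rmin d1 d2) (Rmin r r')).
pose proof (Cmod_ge_0 (f z)); pose proof (Cmod_ge_0 (g z)).
exists m, (K1 * Cmod (g z) + Cmod (f z) * K2 + B * B').
split; [unfold m; repeat apply Rmin_pos; lra|split].
  assert (0 <= K1 * Cmod (g z)) by (apply Rmult_le_pos; lra).
  assert (0 <= Cmod (f z) * K2) by (apply Rmult_le_pos; lra).
  assert (0 <= B * B') by (apply Rmult_le_pos; lra); lra.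
intros h Hh.
assert (Hm : Cmod h < d1 /\ Cmod h < d2 /\ Cmod h < r /\ Cmod h < r').
  unfold m in Hh; pose proof (Rmin_l d1 d2); pose proof (Rmin_r d1 d2).
  pose proof (Rmin_l r r'); pose proof (Rmin_r r r').
  pose proof (Rmin_l (Rmin d1 d2) (Rmin r r')); pose proof (Rmin_r (Rmin d1 d2) (Rmin r r')); lra.
destruct Hm as [Hm1 [Hm2 [Hm3 Hm4]]].
specialize (H1 h Hm1); specialize (H2 h Hm2); specialize (Hfb h Hm3); specialize (Hgb h Hm4).
replace (_ - _)%C with
  ((f (z + h) - f z - h * d) * g z + f z * (g (z + h) - g z - h * e)
    + (f (z + h) - f z) * (g (z + h) - g z))%C by ring.
eapply Rle_trans; [apply Cmod_triangle|].
eapply Rle_trans; [apply Rplus_le_compat_r, Cmod_triangle|].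
rewrite !Cmod_mult.
pose proof (Cmod_ge_0 h).
pose proof (Cmod_ge_0 (f (z + h) - f z)%C); pose proof (Cmod_ge_0 (g (z + h) - g z)%C).
assert (Cmod (f (z + h) - f z)%C * Cmod (g (z + h) - g z)%C <= B * Cmod h * (B' * Cmod h)).
  apply Rmult_le_compat; lra.
assert (Cmod (f (z + h) - f z - h * d)%C * Cmod (g z) <= K1 * Cmod h ^ 2 * Cmod (g z)).
  apply Rmult_le_compat_r; lra.
assert (Cmod (f z) * Cmod (g (z + h) - g z - h * e)%C <= Cmod (f z) * (K2 * Cmod h ^ 2)).
  apply Rmult_le_compat_l; lra.
nra.
Qed.

Lemma cderiv_scal (c : C) (f : C -> C) (z d : C) : cderiv f z d ->
  cderiv (fun u => c * f u)%C z (c * d)%C.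
Proof.
intros H; replace (c * d)%C with (0 * f z + c * d)%C by ring.
apply (cderiv_mult (fun _ => c) f); [apply cderiv_const|exact H].
Qed.

Lemma cexp_lin_taylor (c z h : C) : Cmod h <= 1 ->
  Cmod (cexp (c * (z + h)) - cexp (c * z) - h * (c * cexp (c * z)))%C
  <= 2 * Cmod c ^ 2 * exp (Cmod c * Cmod h) * exp (Re (c * z)%C) * Cmod h ^ 2.
Proof.
intros Hh.
replace (c * (z + h))%C with (c * z + c * h)%C by ring; rewrite cexp_add.
replace (_ - _)%C with (cexp (c * z) * (cexp (c * h) - 1 - c * h))%C by ring.
rewrite Cmod_mult, Cmod_cexp.
pose proof (cexp_taylor1 (c * h)%C) as H; rewrite Cmod_mult in H.
apply Rmult_le_compat_l with (r := exp (Re (c * z)%C)) in H; [|left; apply exp_pos].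
eapply Rle_trans; [exact H|]; right; ring.
Qed.

Lemma cderiv_cexp_lin (c z : C) : cderiv (fun u => cexp (c * u)) z (c * cexp (c * z))%C.
Proof.
exists 1, (2 * Cmod c ^ 2 * exp (Cmod c * 1) * exp (Re (c * z)%C)).
pose proof (exp_pos (Cmod c * 1)); pose proof (exp_pos (Re (c * z)%C)).
pose proof (pow2_ge_0 (Cmod c)).
split; [lra|split; [apply Rmult_le_pos; [apply Rmult_le_pos|]; lra|]].
intros h Hh.
eapply Rle_trans; [apply cexp_lin_taylor; lra|].
apply Rmult_le_compat_r; [apply pow2_ge_0|].
apply Rmult_le_compat_r; [lra|].
apply Rmult_le_compat_l; [lra|].
pose proof (Cmod_ge_0 c); pose proof (Cmod_ge_0 h).
assert (Cmod c * Cmod h <= Cmod c * 1) by (apply Rmult_le_compat_l; lra).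
destruct H4 as [H4|H4]; [left; apply exp_increasing; lra|rewrite H4; lra].
Qed.

Lemma Cmod_gap (v h : C) : Cmod v - Cmod h <= Cmod (v + h)%C.
Proof.
pose proof (Cmod_triangle (v + h) (- h))%C as T; rewrite Cmod_opp in T.
replace (v + h + - h)%C with v in T by ring; lra.
Qed.

(** The explicit quadratic remainder, controlled by |v| - |h| alone, is what [cderiv_csum] needs to
    differentiate the lattice sums and [yfun] term by term. *)
Lemma invpow_taylor (v h : C) (j : nat) : Cmod h < Cmod v ->
  Cmod ((/ (v + h)) ^ j - (/ v) ^ j + INR j * h * (/ v) ^ (S j))%C
  <= INR j * INR (S j) / 2 * Cmod h ^ 2 * (/ (Cmod v - Cmod h)) ^ (S (S j)).
Proof.
intros H.
assert (Hv : v <> 0%C) by (intros E; rewrite E, Cmod_0 in H; pose proof (Cmod_ge_0 h); lra).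
pose proof (Cmod_gap v h) as G.
assert (Hvh : (v + h)%C <> 0%C) by (intros E; rewrite E, Cmod_0 in G; lra).
set (rho := Cmod v - Cmod h) in *.
assert (Hrho : 0 < rho) by (unfold rho; lra).
assert (I1 : Cmod (/ (v + h))%C <= / rho).
  rewrite Cmod_inv by exact Hvh; apply Rinv_le_contravar; lra.
assert (I2 : Cmod (/ v)%C <= / rho).
  rewrite Cmod_inv by exact Hv; apply Rinv_le_contravar; [lra|unfold rho; pose proof (Cmod_ge_0 h); lra].
induction j as [|j IH].
  simpl; match goal with |- Cmod ?u <= _ => replace u with (RtoC 0) by ring end.
  rewrite Cmod_0; right; field; lra.
replace ((/ (v + h)) ^ (S j) - (/ v) ^ (S j) + INR (S j) * h * (/ v) ^ (S (S j)))%C with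
  (((/ (v + h)) ^ j - (/ v) ^ j + INR j * h * (/ v) ^ (S j)) * / (v + h)
    + INR (S j) * (h * h) * (/ v) ^ (S (S j)) * / (v + h))%C.
2:{ rewrite S_INR, RtoC_plus; simpl Cpow; field; split; assumption. }
eapply Rle_trans; [apply Cmod_triangle|].
rewrite !Cmod_mult, Cmod_pow, Cmod_R, (Rabs_pos_eq (INR (S j))) by apply pos_INR.
pose proof (Cmod_ge_0 h); pose proof (Cmod_ge_0 (/ v)%C); pose proof (Cmod_ge_0 (/ (v + h))%C).
assert (P : forall k, 0 <= (/ rho) ^ k) by (intros; apply pow_le; left; apply Rinv_0_lt_compat; lra).
assert (A1 : Cmod ((/ (v + h)) ^ j - (/ v) ^ j + INR j * h * (/ v) ^ S j)%C * Cmod (/ (v + h))%C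
   <= INR j * INR (S j) / 2 * Cmod h ^ 2 * (/ rho) ^ S (S j) * / rho).
  apply Rmult_le_compat; try apply Cmod_ge_0; [exact IH|exact I1].
assert (A2 : Cmod (/ v)%C ^ S (S j) * Cmod (/ (v + h))%C <= (/ rho) ^ S (S j) * / rho).
  apply Rmult_le_compat; try (apply pow_le); try assumption; apply pow_incr; split; assumption.
assert (A3 : INR (S j) * (Cmod h * Cmod h) * Cmod (/ v)%C ^ S (S j) * Cmod (/ (v + h))%C
   <= INR (S j) * (Cmod h * Cmod h) * ((/ rho) ^ S (S j) * / rho)).
  rewrite Rmult_assoc; apply Rmult_le_compat_l; [|exact A2].
  apply Rmult_le_pos; [apply pos_INR|nra].
eapply Rle_trans; [apply Rplus_le_compat; [exact A1|exact A3]|].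
right; rewrite !S_INR; simpl; field; lra.
Qed.

Lemma cderiv_csum (f : nat -> C -> C) (z : C) (d : nat -> C) (delta : R) (K : nat -> R) :
  0 < delta -> ex_series K ->
  (forall h, Cmod h < delta -> csummable (fun k => f k (z + h)%C)) -> csummable d ->
  (forall k h, Cmod h < delta -> Cmod (f k (z + h) - f k z - h * d k)%C <= K k * Cmod h ^ 2) ->
  cderiv (fun u => csum (fun k => f k u)) z (csum d).
Proof.
intros Hd HK Hf Sd H.
assert (Hf0 : csummable (fun k => f k z)).
  apply csummable_ext with (fun k => f k (z + 0)%C); [intros; rewrite Cplus_0_r; reflexivity|].
  apply Hf; rewrite Cmod_0; lra.
exists delta, (Rabs (Series K)); split; [exact Hd|split; [apply Rabs_pos|]].
intros h Hh.
rewrite <- csum_scal, <- !csum_minus; auto.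
2: apply csummable_minus; auto.
2: apply csummable_scal, Sd.
eapply Rle_trans; [apply Cmod_csum_le with (b := fun k => K k * Cmod h ^ 2)|].
- intros k; apply H, Hh.
- apply ex_series_Rscal_r, HK.
- rewrite Series_scal_r; apply Rmult_le_compat_r; [apply pow2_ge_0|apply Rle_abs].
Qed.

Lemma cfsum_split_l (u : nat -> C) (m : nat) :
  cfsum u (S m) = (u O + cfsum (fun k => u (S k)) m)%C.
Proof.
induction m as [|m IH]; [simpl; ring|].
change (cfsum u (S (S m))) with (cfsum u (S m) + u (S m))%C.
rewrite IH; simpl; ring.
Qed.

Lemma cfsum_ext (u v : nat -> C) (m : nat) :
  (forall k, (k < m)%nat -> u k = v k) -> cfsum u m = cfsum v m.
Proof.
induction m as [|m IH]; simpl; intros H; [reflexivity|].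
rewrite IH, H by (intros; try apply H; lia); reflexivity.
Qed.

Lemma cfsum_plus (u v : nat -> C) (m : nat) :
  cfsum (fun k => u k + v k)%C m = (cfsum u m + cfsum v m)%C.
Proof. induction m as [|m IH]; simpl; [|rewrite IH]; ring. Qed.

Lemma cfsum_scal (c : C) (u : nat -> C) (m : nat) :
  cfsum (fun k => c * u k)%C m = (c * cfsum u m)%C.
Proof. induction m as [|m IH]; simpl; [|rewrite IH]; ring. Qed.

(** The second block is reversed because [psi_pair_dup] sends the index k to k and to 2^(n+1) - 1 -
    k. *)
Lemma cfsum_rev (u : nat -> C) (m p : nat) :
  cfsum u (m + p) = (cfsum u m + cfsum (fun k => u (m + p - 1 - k)%nat) p)%C.
Proof.
induction p as [|p IH]; [simpl; rewrite Nat.add_0_r; ring|].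
rewrite cfsum_split_l; replace (m + S p)%nat with (S (m + p)) by lia; simpl cfsum at 1.
rewrite IH; replace (S (m + p) - 1 - 0)%nat with (m + p)%nat by lia.
replace (cfsum (fun k => u (S (m + p) - 1 - S k)%nat) p)
  with (cfsum (fun k => u (m + p - 1 - k)%nat) p); [ring|].
apply cfsum_ext; intros; f_equal; lia.
Qed.

Lemma csum_finite (u : nat -> C) (m : nat) :
  csum (fun k => if Nat.ltb k m then u k else 0%C) = cfsum u m.
Proof.
assert (S0 : csummable (fun k => if Nat.ltb k m then u k else 0%C)).
  unfold csummable; apply ex_series_bounded with (rfsum (fun k => Cmod (u k)) m).
    intros; apply Cmod_ge_0.
  intros n; revert m; induction n as [|n IH]; intros m; simpl.
    clear; induction m; simpl; [lra|pose proof (Cmod_ge_0 (u m)); lra].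
  destruct (Nat.ltb_spec n m) as [H|H].
    clear IH; assert (forall p, rfsum (fun k => Cmod (u k)) (S n) <= rfsum (fun k => Cmod (u k)) (S n + p)).
      induction p; [rewrite Nat.add_0_r; lra|rewrite Nat.add_succ_r; simpl in *;
        pose proof (Cmod_ge_0 (u (S (n + p)))); lra].
    specialize (H0 (m - S n)%nat); replace (S n + (m - S n))%nat with m in H0 by lia.
    eapply Rle_trans; [|exact H0]; simpl; apply Rplus_le_compat_r.
    apply rfsum_le; intros k Hk; replace (Nat.ltb k m) with true; [lra|].
    symmetry; apply Nat.ltb_lt; lia.
  rewrite Cmod_0, Rplus_0_r; apply IH.
rewrite (csum_cfsum _ m S0).
replace (csum _) with (RtoC 0).
  rewrite Cplus_0_r; apply cfsum_ext; intros k Hk.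
  replace (Nat.ltb k m) with true; [reflexivity|symmetry; apply Nat.ltb_lt; exact Hk].
symmetry; transitivity (csum (fun _ => 0%C)); [|apply csum_0].
apply csum_ext; intros k.
replace (Nat.ltb (m + k) m) with false; [reflexivity|symmetry; apply Nat.ltb_ge; lia].
Qed.

(** * Partial fractions of the cotangent *)

Definition I2 : C := (2 * PI * Ci)%C.

(** This is coth (w / 2) / 2: the 1/2 makes the function odd, and its poles are the multiples of
    [I2]. *)
Definition psi (w : C) : C := (/ 2 + / (cexp w - 1))%C.

Lemma Cminus_neq_0 (a b : C) : a <> b -> (a - b)%C <> 0%C.
Proof. intros H E; apply H; replace a with (a - b + b)%C by ring; rewrite E; ring. Qed.

Lemma RtoC_neq_0 (x : R) : x <> 0 -> RtoC x <> 0%C.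
Proof. intros H E; apply H, RtoC_inj, E. Qed.

Lemma C2_neq_0 : RtoC 2 <> 0%C.
Proof. apply RtoC_neq_0; lra. Qed.

(** The half period is a parameter because both PI i and - PI i are used: translates must be moved
    towards either end of the lattice. *)
Lemma psi_dup (v i : C) : cexp i = (-1)%C -> cexp (2 * v)%C <> 1%C ->
  psi (2 * v)%C = (/ 2 * (psi v + psi (v + i)))%C /\ cexp v <> 1%C /\ cexp (v + i)%C <> 1%C.
Proof.
intros Hi H; unfold psi; rewrite cexp_add, Hi.
assert (E : cexp (2 * v)%C = (cexp v * cexp v)%C).
  rewrite <- cexp_add; f_equal; ring.
rewrite E in *; set (u := cexp v) in *.
assert (H1 : u <> 1%C) by (intros H1; apply H; rewrite H1; ring).
assert (H2 : (u * -1)%C <> 1%C).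
  intros H2; apply H; replace (u * u)%C with ((u * -1) * (u * -1))%C by ring; rewrite H2; ring.
split; [|split; [exact H1|exact H2]].
pose proof (Cminus_neq_0 _ _ H) as N; pose proof (Cminus_neq_0 _ _ H1) as N1.
pose proof (Cminus_neq_0 _ _ H2) as N2; pose proof C2_neq_0.
field; repeat split; try assumption.
Qed.

Lemma cexp_mPI : cexp (- (PI * Ci))%C = (- 1)%C.
Proof. rewrite cexp_opp, cexp_iPI; field. Qed.

Lemma cexp_shift (w : C) (k : nat) : cexp (w + INR k * I2)%C = cexp w.
Proof. unfold I2; rewrite cexp_add, cexp_2iPI_nat; ring. Qed.

Lemma cexp_shift_neg (w : C) (k : nat) : cexp (w - INR k * I2)%C = cexp w.
Proof.
rewrite <- (cexp_shift (w - INR k * I2) k); f_equal; ring.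
Qed.

Definition half (n : nat) : R := (/ 2) ^ n.

Lemma half_pos (n : nat) : 0 < half n.
Proof. apply pow_lt; lra. Qed.

Lemma half_S (n : nat) : RtoC (half n) = (2 * half (S n))%C.
Proof. rewrite <- RtoC_mult; f_equal; unfold half; simpl; field. Qed.

Lemma half_pow (n : nat) : half n * INR (2 ^ n) = 1.
Proof.
induction n as [|n IH]; [unfold half; simpl; ring|].
replace (2 ^ S n)%nat with (2 ^ n + 2 ^ n)%nat by (simpl; lia).
rewrite plus_INR; unfold half in *; simpl; lra.
Qed.

Lemma cexp_half_neq_1 (u : C) (n : nat) : cexp u <> 1%C -> cexp (half n * u)%C <> 1%C.
Proof.
intros H E; apply H.
replace u with (INR (2 ^ n) * (half n * u))%C.
  rewrite cexp_nat, E; apply Cpow_1_l.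
rewrite Cmult_assoc, <- RtoC_mult, (Rmult_comm (INR _)), half_pow; ring.
Qed.

(** Pairing the translate k with the translate -(k + 1) uses each of them once and makes the pairs
    decay like 1 / k^2. *)
Definition psi_pair (w : C) (n k : nat) : C :=
  (psi (half n * (w + INR k * I2)) + psi (half n * (w - INR (S k) * I2)))%C.

(** The half period is subtracted at the translate k and added at the translate -(k + 1); the two
    new points then form the pair of index 2^(n+1) - 1 - k. *)
Lemma psi_pair_dup (w : C) (n k : nat) : cexp w <> 1%C -> (k < 2 ^ S n)%nat ->
  psi_pair w (S n) k
  = (/ 2 * (psi_pair w (S (S n)) k + psi_pair w (S (S n)) (2 ^ S n - 1 - k)))%C.
Proof.
intros Hw Hk; unfold psi_pair.
set (k' := (2 ^ S n - 1 - k)%nat).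
assert (Ek : INR (S k') = INR (2 ^ S n) - INR k).
  rewrite <- minus_INR by lia; f_equal; unfold k'; lia.
assert (Ek2 : INR k' = INR (2 ^ S n) - INR (S k)).
  rewrite <- minus_INR by lia; f_equal; unfold k'; lia.
assert (EP : (half (S (S n)) * INR (2 ^ S n) * I2 = PI * Ci)%C).
  replace (half (S (S n)) * INR (2 ^ S n) * I2)%C
    with ((half (S (S n)) * 2 * INR (2 ^ S n)) * (PI * Ci))%C by (unfold I2; ring).
  replace (half (S (S n)) * 2)%C with (RtoC (half (S n))) by (rewrite half_S; ring).
  rewrite <- RtoC_mult, half_pow; ring.
rewrite !(half_S (S n)), <- !Cmult_assoc.
destruct (psi_dup (half (S (S n)) * (w + INR k * I2))%C (- (PI * Ci))%C) as [E1 _].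
- exact cexp_mPI.
- rewrite Cmult_assoc, <- half_S; apply cexp_half_neq_1; rewrite cexp_shift; exact Hw.
- destruct (psi_dup (half (S (S n)) * (w - INR (S k) * I2))%C (PI * Ci)%C) as [E2 _].
  + exact cexp_iPI.
  + rewrite Cmult_assoc, <- half_S; apply cexp_half_neq_1; rewrite cexp_shift_neg; exact Hw.
  + rewrite E1, E2.
    replace (half (S (S n)) * (w + INR k * I2) + - (PI * Ci))%C
      with (half (S (S n)) * (w - INR (S k') * I2))%C.
    2:{ rewrite <- EP, Ek, RtoC_minus; ring. }
    replace (half (S (S n)) * (w - INR (S k) * I2) + PI * Ci)%C
      with (half (S (S n)) * (w + INR k' * I2))%C.
    2:{ rewrite <- EP, Ek2, RtoC_minus; ring. }
    ring.
Qed.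

(* Herglotz's trick: iterating the duplication formula [psi_dup] turns [psi] into a sum over [2 ^ n]
   pairs of half-period translates, which tends to the partial fraction expansion. *)
Lemma psi_pairs (w : C) (n : nat) : cexp w <> 1%C ->
  psi w = (half (S n) * cfsum (psi_pair w (S n)) (2 ^ n))%C.
Proof.
intros Hw; induction n as [|n IH].
  simpl; unfold psi_pair.
  destruct (psi_dup (half 1 * w)%C (- (PI * Ci))%C) as [E _].
  - exact cexp_mPI.
  - rewrite Cmult_assoc, <- half_S; apply cexp_half_neq_1; exact Hw.
  - rewrite Cmult_assoc, <- half_S in E.
    replace (half 0 * w)%C with w in E by (unfold half; simpl; ring).
    rewrite E.
    replace (half 1 * w + - (PI * Ci))%C with (half 1 * (w - INR 1 * I2))%C.
    2:{ unfold half, I2; simpl; rewrite Rmult_1_r, RtoC_inv by lra; field; apply C2_neq_0. }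
    replace (half 1 * (w + INR 0 * I2))%C with (half 1 * w)%C by (simpl; ring).
    replace (RtoC (half 1)) with (/ 2)%C by (unfold half; simpl; rewrite Rmult_1_r, RtoC_inv by lra; reflexivity).
    ring.
rewrite IH, (cfsum_ext _ (fun k => / 2 * (psi_pair w (S (S n)) k + psi_pair w (S (S n)) (2 ^ S n - 1 - k)))%C).
2:{ intros k Hk; apply psi_pair_dup; [exact Hw|simpl; lia]. }
rewrite cfsum_scal, cfsum_plus.
pose proof (cfsum_rev (psi_pair w (S (S n))) (2 ^ n) (2 ^ n)) as R.
replace (2 ^ n + 2 ^ n)%nat with (2 ^ S n)%nat in R by (simpl; lia).
rewrite R, (half_S (S n)); field; apply C2_neq_0.
Qed.

Lemma rfsum_inv_sq (n : nat) : rfsum (fun k => / (INR k + 1) ^ 2) (S n) <= 2 - / (INR n + 1).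
Proof.
induction n as [|n IH]; [simpl; lra|].
change (rfsum (fun k => / (INR k + 1) ^ 2) (S n) + / (INR (S n) + 1) ^ 2 <= 2 - / (INR (S n) + 1)).
rewrite S_INR in *; pose proof (pos_INR n).
assert (E : 2 - / (INR n + 1 + 1) - (2 - / (INR n + 1)) - / (INR n + 1 + 1) ^ 2
  = / ((INR n + 1 + 1) ^ 2 * (INR n + 1))) by (field; lra).
assert (0 < / ((INR n + 1 + 1) ^ 2 * (INR n + 1))).
  apply Rinv_0_lt_compat; apply Rmult_lt_0_compat; [apply pow_lt|]; lra.
lra.
Qed.

Lemma inv_sq_pos (k : nat) : 0 < / (INR k + 1) ^ 2.
Proof. apply Rinv_0_lt_compat, pow_lt; pose proof (pos_INR k); lra. Qed.

Lemma rfsum_inv_sq_le (n : nat) : rfsum (fun k => / (INR k + 1) ^ 2) n <= 2.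
Proof.
destruct n as [|n]; [simpl; lra|].
pose proof (rfsum_inv_sq n); pose proof (pos_INR n).
assert (0 < / (INR n + 1)) by (apply Rinv_0_lt_compat; lra); lra.
Qed.

Lemma ex_series_inv_sq : ex_series (fun k => / (INR k + 1) ^ 2).
Proof.
apply ex_series_bounded with 2; [intros; left; apply inv_sq_pos|apply rfsum_inv_sq_le].
Qed.

Lemma Series_inv_sq_le : Series (fun k => / (INR k + 1) ^ 2) <= 2.
Proof.
apply (is_lim_seq_le (rfsum (fun k => / (INR k + 1) ^ 2)) (fun _ => 2)
  (Series (fun k => / (INR k + 1) ^ 2)) 2 rfsum_inv_sq_le);
  [apply rfsum_lim, ex_series_inv_sq|apply is_lim_seq_const].
Qed.

(** A quantitative form of w being off the lattice: the distances grow linearly, so every lattice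
    sum has a majorant in 1 / (k + 1)^2. *)
Definition latb (c0 : R) (w : C) : Prop := 0 < c0 /\ forall k,
  c0 * (INR k + 1) <= Cmod (w + INR k * I2)%C /\
  c0 * (INR k + 1) <= Cmod (w - INR (S k) * I2)%C.

(** Beyond some rank the affine bound is enough; before it, a minimum of finitely many positive
    numbers is. *)
Lemma linear_lower_bound (x : nat -> R) (al be : R) : 0 < al ->
  (forall k, 0 < x k) -> (forall k, al * INR k - be <= x k) ->
  exists c, 0 < c /\ forall k, c * (INR k + 1) <= x k.
Proof.
intros Hal Hx Hb.
assert (F : forall n, exists c, 0 < c /\ forall k, (k < n)%nat -> c * (INR k + 1) <= x k).
  induction n as [|n [c [Hc IH]]]; [exists 1; split; [lra|intros; lia]|].
  pose proof (pos_INR n); specialize (Hx n).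
  exists (Rmin c (x n / (INR n + 1))); split.
    apply Rmin_pos; [lra|apply Rdiv_lt_0_compat; lra].
  intros k Hk; pose proof (pos_INR k); destruct (Nat.eq_dec k n) as [->|Hne].
    eapply Rle_trans; [apply Rmult_le_compat_r; [lra|apply Rmin_r]|].
    right; field; lra.
  eapply Rle_trans; [apply Rmult_le_compat_r; [lra|apply Rmin_l]|]; apply IH; lia.
destruct (nfloor_ex (Rmax 0 ((Rabs be + al) / (al / 2)))) as [n [_ Hn]]; [apply Rmax_l|].
destruct (F (S n)) as [c [Hc Hs]].
exists (Rmin c (al / 2)); split; [apply Rmin_pos; lra|].
intros k; pose proof (pos_INR k).
destruct (Nat.lt_ge_cases k (S n)) as [H1|H1].
  eapply Rle_trans; [apply Rmult_le_compat_r; [lra|apply Rmin_l]|]; apply Hs, H1.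
eapply Rle_trans; [apply Rmult_le_compat_r; [lra|apply Rmin_r]|].
eapply Rle_trans; [|apply Hb].
apply le_INR in H1; rewrite S_INR in H1.
pose proof (Rmax_r 0 ((Rabs be + al) / (al / 2))).
assert (Hk : (Rabs be + al) / (al / 2) <= INR k) by lra.
apply Rmult_le_compat_r with (r := al / 2) in Hk; [|lra].
unfold Rdiv at 1 in Hk; rewrite Rmult_assoc, Rinv_l, Rmult_1_r in Hk by lra.
pose proof (Rle_abs be); lra.
Qed.

Lemma Cmod_I2 : Cmod I2 = 2 * PI.
Proof.
unfold I2; rewrite !Cmod_mult, Cmod_Ci, !Cmod_R, !Rabs_pos_eq; pose proof PI_RGT_0; lra.
Qed.

Lemma Cmod_nat_I2 (k : nat) : Cmod (INR k * I2)%C = 2 * PI * INR k.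
Proof. rewrite Cmod_mult, Cmod_I2, Cmod_R, Rabs_pos_eq by apply pos_INR; ring. Qed.

Lemma latb_ex (w : C) : (forall k, (w + INR k * I2)%C <> 0%C) ->
  (forall k, (w - INR (S k) * I2)%C <> 0%C) -> exists c0, latb c0 w.
Proof.
intros H1 H2; pose proof PI_RGT_0.
destruct (linear_lower_bound (fun k => Cmod (w + INR k * I2)%C) (2 * PI) (Cmod w)) as [c [Hc Hcs]].
- lra.
- intros k; apply Cmod_gt_0, H1.
- intros k; rewrite <- Cmod_nat_I2, Cplus_comm; apply Cmod_gap.
- destruct (linear_lower_bound (fun k => Cmod (w - INR (S k) * I2)%C) (2 * PI) (Cmod w)) as [d [Hd Hds]].
  + lra.
  + intros k; apply Cmod_gt_0, H2.
  + intros k; eapply Rle_trans with (2 * PI * INR (S k) - Cmod w); [rewrite S_INR; lra|].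
    rewrite <- Cmod_nat_I2, <- (Cmod_opp (w - _)%C).
    replace (- (w - INR (S k) * I2))%C with (INR (S k) * I2 + - w)%C by ring.
    rewrite <- (Cmod_opp w); apply Cmod_gap.
  + exists (Rmin c d); split; [apply Rmin_pos; lra|].
    intros k; pose proof (pos_INR k); split.
    * eapply Rle_trans; [apply Rmult_le_compat_r; [lra|apply Rmin_l]|apply Hcs].
    * eapply Rle_trans; [apply Rmult_le_compat_r; [lra|apply Rmin_r]|apply Hds].
Qed.

Lemma cexp_latb (w : C) : cexp w <> 1%C -> exists c0, latb c0 w.
Proof.
intros H; apply latb_ex; intros k E; apply H.
- rewrite <- (cexp_shift w k), E; apply cexp_0.
- rewrite <- (cexp_shift_neg w (S k)), E; apply cexp_0.
Qed.

Lemma latb_neq_0 (c0 : R) (w : C) (k : nat) : latb c0 w ->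
  (w + INR k * I2)%C <> 0%C /\ (w - INR (S k) * I2)%C <> 0%C.
Proof.
intros [Hc H]; specialize (H k); pose proof (pos_INR k).
assert (0 < c0 * (INR k + 1)) by (apply Rmult_lt_0_compat; lra).
split; apply Cmod_gt_0; lra.
Qed.

(** Eisenstein sums over the multiples of 2 pi i, paired as in [psi_pair] so that the exponent j = 1
    converges absolutely too. *)
Definition lterm (j : nat) (w : C) (k : nat) : C :=
  ((/ (w + INR k * I2)) ^ j + (/ (w - INR (S k) * I2)) ^ j)%C.

Definition lsum (j : nat) (w : C) : C := csum (lterm j w).

Lemma Cmod_inv_le (u : C) (c : R) : 0 < c -> c <= Cmod u -> Cmod (/ u)%C <= / c.
Proof.
intros Hc H; rewrite Cmod_inv; [apply Rinv_le_contravar; lra|].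
apply Cmod_gt_0; lra.
Qed.

Lemma Cmod_invpow_le (u : C) (c : R) (j k : nat) : 0 < c -> c * (INR k + 1) <= Cmod u ->
  Cmod ((/ u) ^ S (S j))%C <= (/ c) ^ S (S j) * / (INR k + 1) ^ 2.
Proof.
intros Hc H; pose proof (pos_INR k).
assert (H1 : Cmod (/ u)%C <= / c * / (INR k + 1)).
  rewrite <- Rinv_mult; apply Cmod_inv_le; [apply Rmult_lt_0_compat; lra|exact H].
assert (I0 : 0 < / c) by (apply Rinv_0_lt_compat; lra).
assert (I1 : 0 < / (INR k + 1) <= 1).
  split; [apply Rinv_0_lt_compat; lra|].
  pose proof (Rinv_le_contravar 1 (INR k + 1)) as X; rewrite Rinv_1 in X; apply X; lra.
rewrite Cmod_pow.
eapply Rle_trans; [apply pow_incr; split; [apply Cmod_ge_0|exact H1]|].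
rewrite Rpow_mult_distr; apply Rmult_le_compat_l; [apply pow_le; lra|].
rewrite <- pow_inv; set (t := / (INR k + 1)) in *.
change (t * (t * t ^ j) <= t * (t * 1)).
assert (t ^ j <= 1) by (rewrite <- (pow1 j); apply pow_incr; lra).
assert (0 <= t ^ j) by (apply pow_le; lra).
apply Rmult_le_compat_l; [lra|]; apply Rmult_le_compat_l; lra.
Qed.

Lemma Cmod_pair_le (w : C) (c0 : R) (k : nat) : latb c0 w ->
  Cmod (/ ((w + INR k * I2) * (w - INR (S k) * I2)))%C <= (/ c0) ^ 2 * / (INR k + 1) ^ 2.
Proof.
intros [Hc H]; destruct (H k) as [H1 H2]; pose proof (pos_INR k).
assert (0 < c0 * (INR k + 1)) by (apply Rmult_lt_0_compat; lra).
rewrite <- pow_inv, <- Rpow_mult_distr, <- Rinv_mult, pow_inv.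
apply Cmod_inv_le; [apply pow_lt; lra|].
rewrite Cmod_mult.
replace ((c0 * (INR k + 1)) ^ 2) with (c0 * (INR k + 1) * (c0 * (INR k + 1))) by ring.
apply Rmult_le_compat; lra.
Qed.

Lemma csummable_lterm (c0 : R) (w : C) (j : nat) : latb c0 w -> csummable (lterm (S j) w).
Proof.
intros H; destruct j as [|j].
(* Single inverses are not summable, but the pair has a numerator 2 w - I2 that does not depend on
   k. *)
- apply csummable_ext with
    (fun k => (2 * w - I2) * / ((w + INR k * I2) * (w - INR (S k) * I2)))%C.
    intros k; unfold lterm; destruct (latb_neq_0 c0 w k H) as [N1 N2].
    rewrite S_INR, RtoC_plus in *; simpl; field; split; assumption.
  apply csummable_scal, csummable_dom with (fun k => (/ c0) ^ 2 * / (INR k + 1) ^ 2).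
    intros k; apply Cmod_pair_le, H.
  apply ex_series_Rscal, ex_series_inv_sq.
- destruct H as [Hc H].
  apply csummable_plus; apply csummable_dom with (fun k => (/ c0) ^ S (S j) * / (INR k + 1) ^ 2);
    try (apply ex_series_Rscal, ex_series_inv_sq); intros k; apply Cmod_invpow_le; apply Hc || apply H.
Qed.

Lemma half_lim : is_lim_seq half 0.
Proof. apply is_lim_seq_geom; rewrite Rabs_pos_eq; lra. Qed.

Lemma clim_squeeze_loc (u : nat -> C) (l : C) (e : nat -> R) :
  eventually (fun n => Cmod (u n - l)%C <= e n) -> is_lim_seq e 0 -> clim u l.
Proof.
intros H He; apply is_lim_seq_le_le_loc with (fun _ => 0) e; [|apply is_lim_seq_const|exact He].
destruct H as [N HN]; exists N; intros n Hn; split; [apply Cmod_ge_0|apply HN, Hn].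
Qed.

Lemma half_small (B : R) : eventually (fun n => half n * B <= / 2).
Proof.
assert (H : is_lim_seq (fun n => half n * B) 0).
  replace (Finite 0) with (Rbar_mult 0 B) by (simpl; f_equal; ring).
  apply is_lim_seq_scal_r, half_lim.
assert (Hp : 0 < / 2) by lra.
destruct (proj2 (is_lim_seq_spec _ _) H (mkposreal _ Hp)) as [N HN].
exists N; intros n Hn; specialize (HN n Hn); simpl in HN; rewrite Rminus_0_r in HN.
pose proof (Rle_abs (half n * B)); lra.
Qed.

(** The residue 1 of [psi] at 0: each term of the duplicated sum tends to a term of the partial
    fraction expansion. *)
Lemma psi_scaled_lim (v : C) : v <> 0%C ->
  clim (fun n => half n * psi (half n * v))%C (/ v)%C.
Proof.
intros Hv; assert (Pv : 0 < Cmod v) by (apply Cmod_gt_0, Hv).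
apply clim_squeeze_loc with (fun n => half n * (/ 2 + 12 * exp 1)).
2:{ replace (Finite 0) with (Rbar_mult 0 (/ 2 + 12 * exp 1)) by (simpl; f_equal; ring).
    apply is_lim_seq_scal_r, half_lim. }
destruct (half_small (Cmod v)) as [N HN]; exists N; intros n Hn; specialize (HN n Hn).
pose proof (half_pos n) as He; set (e := half n) in *.
assert (Mev : Cmod (e * v)%C = e * Cmod v) by (rewrite Cmod_mult, Cmod_R, Rabs_pos_eq; lra).
pose proof (re_le_Cmod (e * v)%C); pose proof (im_le_Cmod (e * v)%C).
assert (G : Cmod (e * v)%C / 6 <= Cmod (cexp (e * v) - 1)%C).
  apply Cmod_cexp_m1_ge; lra.
assert (Hp : 0 < Cmod (e * v)%C) by (rewrite Mev; apply Rmult_lt_0_compat; lra).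
assert (N1 : (cexp (e * v) - 1)%C <> 0%C) by (apply Cmod_gt_0; lra).
replace (e * psi (e * v) - / v)%C with
  (e * (/ 2) + - (cexp (e * v) - 1 - e * v) * / (v * (cexp (e * v) - 1)))%C.
2:{ unfold psi; field; repeat split; try assumption; apply C2_neq_0. }
eapply Rle_trans; [apply Cmod_triangle|].
rewrite !Cmod_mult, Cmod_opp.
pose proof (cexp_taylor1 (e * v)%C) as T.
replace (Cmod (/ 2)%C) with (/ 2).
2:{ rewrite Cmod_inv by apply C2_neq_0; rewrite Cmod_R, Rabs_pos_eq; lra. }
rewrite Cmod_R, Rabs_pos_eq by lra.
assert (D : Cmod (/ (v * (cexp (e * v) - 1)))%C <= / (Cmod v * (e * Cmod v / 6))).
  apply Cmod_inv_le; [apply Rmult_lt_0_compat; [lra|rewrite Mev in Hp; lra]|].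
  rewrite Cmod_mult; apply Rmult_le_compat_l; lra.
assert (X : exp (Cmod (e * v)%C) <= exp 1) by (left; apply exp_increasing; lra).
assert (T2 : Cmod (cexp (e * v) - 1 - e * v)%C <= 2 * (e * Cmod v) ^ 2 * exp 1).
  eapply Rle_trans; [exact T|]; rewrite Mev in *; apply Rmult_le_compat_l; [|exact X].
  pose proof (pow2_ge_0 (e * Cmod v)); lra.
assert (F : Cmod (cexp (e * v) - 1 - e * v)%C * Cmod (/ (v * (cexp (e * v) - 1)))%C
  <= 2 * (e * Cmod v) ^ 2 * exp 1 * / (Cmod v * (e * Cmod v / 6))).
  apply Rmult_le_compat; try apply Cmod_ge_0; assumption.
replace (2 * (e * Cmod v) ^ 2 * exp 1 * / (Cmod v * (e * Cmod v / 6))) with (12 * e * exp 1) in F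
  by (field; lra).
lra.
Qed.

Lemma cexp_m1_le (x : C) : Cmod x <= 1 -> Cmod (cexp x - 1)%C <= 7 * Cmod x.
Proof.
intros H; pose proof (cexp_taylor1 x) as T.
replace (cexp x - 1)%C with ((cexp x - 1 - x) + x)%C by ring.
eapply Rle_trans; [apply Cmod_triangle|].
assert (exp (Cmod x) <= exp 1).
  destruct H as [H|H]; [left; apply exp_increasing, H|rewrite H; lra].
pose proof exp_le_3; pose proof (Cmod_ge_0 x); pose proof (exp_pos (Cmod x)).
assert (2 * Cmod x ^ 2 * exp (Cmod x) <= 2 * Cmod x ^ 2 * 3).
  apply Rmult_le_compat_l; [pose proof (pow2_ge_0 (Cmod x))|]; lra.
nra.
Qed.

Lemma Re_nat_I2 (k : nat) : Re (INR k * I2)%C = 0.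
Proof. unfold I2; csimp; ring. Qed.

Lemma Cmod_cexp_scaled_ge (e : R) (w u : C) (k : nat) :
  0 < e -> e * Cmod w <= / 2 -> e * INR k <= / 2 ->
  u = (w + INR k * I2)%C \/ u = (w - INR k * I2)%C ->
  e * Cmod u / 6 <= Cmod (cexp (e * u) - 1)%C.
Proof.
intros He Hw Hk Hu.
replace (e * Cmod u) with (Cmod (e * u)%C) by (rewrite Cmod_mult, Cmod_R, Rabs_pos_eq; lra).
assert (Hr : Re u = Re w).
  pose proof (Re_nat_I2 k) as E; destruct Hu as [-> | ->]; revert E; unfold Re; simpl; lra.
assert (Hm : Cmod u <= Cmod w + 2 * PI * INR k).
  rewrite <- Cmod_nat_I2; destruct Hu as [-> | ->]; [apply Cmod_triangle|].
  unfold Cminus; rewrite <- (Cmod_opp (INR k * I2)%C); apply Cmod_triangle.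
pose proof PI_lt; pose proof PI_RGT_0.
assert (Er : Re (e * u)%C = e * Re w) by (rewrite <- Hr; unfold Re; simpl; ring).
apply Cmod_cexp_m1_ge.
- rewrite Er, Rabs_mult, Rabs_pos_eq by lra.
  pose proof (re_le_Cmod w); nra.
- eapply Rle_trans; [apply im_le_Cmod|].
  rewrite Cmod_mult, Cmod_R, Rabs_pos_eq by lra; nra.
Qed.

(** The majorant for [tannery]. The two terms add up to (exp (a + b) - 1) / ((exp a - 1) (exp b -
    1)), whose numerator does not depend on k; 252 = 7 * 6 * 6 comes from [cexp_m1_le] and two uses
    of [Cmod_cexp_scaled_ge]. *)
Lemma psi_pair_bound (w : C) (c0 : R) (n k : nat) : cexp w <> 1%C -> latb c0 w ->
  (k < 2 ^ n)%nat ->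
  half (S n) * Cmod w <= / 2 -> half (S n) * Cmod (2 * w - I2)%C <= / 2 ->
  Cmod (half (S n) * psi_pair w (S n) k)%C
  <= 252 * Cmod (2 * w - I2)%C * (/ c0) ^ 2 * / (INR k + 1) ^ 2.
Proof.
intros Hw Hl Hk H1 H2.
pose proof (half_pos (S n)) as He; set (e := half (S n)) in *.
assert (Hek : e * INR (S k) <= / 2).
  assert (Hp : e * INR (2 ^ n) = / 2).
    pose proof (half_pow n) as E; unfold e, half in *; simpl; lra.
  rewrite <- Hp; apply Rmult_le_compat_l; [lra|]; apply le_INR; lia.
assert (Hek' : e * INR k <= / 2) by (rewrite S_INR in Hek; lra).
set (u := (w + INR k * I2)%C); set (v := (w - INR (S k) * I2)%C).
destruct (latb_neq_0 c0 w k Hl) as [Nu Nv]; fold u in Nu; fold v in Nv.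
assert (Gu : e * Cmod u / 6 <= Cmod (cexp (e * u) - 1)%C).
  apply Cmod_cexp_scaled_ge with w k; auto.
assert (Gv : e * Cmod v / 6 <= Cmod (cexp (e * v) - 1)%C).
  apply Cmod_cexp_scaled_ge with w (S k); auto.
pose proof (proj1 (Cmod_gt_0 u) Nu) as Pu; pose proof (proj1 (Cmod_gt_0 v) Nv) as Pv.
assert (Qu : 0 < e * Cmod u) by (apply Rmult_lt_0_compat; lra).
assert (Qv : 0 < e * Cmod v) by (apply Rmult_lt_0_compat; lra).
assert (N1 : (cexp (e * u) - 1)%C <> 0%C) by (apply Cmod_gt_0; lra).
assert (N2 : (cexp (e * v) - 1)%C <> 0%C) by (apply Cmod_gt_0; lra).
assert (E : psi_pair w (S n) k
  = ((cexp (e * (2 * w - I2)) - 1) * / ((cexp (e * u) - 1) * (cexp (e * v) - 1)))%C).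
  unfold psi_pair; fold u v e.
  replace (e * (2 * w - I2))%C with (e * u + e * v)%C.
  2:{ unfold u, v; rewrite S_INR, RtoC_plus; ring. }
  rewrite cexp_add; unfold psi; field; repeat split; try assumption; apply C2_neq_0.
rewrite E, !Cmod_mult, Cmod_R, (Rabs_pos_eq e) by lra.
set (c := (2 * w - I2)%C) in *.
assert (Mc : Cmod (e * c)%C = e * Cmod c) by (rewrite Cmod_mult, Cmod_R, Rabs_pos_eq; lra).
assert (B1 : Cmod (cexp (e * c) - 1)%C <= 7 * (e * Cmod c)).
  rewrite <- Mc; apply cexp_m1_le; lra.
assert (B2 : Cmod (/ ((cexp (e * u) - 1) * (cexp (e * v) - 1)))%C
   <= / (e * Cmod u / 6 * (e * Cmod v / 6))).
  apply Cmod_inv_le; [apply Rmult_lt_0_compat; lra|].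
  rewrite Cmod_mult; apply Rmult_le_compat; lra.
pose proof (Cmod_pair_le w c0 k Hl) as B3; fold u v in B3.
rewrite Cmod_inv, Cmod_mult in B3.
2:{ apply Cmult_neq_0; assumption. }
apply Rle_trans with (e * (7 * (e * Cmod c) * / (e * Cmod u / 6 * (e * Cmod v / 6)))).
  apply Rmult_le_compat_l; [lra|]; apply Rmult_le_compat; try apply Cmod_ge_0; assumption.
replace (e * (7 * (e * Cmod c) * / (e * Cmod u / 6 * (e * Cmod v / 6))))
  with (252 * Cmod c * / (Cmod u * Cmod v)) by (field; lra).
rewrite (Rmult_assoc (252 * Cmod c)).
apply Rmult_le_compat_l; [pose proof (Cmod_ge_0 c); lra|exact B3].
Qed.

Lemma clim_ext_loc (u v : nat -> C) (l : C) :
  eventually (fun n => u n = v n) -> clim u l -> clim v l.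
Proof.
intros [N HN]; apply is_lim_seq_ext_loc; exists N; intros n Hn; rewrite HN; auto.
Qed.

Lemma pow2_gt (k : nat) : (k < 2 ^ k)%nat.
Proof. apply Nat.pow_gt_lin_r; lia. Qed.

Lemma lsum1 (w : C) : cexp w <> 1%C -> lsum 1 w = psi w.
Proof.
intros Hw; destruct (cexp_latb w Hw) as [c0 Hl].
destruct (half_small (Cmod w)) as [N1 H1].
destruct (half_small (Cmod (2 * w - I2)%C)) as [N2 H2].
set (a := fun n k => if Nat.ltb k (2 ^ n) then (half (S n) * psi_pair w (S n) k)%C else 0%C).
set (B := 252 * Cmod (2 * w - I2)%C * (/ c0) ^ 2).
assert (HB : 0 <= B).
  unfold B; destruct Hl as [Hc _]; assert (0 < / c0) by (apply Rinv_0_lt_compat; lra).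
  apply Rmult_le_pos; [pose proof (Cmod_ge_0 (2 * w - I2)%C); lra|apply pow_le; lra].
symmetry.
(* The majorant holds only from some rank on; the shift by N1 + N2 makes it hold for all indices. *)
apply clim_unique with (fun n => csum (a (n + (N1 + N2))%nat)).
- apply clim_ext with (fun _ => psi w); [|apply clim_const].
  intros n; unfold a; rewrite csum_finite, cfsum_scal; apply psi_pairs, Hw.
- apply tannery with (fun k => B * / (INR k + 1) ^ 2).
  + apply ex_series_Rscal, ex_series_inv_sq.
  + intros n k; unfold a; destruct (Nat.ltb_spec k (2 ^ (n + (N1 + N2)))) as [Hk|Hk].
      apply psi_pair_bound; auto; [apply H1|apply H2]; lia.
    rewrite Cmod_0; apply Rmult_le_pos; [exact HB|left; apply inv_sq_pos].
  + intros k; apply (clim_incr (fun n => a n k)).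
    apply clim_ext_loc with (fun n => half (S n) * psi_pair w (S n) k)%C.
      exists k; intros n Hn; unfold a.
      replace (Nat.ltb k (2 ^ n)) with true; [reflexivity|symmetry; apply Nat.ltb_lt].
      pose proof (pow2_gt k); pose proof (Nat.pow_le_mono_r 2 k n); lia.
    destruct (latb_neq_0 c0 w k Hl) as [Nu Nv].
    apply (clim_ext (fun n => half (n + 1) * psi_pair w (n + 1) k)%C).
      intros n; rewrite Nat.add_1_r; reflexivity.
    apply (clim_incr (fun n => half n * psi_pair w n k)%C).
    unfold lterm; simpl Cpow; rewrite !Cmult_1_r.
    apply clim_ext with (fun n => half n * psi (half n * (w + INR k * I2)) + half n * psi (half n * (w - INR (S k) * I2)))%C.
      intros n; unfold psi_pair; ring.
    apply clim_plus; apply psi_scaled_lim; assumption.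
Qed.

Lemma invpow_le (x c : R) (j k : nat) : 0 < c -> c * (INR k + 1) <= x ->
  (/ x) ^ S (S j) <= (/ c) ^ S (S j) * / (INR k + 1) ^ 2.
Proof.
intros Hc H; pose proof (pos_INR k).
assert (Hx : 0 < x) by (assert (0 < c * (INR k + 1)) by (apply Rmult_lt_0_compat; lra); lra).
pose proof (Cmod_invpow_le x c j k Hc) as E.
rewrite Cmod_pow, Cmod_inv, Cmod_R, Rabs_pos_eq in E by (try apply RtoC_neq_0; lra).
apply E, H.
Qed.

Lemma latb_perturb (c0 : R) (w h : C) : latb c0 w -> Cmod h < c0 / 2 -> latb (c0 / 2) (w + h)%C.
Proof.
intros [Hc H] Hh; split; [lra|]; intros k; destruct (H k) as [H1 H2]; pose proof (pos_INR k).
split.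
- replace (w + h + INR k * I2)%C with (w + INR k * I2 + h)%C by ring.
  eapply Rle_trans; [|apply Cmod_gap]; nra.
- replace (w + h - INR (S k) * I2)%C with (w - INR (S k) * I2 + h)%C by ring.
  eapply Rle_trans; [|apply Cmod_gap]; nra.
Qed.

Lemma cderiv_lsum (c0 : R) (w : C) (j : nat) : latb c0 w ->
  cderiv (lsum (S j)) w (- INR (S j) * lsum (S (S j)) w)%C.
Proof.
intros Hl; assert (Hc : 0 < c0) by apply Hl.
unfold lsum at 2; rewrite <- csum_scal by apply (csummable_lterm c0 w (S j) Hl).
apply (cderiv_csum (fun k u => lterm (S j) u k) w _ (c0 / 2)
  (fun k => INR (S j) * INR (S (S j)) * (/ (c0 / 2)) ^ S (S (S j)) * / (INR k + 1) ^ 2)).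
- lra.
- apply ex_series_Rscal, ex_series_inv_sq.
- intros h Hh; apply (csummable_lterm (c0 / 2)), latb_perturb; assumption.
- apply csummable_scal, (csummable_lterm c0), Hl.
- intros k h Hh; destruct Hl as [_ Hl]; destruct (Hl k) as [H1 H2]; pose proof (pos_INR k) as Hk.
  set (u := (w + INR k * I2)%C) in *; set (v := (w - INR (S k) * I2)%C) in *.
  unfold lterm.
  replace (w + h + INR k * I2)%C with (u + h)%C by (unfold u; ring).
  replace (w + h - INR (S k) * I2)%C with (v + h)%C by (unfold v; ring).
  fold u v.
  assert (G : forall x, c0 * (INR k + 1) <= Cmod x ->
    Cmod ((/ (x + h)) ^ S j - (/ x) ^ S j + INR (S j) * h * (/ x) ^ S (S j))%C
    <= INR (S j) * INR (S (S j)) / 2 * Cmod h ^ 2 *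
      ((/ (c0 / 2)) ^ S (S (S j)) * / (INR k + 1) ^ 2)).
    intros x Hx; eapply Rle_trans; [apply invpow_taylor; nra|].
    apply Rmult_le_compat_l.
      apply Rmult_le_pos; [|apply pow2_ge_0]; apply Rmult_le_pos; [|lra].
      apply Rmult_le_pos; apply pos_INR.
    apply invpow_le; [lra|nra].
  replace (_ - _)%C with
    (((/ (u + h)) ^ S j - (/ u) ^ S j + INR (S j) * h * (/ u) ^ S (S j))
     + ((/ (v + h)) ^ S j - (/ v) ^ S j + INR (S j) * h * (/ v) ^ S (S j)))%C by ring.
  eapply Rle_trans; [apply Cmod_triangle|].
  eapply Rle_trans; [apply Rplus_le_compat; apply G; assumption|].
  right; field; lra.
Qed.

Lemma cderiv_inv (f : C -> C) (z d : C) : f z <> 0%C -> cderiv f z d ->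
  cderiv (fun u => / f u)%C z (- d / (f z * f z))%C.
Proof.
intros Hz Hf; assert (Pz : 0 < Cmod (f z)) by (apply Cmod_gt_0, Hz).
destruct (cderiv_bounded f z d Hf) as [r [B [Hr [HB Hfb]]]].
destruct Hf as [d1 [K1 [Hd1 [HK1 H1]]]].
set (m := Cmod (f z)) in *.
pose proof (Cmod_ge_0 d) as Hd.
exists (Rmin (Rmin d1 r) (m / (2 * (B + 1)))), ((K1 * m + Cmod d * B) * 2 / m ^ 3).
split; [repeat apply Rmin_pos; try lra; apply Rdiv_lt_0_compat; lra|].
split.
  apply Rmult_le_pos; [|left; apply Rinv_0_lt_compat, pow_lt; lra].
  assert (0 <= K1 * m) by (apply Rmult_le_pos; lra).
  assert (0 <= Cmod d * B) by (apply Rmult_le_pos; lra); lra.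
intros h Hh.
pose proof (Rmin_l (Rmin d1 r) (m / (2 * (B + 1)))); pose proof (Rmin_r (Rmin d1 r) (m / (2 * (B + 1)))).
pose proof (Rmin_l d1 r); pose proof (Rmin_r d1 r).
assert (Hm : Cmod h * (2 * (B + 1)) <= m).
  assert (E : Cmod h <= m / (2 * (B + 1))) by lra.
  apply Rmult_le_compat_r with (r := 2 * (B + 1)) in E; [|lra].
  replace (m / (2 * (B + 1)) * (2 * (B + 1))) with m in E by (field; lra); exact E.
pose proof (Cmod_ge_0 h) as Hh0.
assert (A1 : Cmod (f (z + h) - f z - h * d)%C <= K1 * Cmod h ^ 2) by (apply H1; lra).
assert (A2 : Cmod (f (z + h) - f z)%C <= B * Cmod h) by (apply Hfb; lra).
assert (A3 : m / 2 <= Cmod (f (z + h)%C)).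
  replace (f (z + h))%C with (f z + (f (z + h) - f z))%C by ring.
  eapply Rle_trans; [|apply Cmod_gap]; fold m; nra.
assert (Nz : f (z + h)%C <> 0%C) by (apply Cmod_gt_0; lra).
replace (_ - _)%C with
  ((- f z * (f (z + h) - f z - h * d) + h * d * (f (z + h) - f z)) * / (f z * f z * f (z + h)))%C
  by (field; split; assumption).
rewrite Cmod_mult.
replace ((K1 * m + Cmod d * B) * 2 / m ^ 3 * Cmod h ^ 2)
  with ((K1 * m + Cmod d * B) * Cmod h ^ 2 * / (m * m * (m / 2))) by (field; lra).
apply Rmult_le_compat; try apply Cmod_ge_0.
- eapply Rle_trans; [apply Cmod_triangle|].
  rewrite !Cmod_mult, Cmod_opp; fold m.
  assert (m * Cmod (f (z + h) - f z - h * d)%C <= m * (K1 * Cmod h ^ 2)) by (apply Rmult_le_compat_l; lra).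
  assert (Cmod h * Cmod d * Cmod (f (z + h) - f z)%C <= Cmod h * Cmod d * (B * Cmod h)).
    apply Rmult_le_compat_l; [apply Rmult_le_pos; lra|exact A2].
  lra.
- apply Cmod_inv_le; [repeat apply Rmult_lt_0_compat; lra|].
  rewrite !Cmod_mult; fold m; apply Rmult_le_compat_l; [apply Rmult_le_pos|]; lra.
Qed.

Lemma cderiv_cexp (z : C) : cderiv cexp z (cexp z).
Proof.
apply cderiv_ext with (fun u => cexp (1 * u)); [intros u; f_equal; ring|].
replace (cexp z) with (1 * cexp (1 * z))%C; [apply cderiv_cexp_lin|].
rewrite Cmult_1_l; f_equal; ring.
Qed.

Lemma cderiv_neq_near (f : C -> C) (z d a : C) : cderiv f z d -> f z <> a ->
  exists r, 0 < r /\ forall h, Cmod h < r -> f (z + h)%C <> a.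
Proof.
intros Hf Ha; destruct (cderiv_bounded f z d Hf) as [r [B [Hr [HB H]]]].
assert (P : 0 < Cmod (f z - a)%C) by (apply Cmod_gt_0, Cminus_neq_0, Ha).
exists (Rmin r (Cmod (f z - a)%C / (B + 1))); split.
  apply Rmin_pos; [lra|apply Rdiv_lt_0_compat; lra].
intros h Hh E.
pose proof (Rmin_l r (Cmod (f z - a)%C / (B + 1))); pose proof (Rmin_r r (Cmod (f z - a)%C / (B + 1))).
assert (Hh1 : Cmod h < r) by lra; specialize (H h Hh1).
assert (E2 : Cmod h < Cmod (f z - a)%C / (B + 1)) by lra.
apply Rmult_lt_compat_r with (r := B + 1) in E2; [|lra].
replace (Cmod (f z - a)%C / (B + 1) * (B + 1)) with (Cmod (f z - a)%C) in E2 by (field; lra).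
rewrite E, <- Cmod_opp in H; replace (- (a - f z))%C with (f z - a)%C in H by ring.
pose proof (Cmod_ge_0 h); nra.
Qed.

Definition hfun (w : C) : C := (cexp w / ((cexp w - 1) * (cexp w - 1)))%C.

(** Differentiates both sides of [lsum1]; since they agree near w, uniqueness of the derivative
    concludes. *)
Lemma lsum2 (w : C) : cexp w <> 1%C -> lsum 2 w = hfun w.
Proof.
intros Hw; destruct (cexp_latb w Hw) as [c0 Hl].
assert (D1 : cderiv psi w (- hfun w)%C).
  replace (- hfun w)%C with (0 + - (cexp w + 0) / ((cexp w - 1) * (cexp w - 1)))%C.
  2:{ unfold hfun; field; apply Cminus_neq_0, Hw. }
  apply cderiv_plus; [apply cderiv_const|].
  apply (cderiv_inv (fun u => cexp u - 1)%C); [apply Cminus_neq_0, Hw|].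
  apply (cderiv_plus cexp (fun _ => - (1))%C); [apply cderiv_cexp|apply cderiv_const].
destruct (cderiv_neq_near cexp w (cexp w) 1%C (cderiv_cexp w) Hw) as [r [Hr Hn]].
assert (D2 : cderiv (lsum 1) w (- hfun w)%C).
  apply cderiv_ext_loc with psi r; [exact Hr| |exact D1].
  intros h Hh; symmetry; apply lsum1, Hn, Hh.
pose proof (cderiv_unique _ _ _ _ D2 (cderiv_lsum c0 w 0 Hl)) as E.
apply (f_equal Copp) in E; replace (hfun w) with (- - hfun w)%C by ring.
rewrite E; simpl; ring.
Qed.

(** * Summation over odd multiples *)

Definition odd (l : nat) : R := 2 * INR l + 1.

Lemma odd_ge (l : nat) : INR l + 1 <= odd l.
Proof. unfold odd; pose proof (pos_INR l); lra. Qed.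

Lemma odd_pos (l : nat) : 0 < odd l.
Proof. pose proof (odd_ge l); pose proof (pos_INR l); lra. Qed.

Lemma z_neq_0 (z : C) : 0 < Re z -> z <> 0%C.
Proof. intros H E; rewrite E in H; simpl in H; lra. Qed.

Lemma Re_scal (a : R) (z : C) : Re (a * z)%C = a * Re z.
Proof. unfold Re; simpl; ring. Qed.

Lemma cexp_neq_1_Re (w : C) : Re w <> 0 -> cexp w <> 1%C.
Proof.
intros H E; apply H; apply exp_inv; rewrite exp_0, <- Cmod_cexp, E; apply Cmod_1.
Qed.

Definition latpt (a : R) (z : C) (k : nat) (u : C) : Prop :=
  u = (a * z + INR k * I2)%C \/ u = (a * z - INR k * I2)%C.

Lemma latpt_Re (a : R) (z u : C) (k : nat) : 0 < Re z -> 0 <= a -> latpt a z k u ->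
  a * Re z <= Cmod u.
Proof.
intros Hz Ha Hu.
assert (E : Re u = a * Re z).
  pose proof (Re_nat_I2 k) as E; rewrite <- Re_scal.
  destruct Hu as [-> | ->]; revert E; unfold Re; simpl; intros; lra.
rewrite <- E; eapply Rle_trans; [apply Rle_abs|apply re_le_Cmod].
Qed.

(** A point u has |u| >= a Re z and, by the triangle inequality, |u| >= 2 PI k - a |z|. Combining
    these with weights |z| and Re z eliminates a, so this constant serves all multiples a at
    once. *)
Definition latc (z : C) : R := 2 * PI * Re z / (Re z + Cmod z).

Lemma latc_pos (z : C) : 0 < Re z -> 0 < latc z.
Proof.
intros Hz; unfold latc; pose proof PI_RGT_0; pose proof (Cmod_ge_0 z).
apply Rdiv_lt_0_compat; [|lra]; apply Rmult_lt_0_compat; lra.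
Qed.

Lemma latpt_Im (a : R) (z u : C) (k : nat) : 0 < Re z -> 0 <= a -> latpt a z k u ->
  latc z * INR k <= Cmod u.
Proof.
intros Hz Ha Hu; pose proof (latpt_Re a z u k Hz Ha Hu) as H1.
pose proof PI_RGT_0; pose proof (Cmod_ge_0 z); pose proof (pos_INR k).
assert (Hd : 2 * PI * INR k - a * Cmod z <= Cmod u).
  rewrite <- Cmod_nat_I2; replace (a * Cmod z) with (Cmod (a * z)%C).
  2:{ rewrite Cmod_mult, Cmod_R, Rabs_pos_eq; lra. }
  destruct Hu as [-> | ->].
    rewrite Cplus_comm; apply Cmod_gap.
  rewrite <- (Cmod_opp (a * z - _)%C), <- (Cmod_opp (a * z)%C).
  replace (- (a * z - INR k * I2))%C with (INR k * I2 + - (a * z))%C by ring; apply Cmod_gap.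
unfold latc; apply Rmult_le_reg_r with (Re z + Cmod z); [lra|].
replace (2 * PI * Re z / (Re z + Cmod z) * INR k * (Re z + Cmod z))
  with (2 * PI * INR k * Re z) by (field; lra).
nra.
Qed.

(** Up to a factor proportional to z i / PI, the points l z + k I2 with l odd are the lattice
    translates of w = PI i - 2 PI^2 k / z: the two periods exchange their roles. So [lsum2] sums
    them, and cexp w = - q, the sign being due to l being odd. *)
Lemma odd_sum (z : C) (k : nat) : 0 < Re z ->
  let q := cexp (- (2 * PI ^ 2 * INR k / z))%C in
  csummable (fun l => (/ (odd l * z + INR k * I2)) ^ 2 + (/ (odd l * z - INR k * I2)) ^ 2)%C /\
  csum (fun l => (/ (odd l * z + INR k * I2)) ^ 2 + (/ (odd l * z - INR k * I2)) ^ 2)%C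
  = ((PI / z) ^ 2 * (q / ((1 + q) * (1 + q))))%C.
Proof.
intros Hz q; pose proof (z_neq_0 z Hz) as Nz.
pose proof PI_RGT_0; pose proof (pos_INR k) as Hk.
assert (NPI : RtoC PI <> 0%C) by (apply RtoC_neq_0; lra).
assert (Ci2 : (Ci * Ci = - (1))%C) by (apply C_eq; simpl; ring).
assert (NCi : Ci <> 0%C).
  intros E; rewrite E in Ci2; apply (f_equal Re) in Ci2; simpl in Ci2; lra.
assert (Pz : 0 < Cmod z) by (apply Cmod_gt_0, Nz).
assert (Nq : (1 + q)%C <> 0%C).
  destruct (Nat.eq_dec k 0) as [E|E].
    unfold q; rewrite E; simpl INR.
    replace (- (2 * PI ^ 2 * 0 / z))%C with (RtoC 0) by (field; exact Nz).
    rewrite cexp_0, <- RtoC_plus; apply RtoC_neq_0; lra.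
  intros E2; assert (Hq : Cmod q = 1).
    replace q with (- (1))%C by (replace q with (1 + q - 1)%C by ring; rewrite E2; ring).
    apply Cmod_m1.
  unfold q in Hq; rewrite Cmod_cexp in Hq.
  assert (Re (- (2 * PI ^ 2 * INR k / z))%C < 0).
    assert (Hs : Re (- (2 * PI ^ 2 * INR k / z))%C = - (2 * PI ^ 2 * INR k * (Re z / Cmod z ^ 2))).
      rewrite Cmod2_alt; destruct z as [x y]; unfold Re, Im; simpl.
      field; unfold Re in Hz; simpl in Hz; nra.
    rewrite Hs.
    assert (0 < INR k) by (apply lt_0_INR; lia).
    assert (0 < Re z / Cmod z ^ 2) by (apply Rdiv_lt_0_compat; [lra|apply pow_lt; lra]).
    assert (0 < 2 * PI ^ 2 * INR k * (Re z / Cmod z ^ 2)).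
      apply Rmult_lt_0_compat; [apply Rmult_lt_0_compat|]; nra.
    lra.
  apply exp_increasing in H0; rewrite exp_0, Hq in H0; lra.
set (c := (- (2 * PI ^ 2 * INR k / z))%C) in *.
set (w := (PI * Ci + c)%C).
assert (Ew : cexp w = (- q)%C) by (unfold w; rewrite cexp_add, cexp_iPI; fold q; ring).
assert (Hw : cexp w <> 1%C).
  rewrite Ew; intros E; apply Nq; replace q with (- - q)%C by ring; rewrite E; ring.
assert (T : forall l, ((/ (odd l * z + INR k * I2)) ^ 2 + (/ (odd l * z - INR k * I2)) ^ 2
   = (- (PI / z) ^ 2) * lterm 2 w l)%C).
  intros l; destruct (cexp_latb w Hw) as [c0 Hl].
  destruct (latb_neq_0 c0 w l Hl) as [Nu Nv].
  assert (E1 : (odd l * z + INR k * I2 = - (z * Ci / PI) * (w + INR l * I2))%C).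
    unfold w, c, I2, odd; rewrite RtoC_plus, RtoC_mult.
    transitivity (- (Ci * Ci) * (2 * INR l + 1) * z + INR k * (2 * PI * Ci))%C.
      rewrite Ci2; ring.
    field; split; assumption.
  assert (E2 : (odd l * z - INR k * I2 = z * Ci / PI * (w - INR (S l) * I2))%C).
    unfold w, c, I2, odd; rewrite S_INR, !RtoC_plus, RtoC_mult.
    transitivity (- (Ci * Ci) * (2 * INR l + 1) * z - INR k * (2 * PI * Ci))%C.
      rewrite Ci2; ring.
    field; split; assumption.
  rewrite E1, E2; unfold lterm.
  transitivity (/ (Ci * Ci) * ((PI / z) ^ 2 * ((/ (w + INR l * I2)) ^ 2 + (/ (w - INR (S l) * I2)) ^ 2)))%C.
    field; repeat split; assumption.
  rewrite Ci2; field; repeat split; assumption.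
split.
- apply csummable_ext with (fun l => (- (PI / z) ^ 2) * lterm 2 w l)%C; [intros; symmetry; apply T|].
  destruct (cexp_latb w Hw) as [c0 Hl]; apply csummable_scal, (csummable_lterm c0), Hl.
- rewrite (csum_ext _ _ T), csum_scal.
  2:{ destruct (cexp_latb w Hw) as [c0 Hl]; apply (csummable_lterm c0), Hl. }
  change (csum (lterm 2 w)) with (lsum 2 w); rewrite lsum2 by exact Hw.
  unfold hfun; rewrite Ew.
  assert (N3 : (- q - 1)%C <> 0%C).
    intros E; apply Nq; replace (1 + q)%C with (- (- q - 1))%C by ring; rewrite E; ring.
  field; repeat split; assumption.
Qed.

Definition sterm (j : nat) (w : C) (k : nat) : C :=
  ((/ (w + INR (S k) * I2)) ^ j + (/ (w - INR (S k) * I2)) ^ j)%C.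

Lemma csummable_lat (c0 : R) (w : C) (j : nat) : latb c0 w ->
  csummable (fun k => (/ (w + INR k * I2)) ^ S (S j))%C /\
  csummable (fun k => (/ (w - INR (S k) * I2)) ^ S (S j))%C.
Proof.
intros [Hc H]; split; apply csummable_dom with (fun k => (/ c0) ^ S (S j) * / (INR k + 1) ^ 2);
  try (apply ex_series_Rscal, ex_series_inv_sq); intros k; apply Cmod_invpow_le; apply Hc || apply H.
Qed.

Lemma lsum_sym (c0 : R) (w : C) (j : nat) : latb c0 w ->
  csummable (sterm (S (S j)) w) /\
  lsum (S (S j)) w = ((/ w) ^ S (S j) + csum (sterm (S (S j)) w))%C.
Proof.
intros H; destruct (csummable_lat c0 w j H) as [H1 H2].
pose proof (csummable_shift _ 1 H1) as H3; simpl in H3.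
split; [apply csummable_plus; assumption|].
unfold lsum, lterm, sterm; rewrite csum_plus by assumption.
rewrite (csum_incr_1 _ H1), csum_plus by assumption.
simpl INR at 1; rewrite Cmult_0_l, Cplus_0_r; ring.
Qed.

Lemma inv_INR_lim : is_lim_seq (fun n => / (INR n + 1)) 0.
Proof.
apply is_lim_seq_ext with (fun n => / INR (S n)); [intros n; rewrite S_INR; reflexivity|].
apply (is_lim_seq_incr_1 (fun n => / INR n)).
replace (Finite 0) with (Rbar_inv p_infty) by reflexivity.
apply is_lim_seq_inv; [apply is_lim_seq_INR|discriminate].
Qed.

(** Going from the pairs k, -(k + 1) to the pairs k, -k rearranges a conditionally convergent sum,
    so partial sums are compared: they differ by the single term 1 / (w - (n + 1) I2), which tends
    to 0. *)
Lemma lsum1_sym (c0 : R) (w : C) : latb c0 w ->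
  csummable (sterm 1 w) /\ lsum 1 w = (/ w + csum (sterm 1 w))%C.
Proof.
intros H.
assert (Hs : csummable (sterm 1 w)).
  apply csummable_dom with (fun k => 2 * Cmod w * ((/ c0) ^ 2 * / (INR k + 1) ^ 2)).
  2:{ apply ex_series_Rscal, ex_series_Rscal, ex_series_inv_sq. }
  intros k; destruct H as [Hc H]; destruct (H k) as [_ Hv]; destruct (H (S k)) as [Hu _].
  pose proof (pos_INR k); rewrite S_INR in Hu.
  assert (Hu' : c0 * (INR k + 1) <= Cmod (w + INR (S k) * I2)%C) by (rewrite S_INR; nra).
  assert (P : 0 < c0 * (INR k + 1)) by (apply Rmult_lt_0_compat; lra).
  assert (Nu : (w + INR (S k) * I2)%C <> 0%C) by (apply Cmod_gt_0; lra).
  assert (Nv : (w - INR (S k) * I2)%C <> 0%C) by (apply Cmod_gt_0; lra).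
  replace (sterm 1 w k) with (2 * w * / ((w + INR (S k) * I2) * (w - INR (S k) * I2)))%C.
  2:{ unfold sterm; field; split; assumption. }
  rewrite !Cmod_mult, Cmod_R, Rabs_pos_eq by lra.
  apply Rmult_le_compat_l; [pose proof (Cmod_ge_0 w); lra|].
  rewrite <- pow_inv, <- Rpow_mult_distr, <- Rinv_mult, pow_inv.
  apply Cmod_inv_le; [apply pow_lt; lra|].
  rewrite Cmod_mult.
  replace ((c0 * (INR k + 1)) ^ 2) with (c0 * (INR k + 1) * (c0 * (INR k + 1))) by ring.
  apply Rmult_le_compat; lra.
split; [exact Hs|].
apply clim_unique with (fun n => cfsum (lterm 1 w) (S n)).
- apply clim_ext with (fun n => cfsum (lterm 1 w) (n + 1)); [intros; f_equal; lia|].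
  apply (clim_incr (cfsum (lterm 1 w))), cfsum_lim, (csummable_lterm c0), H.
- apply clim_ext with (fun n => (/ w + cfsum (sterm 1 w) n) + / (w - INR (S n) * I2))%C.
    induction n as [|n IH].
      unfold cfsum, lterm; rewrite !Cpow_1_r; change (INR 0) with 0.
      replace (w + 0 * I2)%C with w by ring; ring.
    change (cfsum (lterm 1 w) (S (S n))) with (cfsum (lterm 1 w) (S n) + lterm 1 w (S n))%C.
    rewrite <- IH; change (cfsum (sterm 1 w) (S n)) with (cfsum (sterm 1 w) n + sterm 1 w n)%C.
    unfold sterm, lterm; rewrite !Cpow_1_r; ring.
  replace (/ w + csum (sterm 1 w))%C with ((/ w + csum (sterm 1 w)) + 0)%C by ring.
  apply clim_plus; [apply clim_plus; [apply clim_const|apply cfsum_lim, Hs]|].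
  apply clim_squeeze with (fun n => / c0 * / (INR n + 1)).
    intros n; destruct H as [Hc H]; destruct (H n) as [_ Hv]; pose proof (pos_INR n).
    replace (/ (w - INR (S n) * I2) - 0)%C with (/ (w - INR (S n) * I2))%C by ring.
    rewrite <- Rinv_mult; apply Cmod_inv_le; [apply Rmult_lt_0_compat; lra|exact Hv].
  replace (Finite 0) with (Rbar_mult (/ c0) 0) by (simpl; f_equal; ring).
  apply is_lim_seq_scal_l, inv_INR_lim.
Qed.

Lemma hfun_bound (w : C) : 0 < Re w ->
  Cmod (hfun w) <= exp (- Re w) / (1 - exp (- Re w)) ^ 2.
Proof.
intros Hw.
assert (H1 : exp (- Re w) < 1) by (rewrite <- exp_0; apply exp_increasing; lra).
assert (N : (cexp w - 1)%C <> 0%C) by (apply Cminus_neq_0, cexp_neq_1_Re; lra).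
assert (E : exp (Re w) * exp (- Re w) = 1).
  rewrite <- exp_plus; replace (Re w + - Re w) with 0 by ring; apply exp_0.
pose proof (exp_pos (Re w)); pose proof (exp_pos (- Re w)).
unfold hfun; rewrite Cmod_div by (apply Cmult_neq_0; exact N).
rewrite Cmod_mult, Cmod_cexp.
assert (G : exp (Re w) - 1 <= Cmod (cexp w - 1)%C).
  pose proof (Cmod_gap (cexp w) (- (1))%C) as G; rewrite Cmod_opp, Cmod_1, Cmod_cexp in G; exact G.
assert (E2 : exp (- Re w) / (1 - exp (- Re w)) ^ 2 = exp (Re w) / ((exp (Re w) - 1) * (exp (Re w) - 1))).
  replace (exp (- Re w)) with (/ exp (Re w)) by (symmetry; apply exp_Ropp).
  field; repeat split; nra.
rewrite E2; apply Rmult_le_compat_l; [lra|].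
apply Rinv_le_contravar; [|apply Rmult_le_compat; nra].
apply Rmult_lt_0_compat; nra.
Qed.

Definition sqpair (z : C) (l k : nat) : C :=
  ((/ (odd l * z + INR (S k) * I2)) ^ 2 + (/ (odd l * z - INR (S k) * I2)) ^ 2)%C.

(* [1 / ((u - z) (u + z))] approximates [1 / u ^ 2] to fourth order and
   telescopes in the odd multiple of [z]: subtracting it makes the double series
   over the lattice absolutely convergent. *)
Definition telpair (z : C) (l k : nat) : C :=
  (/ ((odd l * z + INR (S k) * I2 - z) * (odd l * z + INR (S k) * I2 + z))
   + / ((odd l * z - INR (S k) * I2 - z) * (odd l * z - INR (S k) * I2 + z)))%C.

Lemma latpt_neq_0 (a : R) (z u : C) (k : nat) : 0 < Re z -> 0 <= a -> latpt a z (S k) u ->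
  u <> 0%C.
Proof.
intros Hz Ha Hu; apply Cmod_gt_0.
pose proof (latpt_Im a z u (S k) Hz Ha Hu); pose proof (latc_pos z Hz).
assert (0 < latc z * INR (S k)) by (apply Rmult_lt_0_compat; [lra|apply lt_0_INR; lia]); lra.
Qed.

Lemma odd_eq (l : nat) : RtoC (odd l) = (2 * INR l + 1)%C.
Proof. unfold odd; rewrite RtoC_plus, RtoC_mult; reflexivity. Qed.

Lemma latpt_shift (z u : C) (l k : nat) : latpt (odd l) z k u ->
  latpt (2 * INR l) z k (u - z)%C /\ latpt (2 * INR (S l)) z k (u + z)%C.
Proof.
unfold latpt; rewrite !odd_eq, S_INR, !RtoC_mult, RtoC_plus.
intros [-> | ->]; split; (left; ring) || (right; ring).
Qed.

(** The difference is - z^2 over the four factors u, u, u - z, u + z. Two of them are bounded below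
    through the real part, linearly in l, and two through [latc], linearly in k; u - z must be among
    the latter, its real part being 0 at l = 0. *)
Lemma inv_sq_tel_diff (z u : C) (l k : nat) : 0 < Re z -> latpt (odd l) z (S k) u ->
  Cmod ((/ u) ^ 2 - / ((u - z) * (u + z)))%C
  <= (Cmod z / (Re z * latc z)) ^ 2 * (/ (INR l + 1) ^ 2 * / (INR k + 1) ^ 2).
Proof.
intros Hz Hu; destruct (latpt_shift z u l (S k) Hu) as [Hm Hp].
pose proof (pos_INR l) as Hl; pose proof (pos_INR k) as Hk; pose proof (odd_ge l) as Ho.
pose proof (latc_pos z Hz) as Hc.
assert (P2 : 0 <= 2 * INR l) by lra.
assert (P3 : 0 <= 2 * INR (S l)) by (rewrite S_INR; lra).
assert (P4 : 0 <= odd l) by lra.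
pose proof (latpt_Re _ _ _ _ Hz P4 Hu) as A1; pose proof (latpt_Im _ _ _ _ Hz P4 Hu) as A2.
pose proof (latpt_Im _ _ _ _ Hz P2 Hm) as A3; pose proof (latpt_Re _ _ _ _ Hz P3 Hp) as A4.
pose proof (latpt_neq_0 _ _ _ _ Hz P4 Hu); pose proof (latpt_neq_0 _ _ _ _ Hz P2 Hm).
pose proof (latpt_neq_0 _ _ _ _ Hz P3 Hp).
rewrite S_INR in A2, A3, A4.
set (a := (INR l + 1) * Re z); set (b := latc z * (INR k + 1)).
assert (Pa : 0 < a) by (apply Rmult_lt_0_compat; lra).
assert (Pb : 0 < b) by (apply Rmult_lt_0_compat; lra).
assert (B1 : a <= Cmod u) by (unfold a; nra).
assert (B4 : a <= Cmod (u + z)%C) by (unfold a; nra).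
assert (B2 : b <= Cmod u) by exact A2.
assert (B3 : b <= Cmod (u - z)%C) by exact A3.
replace ((/ u) ^ 2 - / ((u - z) * (u + z)))%C
  with (- (z * z) * / (u * u * ((u - z) * (u + z))))%C by (field; repeat split; assumption).
rewrite Cmod_mult, Cmod_opp, Cmod_mult.
replace ((Cmod z / (Re z * latc z)) ^ 2 * (/ (INR l + 1) ^ 2 * / (INR k + 1) ^ 2))
  with (Cmod z * Cmod z * / (a * b * (b * a))) by (unfold a, b; field; lra).
apply Rmult_le_compat_l; [apply Rmult_le_pos; apply Cmod_ge_0|].
apply Cmod_inv_le; [apply Rmult_lt_0_compat; apply Rmult_lt_0_compat; assumption|].
rewrite !Cmod_mult; apply Rmult_le_compat; try (apply Rmult_le_pos; lra);
  apply Rmult_le_compat; lra.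
Qed.

Lemma sqpair_telpair (z : C) (l k : nat) : 0 < Re z ->
  Cmod (sqpair z l k - telpair z l k)%C
  <= 2 * (Cmod z / (Re z * latc z)) ^ 2 * (/ (INR l + 1) ^ 2 * / (INR k + 1) ^ 2).
Proof.
intros Hz.
replace (sqpair z l k - telpair z l k)%C with
  (((/ (odd l * z + INR (S k) * I2)) ^ 2
     - / ((odd l * z + INR (S k) * I2 - z) * (odd l * z + INR (S k) * I2 + z)))
   + ((/ (odd l * z - INR (S k) * I2)) ^ 2
     - / ((odd l * z - INR (S k) * I2 - z) * (odd l * z - INR (S k) * I2 + z))))%C
  by (unfold sqpair, telpair; ring).
eapply Rle_trans; [apply Cmod_triangle|].
pose proof (inv_sq_tel_diff z (odd l * z + INR (S k) * I2)%C l k Hz (or_introl eq_refl)).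
pose proof (inv_sq_tel_diff z (odd l * z - INR (S k) * I2)%C l k Hz (or_intror eq_refl)).
lra.
Qed.

Lemma telpair_sum (z : C) (k m : nat) : 0 < Re z ->
  cfsum (fun l => telpair z l k) m = (- / (2 * z) * sterm 1 (2 * INR m * z) k)%C.
Proof.
intros Hz; pose proof (z_neq_0 z Hz) as Nz; unfold sterm; rewrite !Cpow_1_r.
assert (N : forall m u, latpt (2 * INR m) z (S k) u -> u <> 0%C).
  intros p u; apply latpt_neq_0; [exact Hz|pose proof (pos_INR p); lra].
induction m as [|m IH].
  simpl cfsum; change (INR 0) with 0.
  assert (N0 : (INR (S k) * I2)%C <> 0%C).
    apply (N 0%nat); left; change (INR 0) with 0; rewrite Rmult_0_r; ring.
  replace (2 * 0 * z + INR (S k) * I2)%C with (INR (S k) * I2)%C by ring.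
  replace (2 * 0 * z - INR (S k) * I2)%C with (- (INR (S k) * I2))%C by ring.
  generalize dependent (INR (S k) * I2)%C; intros K N0.
  replace (/ - K)%C with (- / K)%C; [ring|field; exact N0].
simpl cfsum; rewrite IH; unfold telpair.
set (K := (INR (S k) * I2)%C) in *.
rewrite odd_eq.
assert (E : forall m, RtoC (2 * INR m) = (2 * INR m)%C) by (intros; apply RtoC_mult).
assert (N1 : (2 * INR m * z + K)%C <> 0%C) by (apply (N m); left; rewrite E; reflexivity).
assert (N2 : (2 * INR m * z - K)%C <> 0%C) by (apply (N m); right; rewrite E; reflexivity).
assert (N3 : (2 * INR (S m) * z + K)%C <> 0%C) by (apply (N (S m)); left; rewrite E; reflexivity).
assert (N4 : (2 * INR (S m) * z - K)%C <> 0%C) by (apply (N (S m)); right; rewrite E; reflexivity).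
replace ((2 * INR m + 1) * z + K - z)%C with (2 * INR m * z + K)%C by ring.
replace ((2 * INR m + 1) * z - K - z)%C with (2 * INR m * z - K)%C by ring.
replace ((2 * INR m + 1) * z + K + z)%C with (2 * INR (S m) * z + K)%C
  by (rewrite S_INR, RtoC_plus; ring).
replace ((2 * INR m + 1) * z - K + z)%C with (2 * INR (S m) * z - K)%C
  by (rewrite S_INR, RtoC_plus; ring).
assert (D1 : (2 * z)%C = (2 * INR (S m) * z + K - (2 * INR m * z + K))%C)
  by (rewrite S_INR, RtoC_plus; ring).
assert (D2 : (2 * z)%C = (2 * INR (S m) * z - K - (2 * INR m * z - K))%C)
  by (rewrite S_INR, RtoC_plus; ring).
assert (N5 : (2 * z)%C <> 0%C) by (apply Cmult_neq_0; [apply C2_neq_0|exact Nz]).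
assert (T : forall p q : C, p <> 0%C -> q <> 0%C -> (2 * z = q - p)%C ->
  (/ (p * q) = / (2 * z) * (/ p - / q))%C).
  intros p q Np Nq Eq; assert (N6 : (q - p)%C <> 0%C) by (rewrite <- Eq; exact N5).
  rewrite Eq; field; repeat split; assumption.
rewrite (T _ _ N1 N3 D1), (T _ _ N2 N4 D2); ring.
Qed.

Lemma psi_lim (z : C) : 0 < Re z -> clim (fun m => psi (2 * INR m * z)) (/ 2)%C.
Proof.
intros Hz.
apply clim_squeeze_loc with (fun n => / (2 * Re z) * / INR n).
- exists 1%nat; intros n Hn; assert (0 < INR n) by (apply lt_0_INR; lia).
  replace (psi (2 * INR n * z) - / 2)%C with (/ (cexp (2 * INR n * z) - 1))%C by (unfold psi; ring).
  rewrite <- Rinv_mult; apply Cmod_inv_le; [apply Rmult_lt_0_compat; lra|].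
  pose proof (Cmod_gap (cexp (2 * INR n * z)) (- (1))%C) as G.
  rewrite Cmod_opp, Cmod_1, Cmod_cexp in G.
  replace (Re (2 * INR n * z)%C) with (2 * INR n * Re z) in G by (unfold Re; simpl; ring).
  pose proof (exp_ineq1_le (2 * INR n * Re z)).
  eapply Rle_trans; [|exact G]; lra.
- replace (Finite 0) with (Rbar_mult (/ (2 * Re z)) 0) by (simpl; f_equal; ring).
  apply is_lim_seq_scal_l.
  replace (Finite 0) with (Rbar_inv p_infty) by reflexivity.
  apply is_lim_seq_inv; [apply is_lim_seq_INR|discriminate].
Qed.

Lemma clim_inv_latpt (z : C) (k : nat) (u : nat -> C) : 0 < Re z ->
  (forall n, latpt (2 * INR n) z k (u n)) -> clim (fun n => / u n)%C 0%C.
Proof.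
intros Hz Hu; apply clim_squeeze_loc with (fun n => / (2 * Re z) * / INR n).
- exists 1%nat; intros n Hn; assert (0 < INR n) by (apply lt_0_INR; lia).
  replace (/ u n - 0)%C with (/ u n)%C by ring.
  rewrite <- Rinv_mult; apply Cmod_inv_le; [apply Rmult_lt_0_compat; lra|].
  pose proof (latpt_Re (2 * INR n) z (u n) k Hz) as G.
  eapply Rle_trans; [|apply G; [lra|apply Hu]]; lra.
- replace (Finite 0) with (Rbar_mult (/ (2 * Re z)) 0) by (simpl; f_equal; ring).
  apply is_lim_seq_scal_l.
  replace (Finite 0) with (Rbar_inv p_infty) by reflexivity.
  apply is_lim_seq_inv; [apply is_lim_seq_INR|discriminate].
Qed.

Definition qdual (z : C) (k : nat) : C := cexp (- (2 * PI ^ 2 * INR k / z))%C.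

(* The terms of the dual series, in the dual nome [exp (- 2 PI ^ 2 / z)]. *)
Definition edual (z : C) (k : nat) : C :=
  ((PI / z) ^ 2 * (qdual z k / ((1 + qdual z k) * (1 + qdual z k))))%C.

Lemma edual_0 (z : C) : 0 < Re z -> edual z 0 = (PI ^ 2 / (4 * z ^ 2))%C.
Proof.
intros Hz; pose proof (z_neq_0 z Hz); unfold edual, qdual.
replace (- (2 * PI ^ 2 * INR 0 / z))%C with (RtoC 0) by (simpl INR; field; assumption).
rewrite cexp_0; field; assumption.
Qed.

Lemma csummable_hfun_odd (z : C) : 0 < Re z -> csummable (fun l => hfun (odd l * z)).
Proof.
intros Hz.
set (r := exp (- Re z)).
assert (Hr : 0 < r < 1).
  split; [apply exp_pos|unfold r; rewrite <- exp_0; apply exp_increasing; lra].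
apply csummable_dom with (fun l => / (1 - r) ^ 2 * r ^ l).
2:{ apply ex_series_Rscal, ex_series_geom; rewrite Rabs_pos_eq; lra. }
intros l.
assert (Hre : Re (odd l * z)%C = odd l * Re z) by apply Re_scal.
pose proof (odd_ge l); pose proof (pos_INR l).
assert (H1 : exp (- Re (odd l * z)%C) <= r ^ l).
  rewrite Hre; unfold r; rewrite <- exp_nat; apply exp_le; nra.
assert (H2 : exp (- Re (odd l * z)%C) <= r) by (rewrite Hre; apply exp_le; nra).
eapply Rle_trans; [apply hfun_bound; rewrite Hre; apply Rmult_lt_0_compat; lra|].
unfold Rdiv; rewrite Rmult_comm; apply Rmult_le_compat; try (left; apply exp_pos).
- left; apply Rinv_0_lt_compat, pow_lt; lra.
- apply Rinv_le_contravar; [apply pow_lt; lra|apply pow_incr; lra].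
- exact H1.
Qed.

(** By [lsum2] the left side is the sum of 1 / (l z + k I2)^2 over odd l > 0 and all k, a double
    series of weight two that does not converge absolutely. Exchanging the sums leaves the
    correction - 1 / (4 z), as for the Eisenstein series of weight two. The row k = 0 is halved
    because [odd_sum] counts k and -k together. *)
Lemma hfun_odd_sum (z : C) : 0 < Re z ->
  csum (fun l => hfun (odd l * z))
  = (/ 2 * edual z 0 + csum (fun k => edual z (S k)) - / (4 * z))%C.
Proof.
intros Hz; pose proof (z_neq_0 z Hz) as Nz.
assert (Lo : forall l, cexp (odd l * z) <> 1%C).
  intros l; apply cexp_neq_1_Re; rewrite Re_scal; pose proof (odd_pos l); nra.
set (B := 2 * (Cmod z / (Re z * latc z)) ^ 2).
assert (Hd : forall l k, Cmod (sqpair z l k - telpair z l k)%C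
  <= B * (/ (INR l + 1) ^ 2 * / (INR k + 1) ^ 2)).
  intros; apply sqpair_telpair, Hz.
assert (HB : 0 <= B) by (unfold B; pose proof (pow2_ge_0 (Cmod z / (Re z * latc z))); lra).
assert (Sd : forall l, csummable (fun k => sqpair z l k - telpair z l k)%C).
  intros l; apply csummable_dom with (fun k => B * (/ (INR l + 1) ^ 2 * / (INR k + 1) ^ 2)).
    intros k; apply Hd.
  apply ex_series_Rscal, ex_series_Rscal, ex_series_inv_sq.
assert (Hh : forall l, csummable (sqpair z l) /\
  hfun (odd l * z) = ((/ (odd l * z)) ^ 2 + csum (sqpair z l))%C).
  intros l; destruct (cexp_latb _ (Lo l)) as [c0 Hl].
  rewrite <- lsum2 by apply Lo; apply (lsum_sym c0 _ 0 Hl).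
(* For finitely many l the exchange is free. The telescoped part reduces to a boundary term at 2 m
   z, evaluated by [lsum1]; since [psi] tends to 1/2 there, it tends to the correction. *)
assert (Hf : forall m, (0 < m)%nat -> cfsum (fun l => hfun (odd l * z)) m
  = (cfsum (fun l => (/ (odd l * z)) ^ 2) m
     + csum (fun k => cfsum (fun l => sqpair z l k - telpair z l k) m)
     - / (2 * z) * (psi (2 * INR m * z) - / (2 * INR m * z)))%C).
  intros m Hm.
  assert (Hm' : 0 < INR m) by (apply lt_0_INR, Hm).
  rewrite (cfsum_ext _ (fun l => (/ (odd l * z)) ^ 2 + csum (sqpair z l))%C) by (intros; apply Hh).
  rewrite cfsum_plus.
  destruct (csum_cfsum_swap (sqpair z) m (fun l => proj1 (Hh l))) as [_ ->].
  destruct (csum_cfsum_swap (fun l k => sqpair z l k - telpair z l k)%C m Sd) as [S1 _].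
  assert (Lm : cexp (2 * INR m * z) <> 1%C).
    apply cexp_neq_1_Re; replace (Re (2 * INR m * z)%C) with (2 * INR m * Re z) by (unfold Re; simpl; ring).
    nra.
  destruct (cexp_latb _ Lm) as [c1 Hl1]; destruct (lsum1_sym c1 _ Hl1) as [S2 E2].
  rewrite (csum_ext (fun k => cfsum (fun l => sqpair z l k) m) (fun k => cfsum (fun l => sqpair z l k - telpair z l k) m
     + (- / (2 * z)) * sterm 1 (2 * INR m * z) k))%C.
  2:{ intros k; rewrite <- telpair_sum by exact Hz; rewrite <- cfsum_plus; apply cfsum_ext; intros; ring. }
  rewrite csum_plus, csum_scal by (try apply csummable_scal; assumption).
  rewrite lsum1 in E2 by exact Lm; rewrite E2; ring.
destruct (odd_sum z 0 Hz) as [So0 Eo0'].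
pose proof (Eo0' : _ = edual z 0) as Eo0.
assert (Eh : forall l, ((/ (odd l * z)) ^ 2 = / 2 * ((/ (odd l * z + INR 0 * I2)) ^ 2 + (/ (odd l * z - INR 0 * I2)) ^ 2))%C).
  intros l; replace (odd l * z + INR 0 * I2)%C with (odd l * z)%C by (simpl INR; ring).
  replace (odd l * z - INR 0 * I2)%C with (odd l * z)%C by (simpl INR; ring).
  field; split; [exact Nz|apply RtoC_neq_0; pose proof (odd_pos l); lra].
apply clim_unique with (fun m => cfsum (fun l => hfun (odd l * z)) (m + 1)).
- apply (clim_incr (cfsum (fun l => hfun (odd l * z)))), cfsum_lim, csummable_hfun_odd, Hz.
- eapply clim_ext; [intros m; symmetry; apply Hf; lia|].
  replace (/ 2 * edual z 0 + csum (fun k => edual z (S k)) - / (4 * z))%C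
    with (/ 2 * edual z 0 + csum (fun k => edual z (S k)) - / (2 * z) * (/ 2 - 0))%C.
  2:{ field; repeat split; try exact Nz; try apply C2_neq_0; apply RtoC_neq_0; lra. }
  apply clim_minus; [apply clim_plus|].
  + apply (clim_incr (cfsum (fun l => (/ (odd l * z)) ^ 2)%C)).
    rewrite <- Eo0, <- csum_scal by exact So0; rewrite <- (csum_ext _ _ Eh).
    apply cfsum_lim, (csummable_ext _ _ (fun l => eq_sym (Eh l))), csummable_scal, So0.
  + apply (clim_incr (fun m => csum (fun k => cfsum (fun l => sqpair z l k - telpair z l k) m)%C)).
    apply tannery with (fun k => B * 2 * / (INR k + 1) ^ 2).
    * apply ex_series_Rscal, ex_series_inv_sq.
    * intros n k; eapply Rle_trans; [apply Cmod_cfsum|].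
      eapply Rle_trans; [apply rfsum_le; intros l _; apply Hd|].
      eapply Rle_trans with (rfsum (fun l => / (INR l + 1) ^ 2 * (B * / (INR k + 1) ^ 2)) n).
        apply rfsum_le; intros; lra.
      rewrite rfsum_scal_r.
      replace (B * 2 * / (INR k + 1) ^ 2) with (2 * (B * / (INR k + 1) ^ 2)) by ring.
      apply Rmult_le_compat_r; [|apply rfsum_inv_sq_le].
      apply Rmult_le_pos; [exact HB|left; apply inv_sq_pos].
    * intros k; destruct (odd_sum z (S k) Hz) as [So Eo'].
      pose proof (Eo' : _ = edual z (S k)) as Eo.
      replace (edual z (S k)) with (edual z (S k) - - / (2 * z) * (0 + 0))%C by ring.
      apply clim_ext with (fun m => cfsum (fun l => sqpair z l k) m - - / (2 * z) * sterm 1 (2 * INR m * z) k)%C.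
        intros m; rewrite <- telpair_sum by exact Hz.
        induction m as [|m IH]; simpl; [|rewrite <- IH]; ring.
      apply clim_minus; [rewrite <- Eo; apply cfsum_lim, So|].
      apply clim_scal; unfold sterm; apply clim_plus.
      -- apply clim_ext with (fun m => / (2 * INR m * z + INR (S k) * I2))%C.
           intros; rewrite Cpow_1_r; reflexivity.
         apply (clim_inv_latpt z (S k)); [exact Hz|left; rewrite RtoC_mult; reflexivity].
      -- apply clim_ext with (fun m => / (2 * INR m * z - INR (S k) * I2))%C.
           intros; rewrite Cpow_1_r; reflexivity.
         apply (clim_inv_latpt z (S k)); [exact Hz|right; rewrite RtoC_mult; reflexivity].
  + apply clim_scal, clim_minus.
    * apply (clim_incr (fun m => psi (2 * INR m * z))), psi_lim, Hz.
    * apply (clim_incr (fun m => / (2 * INR m * z))%C).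
      apply (clim_inv_latpt z 0); [exact Hz|left; rewrite RtoC_mult; simpl INR; ring].
Qed.

(** * Lambert series of the logarithmic derivative *)

Lemma csummable_pow (x : C) : Cmod x < 1 -> csummable (fun n => x ^ n)%C.
Proof.
intros H; apply csummable_dom with (fun n => Cmod x ^ n).
  intros n; rewrite Cmod_pow; lra.
apply ex_series_geom; rewrite Rabs_pos_eq; [exact H|apply Cmod_ge_0].
Qed.

Lemma one_minus_neq_0 (x : C) : Cmod x < 1 -> (1 - x)%C <> 0%C.
Proof.
intros H; apply Cminus_neq_0; intros E; rewrite <- E, Cmod_1 in H; lra.
Qed.

Lemma csum_geom (x : C) : Cmod x < 1 -> csum (fun n => x ^ n)%C = (/ (1 - x))%C.
Proof.
intros H; pose proof (csummable_pow x H) as S; pose proof (one_minus_neq_0 x H) as N.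
assert (E : csum (fun n => x ^ n)%C = (1 + x * csum (fun n => x ^ n))%C).
  rewrite (csum_incr_1 _ S) at 1; rewrite <- csum_scal by exact S; reflexivity.
set (g := csum (fun n => x ^ n)%C) in *.
replace g with (((1 + x * g) - x * g) / (1 - x))%C by (rewrite <- E; field; exact N).
field; exact N.
Qed.

Lemma ex_series_pow_exp (j : nat) (s : R) : 0 < s ->
  ex_series (fun n => INR n ^ j * exp (- (INR n * s))).
Proof.
intros Hs.
assert (B : forall x, 0 <= x -> x ^ j <= INR (Factorial.fact j) * (2 / s) ^ j * exp (x * s / 2)).
  intros x Hx.
  assert (Hy : 0 <= x * s / 2) by (apply Rmult_le_pos; [apply Rmult_le_pos|]; lra).
  pose proof (exp_ge_taylor (x * s / 2) j Hy) as T.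
  pose proof (INR_fact_lt_0 j) as Hf.
  assert (T2 : (x * s / 2) ^ j / INR (Factorial.fact j) <= exp (x * s / 2)).
    eapply Rle_trans; [|exact T].
    destruct j as [|j]; [simpl; lra|].
    rewrite tech5; assert (0 <= sum_f_R0 (fun k => (x * s / 2) ^ k / INR (Factorial.fact k)) j); [|lra].
    apply cond_pos_sum; intros k; apply Rmult_le_pos; [apply pow_le, Hy|].
    left; apply Rinv_0_lt_compat, INR_fact_lt_0.
  apply Rmult_le_compat_l with (r := INR (Factorial.fact j) * (2 / s) ^ j) in T2.
    replace (x ^ j) with (INR (Factorial.fact j) * (2 / s) ^ j * ((x * s / 2) ^ j / INR (Factorial.fact j))); [exact T2|].
    replace (INR (Factorial.fact j) * (2 / s) ^ j * ((x * s / 2) ^ j / INR (Factorial.fact j)))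
      with ((2 / s) ^ j * (x * s / 2) ^ j) by (field; lra).
    rewrite <- Rpow_mult_distr; f_equal; field; lra.
  apply Rmult_le_pos; [lra|apply pow_le; apply Rlt_le, Rdiv_lt_0_compat; lra].
apply ex_series_dom with (fun n => INR (Factorial.fact j) * (2 / s) ^ j * exp (- s / 2) ^ n).
- intros n; pose proof (pos_INR n); pose proof (exp_pos (- (INR n * s))).
  rewrite Rabs_pos_eq by (apply Rmult_le_pos; [apply pow_le|]; lra).
  rewrite <- exp_nat; specialize (B (INR n) H).
  replace (exp (INR n * (- s / 2))) with (exp (INR n * s / 2) * exp (- (INR n * s))).
    apply Rmult_le_compat_r with (r := exp (- (INR n * s))) in B; lra.
  rewrite <- exp_plus; f_equal; field.
- apply ex_series_Rscal, ex_series_geom.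
  rewrite Rabs_pos_eq by (left; apply exp_pos); rewrite <- exp_0; apply exp_increasing; lra.
Qed.

Lemma Cmod_cexp_neg (z : C) (n : nat) : Cmod (cexp (- z) ^ n)%C = exp (- (INR n * Re z)).
Proof.
rewrite Cmod_pow, Cmod_cexp, <- exp_nat; f_equal; unfold Re; simpl; ring.
Qed.

Lemma csummable_pow_q (j : nat) (z : C) : 0 < Re z ->
  csummable (fun n => (INR n ^ j)%R * cexp (- z) ^ n)%C.
Proof.
intros Hz; apply csummable_dom with (fun n => INR n ^ j * exp (- (INR n * Re z))).
  intros n; rewrite Cmod_mult, Cmod_cexp_neg, Cmod_R, Rabs_pos_eq; [lra|apply pow_le, pos_INR].
apply ex_series_pow_exp, Hz.
Qed.

Lemma Cmod_q_lt_1 (z : C) : 0 < Re z -> Cmod (cexp (- z)) < 1.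
Proof.
intros Hz; rewrite Cmod_cexp, <- exp_0; apply exp_increasing; unfold Re in *; simpl; lra.
Qed.

Lemma hfun_series (z : C) : 0 < Re z ->
  csum (fun n => INR (S n) * cexp (- z) ^ S n)%C = hfun z.
Proof.
intros Hz; pose proof (Cmod_q_lt_1 z Hz) as Hq; set (q := cexp (- z)) in *.
pose proof (one_minus_neq_0 q Hq) as N.
pose proof (csummable_pow_q 1 z Hz) as S1; fold q in S1.
assert (S2 : csummable (fun n => INR n * q ^ n)%C).
  apply csummable_ext with (2 := S1); intros n; rewrite pow_1; reflexivity.
assert (S3 : csummable (fun n => INR (S n) * q ^ S n)%C) by (apply (csummable_shift _ 1 S2)).
pose proof (csummable_pow q Hq) as S0.
assert (E : csum (fun n => INR n * q ^ n)%C = csum (fun n => INR (S n) * q ^ S n)%C).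
  rewrite (csum_incr_1 _ S2); simpl INR at 1; ring.
assert (E2 : csum (fun n => INR (S n) * q ^ S n)%C = (q * csum (fun n => INR n * q ^ n) + q * csum (fun n => q ^ n))%C).
  rewrite <- !csum_scal, <- csum_plus by (try apply csummable_scal; assumption).
  apply csum_ext; intros n; rewrite S_INR, RtoC_plus, Cpow_S; ring.
rewrite csum_geom in E2 by exact Hq; rewrite E in E2.
set (g := csum (fun n => INR (S n) * q ^ S n)%C) in *.
assert (Nz : cexp z <> 0%C) by apply cexp_neq_0.
assert (Eq : q = (/ cexp z)%C) by apply cexp_opp.
assert (N3 : (cexp z - 1)%C <> 0%C).
  apply Cminus_neq_0, cexp_neq_1_Re; lra.
transitivity (q / ((1 - q) * (1 - q)))%C.
  replace g with ((g - q * g) / (1 - q))%C by (field; exact N).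
  rewrite E2 at 1; field; exact N.
rewrite Eq in *; unfold hfun; field; repeat split; try assumption.
Qed.

(* [- tterm z i] is the logarithmic derivative in [z] of [(1 + q ^ S i) / (1 - q ^ S i)], where
   [q = exp (- z)]. *)
Definition tterm (z : C) (i : nat) : C :=
  (2 * INR (S i) * (cexp (- z) ^ S i / (1 - cexp (- z) ^ S i * cexp (- z) ^ S i)))%C.

Lemma Cmod_q_pow_lt_1 (z : C) (i : nat) : 0 < Re z -> Cmod (cexp (- z) ^ S i)%C < 1.
Proof.
intros Hz; rewrite Cmod_pow; apply pow_lt_1_compat; [|lia].
split; [apply Cmod_ge_0|apply Cmod_q_lt_1, Hz].
Qed.

Lemma tterm_series (z : C) (i : nat) : 0 < Re z ->
  csum (fun l => 2 * (INR (S i) * cexp (- (odd l * z)) ^ S i))%C = tterm z i.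
Proof.
intros Hz; pose proof (Cmod_q_pow_lt_1 z i Hz) as Hq.
set (w := (cexp (- z) ^ S i)%C) in *.
assert (Hw : Cmod (w * w)%C < 1).
  rewrite Cmod_mult; pose proof (Cmod_ge_0 w); nra.
rewrite (csum_ext _ (fun l => 2 * INR (S i) * w * (w * w) ^ l)%C).
  rewrite csum_scal, csum_geom by (try apply csummable_pow; exact Hw).
  unfold tterm; fold w; field; apply one_minus_neq_0, Hw.
intros l.
assert (E : (cexp (- (odd l * z)) ^ S i = w * (w * w) ^ l)%C).
  replace (cexp (- (odd l * z))) with (cexp (- z) ^ S (2 * l))%C.
    rewrite <- Cpow_mult_r, Nat.mul_comm, Cpow_mult_r; fold w.
    rewrite Cpow_S, Cpow_mult_r; simpl; do 2 f_equal; ring.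
  rewrite <- cexp_nat; f_equal; rewrite odd_eq, S_INR, mult_INR, RtoC_plus, RtoC_mult; simpl INR; rewrite !RtoC_plus; ring.
rewrite E; ring.
Qed.

Lemma Cmod_one_minus_ge (x : C) : 1 - Cmod x <= Cmod (1 - x)%C.
Proof.
pose proof (Cmod_gap 1 (- x)%C) as G; rewrite Cmod_opp, Cmod_1 in G; exact G.
Qed.

Lemma tterm_bound (z : C) (i : nat) : 0 < Re z ->
  Cmod (tterm z i) <= 2 * INR (S i) * exp (- (INR (S i) * Re z)) / (1 - exp (- Re z)).
Proof.
intros Hz; pose proof (Cmod_q_pow_lt_1 z i Hz) as Hq.
assert (Er : exp (- Re z) < 1) by (rewrite <- exp_0; apply exp_increasing; lra).
set (w := (cexp (- z) ^ S i)%C) in *.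
assert (Ew : Cmod w = exp (- (INR (S i) * Re z))) by apply Cmod_cexp_neg.
pose proof (Cmod_ge_0 w).
assert (Hww : Cmod (w * w)%C < 1) by (rewrite Cmod_mult; nra).
unfold tterm; fold w; rewrite !Cmod_mult, Cmod_div by apply one_minus_neq_0, Hww.
rewrite !Cmod_R, !Rabs_pos_eq by (try apply pos_INR; lra); rewrite <- Ew.
unfold Rdiv; rewrite <- !Rmult_assoc; apply Rmult_le_compat_l.
  apply Rmult_le_pos; [pose proof (pos_INR (S i))|]; lra.
apply Rinv_le_contravar; [lra|].
eapply Rle_trans; [|apply Cmod_one_minus_ge]; rewrite Cmod_mult.
assert (Cmod w <= exp (- Re z)).
  rewrite Ew; apply exp_le; rewrite S_INR; pose proof (pos_INR i); nra.
nra.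
Qed.

Lemma ex_series_tbound (s : R) : 0 < s ->
  ex_series (fun i => 2 * INR (S i) * exp (- (INR (S i) * s)) / (1 - exp (- s))).
Proof.
intros Hs.
apply ex_series_ext with (fun i => 2 / (1 - exp (- s)) * (INR (S i) ^ 1 * exp (- (INR (S i) * s)))).
  intros i; rewrite pow_1; match goal with |- ?a = ?b => change (@eq R a b) end; field.
  assert (exp (- s) < 1) by (rewrite <- exp_0; apply exp_increasing; lra); lra.
apply ex_series_Rscal, (ex_series_shift (fun i => INR i ^ 1 * exp (- (INR i * s))) 1), ex_series_pow_exp, Hs.
Qed.

Lemma csummable_tterm (z : C) : 0 < Re z -> csummable (tterm z).
Proof.
intros Hz; eapply csummable_dom; [intros i; apply tterm_bound, Hz|apply ex_series_tbound, Hz].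
Qed.

(** A geometric expansion of each term gives the double sum of 2 i q^(i l) over i >= 1 and odd l.
    Summing over i first produces [hfun] at the odd multiples of z, hence [hfun_odd_sum]. *)
Lemma tterm_sum (z : C) : 0 < Re z ->
  csum (tterm z) = (PI ^ 2 / (4 * z ^ 2) - / (2 * z) + 2 * csum (fun k => edual z (S k)))%C.
Proof.
intros Hz; pose proof (z_neq_0 z Hz) as Nz.
transitivity (2 * csum (fun l => hfun (odd l * z)))%C.
2:{ rewrite hfun_odd_sum, edual_0 by exact Hz; field; repeat split; try assumption; apply C2_neq_0. }
rewrite <- csum_scal by apply csummable_hfun_odd, Hz.
assert (Re_odd : forall l, 0 < Re (odd l * z)%C).
  intros l; rewrite Re_scal; apply Rmult_lt_0_compat; [apply odd_pos|exact Hz].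
rewrite (csum_ext (tterm z) (fun i => csum (fun l => 2 * (INR (S i) * cexp (- (odd l * z)) ^ S i))%C)).
2:{ intros i; symmetry; apply tterm_series, Hz. }
assert (G : forall l, (2 * hfun (odd l * z)
  = csum (fun i => 2 * (INR (S i) * cexp (- (odd l * z)) ^ S i)))%C).
  intros l.
  assert (Sl : csummable (fun i => INR (S i) * cexp (- (odd l * z)) ^ S i)%C).
    apply csummable_ext with (fun n => (INR (S n) ^ 1)%R * cexp (- (odd l * z)) ^ S n)%C.
      intros; rewrite pow_1; reflexivity.
    apply (csummable_shift _ 1 (csummable_pow_q 1 _ (Re_odd l))).
  rewrite csum_scal by exact Sl; rewrite hfun_series by apply Re_odd; reflexivity.
rewrite (csum_ext (fun l => 2 * hfun (odd l * z))%C _ G).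
apply csum_swap with (fun i => 2 * (INR (S i) * exp (- (INR (S i) * Re z)))) (fun l => exp (- Re z) ^ l).
- apply ex_series_Rscal.
  apply ex_series_ext with (fun i => INR (S i) ^ 1 * exp (- (INR (S i) * Re z))).
    intros i; rewrite pow_1; reflexivity.
  apply (ex_series_shift (fun i => INR i ^ 1 * exp (- (INR i * Re z))) 1), ex_series_pow_exp, Hz.
- apply ex_series_geom; rewrite Rabs_pos_eq by (left; apply exp_pos).
  rewrite <- exp_0; apply exp_increasing; lra.
- intros i l; rewrite !Cmod_mult, Cmod_cexp_neg, !Cmod_R, !Rabs_pos_eq by (try apply pos_INR; lra).
  rewrite <- exp_nat, !Rmult_assoc, <- exp_plus, Re_scal.
  apply Rmult_le_compat_l; [lra|]; apply Rmult_le_compat_l; [apply pos_INR|].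
  apply exp_le; unfold odd; rewrite S_INR; pose proof (pos_INR i); pose proof (pos_INR l).
  assert (0 <= INR i * INR l) by (apply Rmult_le_pos; lra); nra.
Qed.

(** * The generating function *)

Fixpoint gf (K : nat) (q : C) : C :=
  match K with
  | O => 1%C
  | S K => (gf K q * ((1 + q ^ S K) / (1 - q ^ S K)))%C
  end.

Fixpoint gfR (K : nat) (r : R) : R :=
  match K with
  | O => 1
  | S K => gfR K r * ((1 + r ^ S K) / (1 - r ^ S K))
  end.

Lemma Cmod_pow_lt_1 (q : C) (k : nat) : Cmod q < 1 -> Cmod (q ^ S k)%C < 1.
Proof.
intros H; rewrite Cmod_pow; apply pow_lt_1_compat; [split; [apply Cmod_ge_0|exact H]|lia].
Qed.

Lemma pow_S_bounds (r : R) (k : nat) : 0 < r < 1 -> 0 < r ^ S k < 1.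
Proof. intros H; split; [apply pow_lt; lra|apply pow_lt_1_compat; [lra|lia]]. Qed.

Lemma gfR_pos (K : nat) (r : R) : 0 < r < 1 -> 0 < gfR K r.
Proof.
intros H; induction K as [|K IH]; cbn [gfR]; [lra|].
pose proof (pow_S_bounds r K H).
apply Rmult_lt_0_compat; [exact IH|apply Rdiv_lt_0_compat; lra].
Qed.

Lemma gf_gfR (K : nat) (r : R) : 0 < r < 1 -> gf K r = gfR K r.
Proof.
intros H; induction K as [|K IH]; [reflexivity|].
cbn [gf gfR]; rewrite IH, <- RtoC_pow.
pose proof (pow_S_bounds r K H).
rewrite RtoC_mult, RtoC_div by lra; rewrite RtoC_plus, RtoC_minus; reflexivity.
Qed.

Lemma cderiv_gf (K : nat) (z : C) : 0 < Re z ->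
  cderiv (fun u => gf K (cexp (- u))) z (- cfsum (tterm z) K * gf K (cexp (- z)))%C.
Proof.
intros Hz; induction K as [|K IH].
  simpl; replace (- 0 * 1)%C with (RtoC 0) by ring; apply cderiv_const.
cbn [gf cfsum].
set (w := (cexp (- z) ^ S K)%C).
assert (Hw : Cmod w < 1) by (apply Cmod_q_pow_lt_1, Hz).
pose proof (one_minus_neq_0 w Hw) as N1.
assert (N2 : (1 + w)%C <> 0%C).
  replace (1 + w)%C with (1 - - w)%C by ring; apply one_minus_neq_0; rewrite Cmod_opp; exact Hw.
set (c := (- INR (S K))%C).
assert (Ew : forall u, (cexp (- u) ^ S K = cexp (c * u))%C).
  intros u; rewrite <- cexp_nat; f_equal; unfold c; ring.
assert (Dw : cderiv (fun u => cexp (- u) ^ S K)%C z (c * w)%C).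
  apply cderiv_ext with (fun u => cexp (c * u)); [intros u; symmetry; apply Ew|].
  unfold w; rewrite Ew; apply cderiv_cexp_lin.
assert (D1 : cderiv (fun u => 1 + cexp (- u) ^ S K)%C z (0 + c * w)%C).
  apply cderiv_plus; [apply cderiv_const|exact Dw].
assert (D2 : cderiv (fun u => 1 - cexp (- u) ^ S K)%C z (0 + - (1) * (c * w))%C).
  apply cderiv_ext with (fun u => 1 + - (1) * cexp (- u) ^ S K)%C; [intros; ring|].
  apply cderiv_plus; [apply cderiv_const|apply cderiv_scal, Dw].
pose proof (cderiv_mult _ _ _ _ _ D1 (cderiv_inv (fun u => 1 - cexp (- u) ^ S K)%C _ _ N1 D2)) as D3.
pose proof (cderiv_mult _ _ _ _ _ IH D3) as D; clear D1 D2 D3.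
fold w in D.
match type of D with cderiv _ _ ?e => match goal with |- cderiv _ _ ?g =>
  replace g with e; [exact D|] end end.
unfold tterm; fold w; fold c.
replace (RtoC (INR (S K))) with (- c)%C by (unfold c; ring).
assert (N3 : (1 - w * w)%C <> 0%C).
  replace (1 - w * w)%C with ((1 - w) * (1 + w))%C by ring; apply Cmult_neq_0; assumption.
field; repeat split; assumption.
Qed.

Lemma Cmod_gf_le (K : nat) (q : C) : 0 < Cmod q < 1 -> Cmod (gf K q) <= gfR K (Cmod q).
Proof.
intros H; induction K as [|K IH]; cbn [gf gfR]; [rewrite Cmod_1; lra|].
rewrite Cmod_mult; apply Rmult_le_compat; try apply Cmod_ge_0; [exact IH|].
pose proof (Cmod_pow_lt_1 q K (proj2 H)) as Hw.
pose proof (pow_S_bounds _ K H).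
rewrite Cmod_div by apply one_minus_neq_0, Hw.
rewrite <- Cmod_pow in *.
apply Rmult_le_compat; try apply Cmod_ge_0.
- left; apply Rinv_0_lt_compat, Cmod_gt_0, one_minus_neq_0, Hw.
- eapply Rle_trans; [apply Cmod_triangle|]; rewrite Cmod_1; lra.
- apply Rinv_le_contravar; [lra|apply Cmod_one_minus_ge].
Qed.

(* [o K n] is to count the overpartitions of [n] with all parts at most [K]. *)
Definition opcount (o : nat -> nat -> R) : Prop :=
  (forall n, o O n = match n with O => 1 | _ => 0 end) /\
  (forall K n, 0 <= o K n) /\
  (forall K n, (n < S K)%nat -> o (S K) n = o K n) /\
  (forall K n, o (S K) (S K + n)%nat = o K (S K + n)%nat + o (S K) n + o K n).

Definition shiftn (k : nat) (u : nat -> C) (n : nat) : C :=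
  if Nat.ltb n k then 0%C else u (n - k)%nat.

Lemma csum_shiftn (k : nat) (u : nat -> C) : csummable u ->
  csummable (shiftn k u) /\ csum (shiftn k u) = csum u.
Proof.
intros Hu.
assert (E : forall n, shiftn k u (k + n)%nat = u n).
  intros n; unfold shiftn; replace (Nat.ltb (k + n) k) with false.
    f_equal; lia.
  symmetry; apply Nat.ltb_ge; lia.
assert (S1 : csummable (shiftn k u)).
  unfold csummable; apply (ex_series_incr_n _ k).
  apply ex_series_ext with (fun n => Cmod (u n)); [intros n; rewrite E; reflexivity|exact Hu].
split; [exact S1|].
rewrite (csum_cfsum _ k S1), (csum_ext _ u E).
rewrite (cfsum_ext _ (fun _ => 0%C)).
  replace (cfsum (fun _ => 0%C) k) with (RtoC 0); [ring|].
  clear; induction k as [|k IH]; simpl; [reflexivity|rewrite <- IH; ring].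
intros n Hn; unfold shiftn; replace (Nat.ltb n k) with true; [reflexivity|].
symmetry; apply Nat.ltb_lt, Hn.
Qed.

Lemma rfsum_ext (u v : nat -> R) (m : nat) :
  (forall k, (k < m)%nat -> u k = v k) -> rfsum u m = rfsum v m.
Proof.
intros H; apply Rle_antisym; apply rfsum_le; intros k Hk; rewrite H by exact Hk; lra.
Qed.

Lemma rfsum_split (u : nat -> R) (m p : nat) :
  rfsum u (m + p) = rfsum u m + rfsum (fun k => u (m + k)%nat) p.
Proof.
induction p as [|p IH]; [rewrite Nat.add_0_r; simpl; ring|].
rewrite Nat.add_succ_r; simpl; rewrite IH; ring.
Qed.

Lemma rfsum_plus (u v : nat -> R) (m : nat) :
  rfsum (fun k => u k + v k) m = rfsum u m + rfsum v m.
Proof. induction m as [|m IH]; simpl; [|rewrite IH]; ring. Qed.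

Lemma rfsum_mono (u : nat -> R) (m p : nat) : (forall k, 0 <= u k) -> (m <= p)%nat ->
  rfsum u m <= rfsum u p.
Proof.
intros H Hm; replace p with (m + (p - m))%nat by lia; rewrite rfsum_split.
assert (0 <= rfsum (fun k => u (m + k)%nat) (p - m)); [|lra].
generalize (p - m)%nat; intros t; induction t as [|t IH]; simpl; [lra|].
specialize (H (m + t)%nat); lra.
Qed.

(** The recurrence bounds a partial sum U of the new series by Sv + r^k (U + Sv), where Sv is the
    sum of the old one; as r^k < 1, this can be solved for U. *)
Lemma opcount_summable (o : nat -> nat -> R) (r : R) (K : nat) : opcount o -> 0 < r < 1 ->
  ex_series (fun n => o K n * r ^ n).
Proof.
intros [H0 [Hpos [Hlt Hrec]]] Hr.
assert (P : forall K n, 0 <= o K n * r ^ n).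
  intros k n; apply Rmult_le_pos; [apply Hpos|apply pow_le; lra].
induction K as [|K IH].
  apply ex_series_bounded with 1; [apply P|].
  intros n; destruct n as [|n]; [simpl; lra|].
  replace (S n) with (1 + n)%nat by lia; rewrite rfsum_split; simpl; rewrite H0.
  rewrite (rfsum_ext _ (fun _ => 0)) by (intros; rewrite H0; ring).
  clear; induction n; simpl in *; lra.
specialize (Hlt K); specialize (Hrec K).
set (k := S K) in *; pose proof (pow_S_bounds r K Hr) as Hk; fold k in Hk.
set (v := fun n => o K n * r ^ n) in *; set (u := fun n => o k n * r ^ n) in *.
pose proof (fun N => rfsum_le_Series v N (P K) IH) as Bv; set (Sv := Series v) in *.
assert (Sv0 : 0 <= Sv) by (apply (Bv O)).
apply ex_series_bounded with (Sv * (1 + r ^ k) / (1 - r ^ k)); [apply (P k)|].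
intros N.
apply Rle_trans with (rfsum u (k + N)).
  apply rfsum_mono; [apply (P k)|lia].
assert (E : rfsum u (k + N) = rfsum v (k + N) + r ^ k * (rfsum u N + rfsum v N)).
  rewrite !rfsum_split.
  rewrite (rfsum_ext u v k) by (intros n Hn; unfold u, v; rewrite Hlt by exact Hn; reflexivity).
  rewrite (rfsum_ext (fun n => u (k + n)%nat) (fun n => v (k + n)%nat + (u n + v n) * r ^ k)).
    rewrite rfsum_plus, rfsum_scal_r, rfsum_plus; ring.
  intros n _; unfold u, v; rewrite Hrec, pow_add; ring.
pose proof (Bv N); pose proof (Bv (k + N)%nat).
assert (rfsum u N <= rfsum u (k + N)) by (apply rfsum_mono; [apply (P k)|lia]).
apply Rmult_le_reg_r with (1 - r ^ k); [lra|].
replace (Sv * (1 + r ^ k) / (1 - r ^ k) * (1 - r ^ k)) with (Sv * (1 + r ^ k)) by (field; lra).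
nra.
Qed.

Lemma opcount_csummable (o : nat -> nat -> R) (q : C) (K : nat) : opcount o -> 0 < Cmod q < 1 ->
  csummable (fun n => o K n * q ^ n)%C.
Proof.
intros Ho Hq; apply csummable_dom with (fun n => o K n * Cmod q ^ n).
  intros n; rewrite Cmod_mult, Cmod_pow, Cmod_R, Rabs_pos_eq; [lra|apply Ho].
apply opcount_summable; assumption.
Qed.

(** Summed against q^n, the recurrence reads u = v + w (u + v) with w = q^(K+1), and it is solved
    for u. *)
Lemma opcount_gf (o : nat -> nat -> R) (q : C) (K : nat) : opcount o -> 0 < Cmod q < 1 ->
  csum (fun n => o K n * q ^ n)%C = gf K q.
Proof.
intros Ho Hq; assert (Hs := fun K => opcount_csummable o q K Ho Hq).
induction K as [|K IH].
  rewrite (csum_incr_1 _ (Hs O)), (csum_ext _ (fun _ => 0%C)), csum_0.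
    rewrite (proj1 Ho); simpl; ring.
  intros n; rewrite (proj1 Ho); ring.
cbn [gf]; rewrite <- IH.
set (u := fun n => (o (S K) n * q ^ n)%C) in *; set (v := fun n => (o K n * q ^ n)%C) in *.
assert (Su : csummable u) by apply Hs; assert (Sv : csummable v) by apply Hs.
destruct (csum_shiftn (S K) (fun n => u n + v n)%C) as [Sw Ew]; [apply csummable_plus; assumption|].
assert (E : csum u = (csum v + q ^ S K * (csum u + csum v))%C).
  rewrite <- csum_plus, <- Ew, <- csum_scal, <- csum_plus by (try apply csummable_scal; assumption).
  apply csum_ext; intros n; unfold shiftn.
  destruct Ho as [_ [_ [Hlt Hrec]]].
  destruct (Nat.ltb_spec n (S K)) as [Hn|Hn].
    unfold u, v; rewrite Hlt by exact Hn; ring.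
  replace n with (S K + (n - S K))%nat at 1 2 by lia.
  unfold u, v; rewrite Hrec, !RtoC_plus, Cpow_add_r; ring.
pose proof (one_minus_neq_0 _ (Cmod_pow_lt_1 q K (proj2 Hq))) as N.
set (w := (q ^ S K)%C) in *.
replace (csum u) with ((csum u - w * csum u) / (1 - w))%C by (field; exact N).
rewrite E at 1; field; exact N.
Qed.

(** * The main term and its generating function *)

(* [aco i = PI ^ (2 i + 1) i! / (2 i + 1)!], the coefficients of a series in [/ z] solving the
   differential equation [cderiv_yfun]. *)
Fixpoint aco (i : nat) : R :=
  match i with O => PI | S i => aco i * (PI ^ 2 / (4 * INR i + 6)) end.

Lemma aco_pos (i : nat) : 0 < aco i.
Proof.
pose proof PI_RGT_0; induction i as [|i IH]; cbn [aco]; [lra|].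
apply Rmult_lt_0_compat; [exact IH|apply Rdiv_lt_0_compat; [nra|pose proof (pos_INR i); lra]].
Qed.

Lemma aco_rec (i : nat) : (4 * INR i + 6) * aco (S i) = PI ^ 2 * aco i.
Proof. cbn [aco]; field; pose proof (pos_INR i); lra. Qed.

(** Replaces 4 i + 6 by 4 (i + 1) in the recurrence. The growth exp (PI^2 / (4 |z|)) obtained for
    [yfun] has the exponent of the generating function itself on the real axis, so nothing is lost
    at the exponential scale. *)
Lemma aco_le (i : nat) : aco i <= PI * ((PI ^ 2 / 4) ^ i / INR (Factorial.fact i)).
Proof.
pose proof PI_RGT_0; induction i as [|i IH]; [simpl; lra|].
cbn [aco]; rewrite fact_simpl, mult_INR.
pose proof (INR_fact_lt_0 i); pose proof (pos_INR i); pose proof (S_INR i) as Si.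
apply Rle_trans with (PI * ((PI ^ 2 / 4) ^ i / INR (Factorial.fact i)) * (PI ^ 2 / (4 * INR (S i)))).
- apply Rmult_le_compat; [left; apply aco_pos| |exact IH|].
    left; apply Rdiv_lt_0_compat; nra.
  apply Rmult_le_compat_l; [nra|apply Rinv_le_contravar; lra].
- right; simpl pow; field; lra.
Qed.

Lemma is_series_exp (x : R) : is_series (fun n => x ^ n / INR (Factorial.fact n)) (exp x).
Proof.
pose proof (is_exp_Reals x) as H; apply is_pseries_R in H.
eapply is_series_ext; [|exact H]; intros n; simpl; unfold Rdiv; apply Rmult_comm.
Qed.

Lemma ex_series_aco (t : R) : 0 <= t -> ex_series (fun i => aco i * t ^ i).
Proof.
intros Ht; pose proof PI_RGT_0.
apply ex_series_dom with (fun i => PI * ((PI ^ 2 / 4 * t) ^ i / INR (Factorial.fact i))).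
- intros i; pose proof (aco_pos i); assert (0 <= t ^ i) by (apply pow_le, Ht).
  rewrite Rabs_pos_eq by (apply Rmult_le_pos; lra).
  rewrite Rpow_mult_distr.
  replace (PI * ((PI ^ 2 / 4) ^ i * t ^ i / INR (Factorial.fact i)))
    with (PI * ((PI ^ 2 / 4) ^ i / INR (Factorial.fact i)) * t ^ i).
    apply Rmult_le_compat_r; [lra|apply aco_le].
  field; apply INR_fact_neq_0.
- apply ex_series_Rscal; eexists; apply is_series_exp.
Qed.

Lemma Series_aco_le (t : R) : 0 <= t -> Series (fun i => aco i * t ^ i) <= PI * exp (PI ^ 2 / 4 * t).
Proof.
intros Ht; pose proof PI_RGT_0.
rewrite <- (is_series_unique _ _ (is_series_exp (PI ^ 2 / 4 * t))), <- Series_scal_l.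
apply Series_le.
- intros i; pose proof (aco_pos i); assert (0 <= t ^ i) by (apply pow_le, Ht).
  split; [apply Rmult_le_pos; lra|].
  rewrite Rpow_mult_distr.
  replace (PI * ((PI ^ 2 / 4) ^ i * t ^ i / INR (Factorial.fact i)))
    with (PI * ((PI ^ 2 / 4) ^ i / INR (Factorial.fact i)) * t ^ i).
    apply Rmult_le_compat_r; [lra|apply aco_le].
  field; apply INR_fact_neq_0.
- apply ex_series_Rscal; eexists; apply is_series_exp.
Qed.

Definition yfun (z : C) : C := csum (fun i => aco i * (/ z) ^ i)%C.

Lemma Cmod_aco_term (z : C) (i : nat) : Cmod (aco i * (/ z) ^ i)%C = aco i * Cmod (/ z)%C ^ i.
Proof.
rewrite Cmod_mult, Cmod_pow, Cmod_R, Rabs_pos_eq; [reflexivity|left; apply aco_pos].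
Qed.

Lemma csummable_yfun (z : C) : csummable (fun i => aco i * (/ z) ^ i)%C.
Proof.
apply csummable_dom with (fun i => aco i * Cmod (/ z)%C ^ i).
  intros i; rewrite Cmod_aco_term; lra.
apply ex_series_aco, Cmod_ge_0.
Qed.

Lemma Cmod_yfun_le (z : C) : Cmod (yfun z) <= PI * exp (PI ^ 2 / 4 * Cmod (/ z)%C).
Proof.
eapply Rle_trans; [|apply Series_aco_le, Cmod_ge_0].
apply Cmod_csum_le; [|apply ex_series_aco, Cmod_ge_0].
intros i; rewrite Cmod_aco_term; lra.
Qed.

Lemma INR_le_pow2 (i : nat) : INR i + 1 <= 2 ^ i.
Proof. induction i as [|i IH]; [simpl; lra|rewrite S_INR; simpl; pose proof (pos_INR i); lra]. Qed.

Lemma tri_le_pow2 (i : nat) : INR i * INR (S i) / 2 <= 2 ^ i.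
Proof.
induction i as [|i IH]; [simpl; lra|].
pose proof (INR_le_pow2 i); rewrite !S_INR in *; simpl; nra.
Qed.

(** In the coefficient of (1 / z)^(i+2) the equation is [aco_rec]; the coefficient of 1 / z is aco 0
    / 2 - PI / 2 = 0, which accounts for the term - PI / (2 z). *)
Lemma cderiv_yfun (z : C) : z <> 0%C ->
  cderiv yfun z ((/ (2 * z) - PI ^ 2 / (4 * z ^ 2)) * yfun z - PI / (2 * z))%C.
Proof.
intros Nz; assert (Pz : 0 < Cmod z) by (apply Cmod_gt_0, Nz).
set (d := fun i => (- (aco i * INR i)%R * (/ z) ^ S i)%C).
assert (Sd : csummable d).
  apply csummable_dom with (fun i => Cmod (/ z)%C * (aco i * (2 * Cmod (/ z)%C) ^ i)).
  2:{ apply ex_series_Rscal, ex_series_aco; pose proof (Cmod_ge_0 (/ z)%C); lra. }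
  intros i; unfold d; rewrite Cmod_mult, Cmod_opp, Cmod_pow, Cmod_R.
  pose proof (aco_pos i); pose proof (pos_INR i); pose proof (Cmod_ge_0 (/ z)%C) as H1.
  assert (H2 : 0 <= Cmod (/ z)%C ^ i) by (apply pow_le, H1).
  rewrite Rabs_pos_eq by (apply Rmult_le_pos; lra); rewrite Rpow_mult_distr; simpl pow.
  pose proof (INR_le_pow2 i).
  assert (aco i * INR i <= aco i * 2 ^ i) by (apply Rmult_le_compat_l; lra).
  assert (0 <= Cmod (/ z)%C * Cmod (/ z)%C ^ i) by (apply Rmult_le_pos; lra).
  nra.
assert (D : cderiv yfun z (csum d)).
  apply (cderiv_csum (fun i u => aco i * (/ u) ^ i)%C z d (Cmod z / 2)
    (fun i => (2 / Cmod z) ^ 2 * (aco i * (4 / Cmod z) ^ i))).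
  - lra.
  - apply ex_series_Rscal, ex_series_aco; left; apply Rdiv_lt_0_compat; lra.
  - intros h _; apply csummable_yfun.
  - exact Sd.
  - intros i h Hh; unfold d.
    replace (_ - _)%C with (aco i * ((/ (z + h)) ^ i - (/ z) ^ i + INR i * h * (/ z) ^ S i))%C
      by (rewrite RtoC_mult; ring).
    rewrite Cmod_mult, Cmod_R, Rabs_pos_eq by (left; apply aco_pos).
    pose proof (aco_pos i) as Ha.
    eapply Rle_trans; [apply Rmult_le_compat_l; [lra|apply invpow_taylor; lra]|].
    assert (I1 : (/ (Cmod z - Cmod h)) ^ S (S i) <= (2 / Cmod z) ^ S (S i)).
      apply pow_incr; split; [left; apply Rinv_0_lt_compat; lra|].
      replace (2 / Cmod z) with (/ (Cmod z / 2)) by (field; lra).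
      apply Rinv_le_contravar; lra.
    assert (I2 : 0 <= (2 / Cmod z) ^ S (S i)) by (apply pow_le; left; apply Rdiv_lt_0_compat; lra).
    pose proof (tri_le_pow2 i) as I3; pose proof (pow2_ge_0 (Cmod h)) as I4.
    assert (I5 : 0 <= INR i * INR (S i) / 2).
      pose proof (pos_INR i); pose proof (pos_INR (S i)); nra.
    apply Rle_trans with (aco i * (2 ^ i * Cmod h ^ 2 * (2 / Cmod z) ^ S (S i))).
      apply Rmult_le_compat_l; [lra|].
      apply Rmult_le_compat; [apply Rmult_le_pos; lra| |apply Rmult_le_compat_r; lra|exact I1].
      apply pow_le; left; apply Rinv_0_lt_compat; lra.
    right; replace (4 / Cmod z) with (2 * (2 / Cmod z)) by (field; lra).
    rewrite Rpow_mult_distr; simpl pow; ring.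
match goal with |- cderiv _ _ ?g => replace g with (csum d); [exact D|] end.
rewrite (csum_incr_1 _ Sd).
assert (E : forall i, (d (S i) = - PI ^ 2 / (4 * z ^ 2) * (aco i * (/ z) ^ i)
   + / (2 * z) * (aco (S i) * (/ z) ^ S i))%C).
  intros i; unfold d.
  assert (R : aco (S i) * INR (S i) = (PI ^ 2 * aco i - 2 * aco (S i)) / 4).
    rewrite <- aco_rec, S_INR; field.
  rewrite R, !Cpow_S, RtoC_div, RtoC_minus, !RtoC_mult, RtoC_pow by lra.
  field; repeat split; try exact Nz; try apply C2_neq_0; apply RtoC_neq_0; lra.
pose proof (csummable_yfun z) as Sy.
pose proof (csummable_shift _ 1 Sy) as Sy1.
rewrite (csum_ext _ _ E), csum_plus, !csum_scal by (try apply csummable_scal; assumption).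
assert (Ey : yfun z = (PI + csum (fun i => aco (S i) * (/ z) ^ S i))%C).
  unfold yfun; rewrite (csum_incr_1 _ Sy); simpl; ring.
change (csum (fun n => aco n * (/ z) ^ n)%C) with (yfun z).
replace (csum (fun n => aco (S n) * (/ z) ^ S n)%C) with (yfun z - PI)%C by (rewrite Ey; ring).
unfold d; simpl INR; rewrite Rmult_0_r.
field; repeat split; try exact Nz; try apply C2_neq_0; apply RtoC_neq_0; lra.
Qed.

Definition powsum (j : nat) (z : C) : C := csum (fun n => (INR n ^ j)%R * cexp (- z) ^ n)%C.

Lemma cderiv_powsum (j : nat) (z : C) : 0 < Re z ->
  cderiv (powsum j) z (- powsum (S j) z)%C.
Proof.
intros Hz; set (s := Re z) in *.
assert (Hh : forall h, Cmod h < Rmin 1 (s / 2) -> Cmod h < 1 /\ Cmod h < s / 2).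
  intros h H; pose proof (Rmin_l 1 (s / 2)); pose proof (Rmin_r 1 (s / 2)); lra.
replace (- powsum (S j) z)%C
  with (csum (fun n => - (1) * ((INR n ^ S j)%R * cexp (- z) ^ n))%C).
2:{ rewrite csum_scal by apply (csummable_pow_q (S j) z Hz); unfold powsum; ring. }
apply (cderiv_csum (fun n u => (INR n ^ j)%R * cexp (- u) ^ n)%C z _ (Rmin 1 (s / 2))
  (fun n => 2 * (INR n ^ S (S j) * exp (- (INR n * (s / 2)))))).
- apply Rmin_pos; lra.
- apply ex_series_Rscal, ex_series_pow_exp; lra.
- intros h H; apply csummable_pow_q; destruct (Hh h H).
  pose proof (re_le_Cmod h) as G; apply Rabs_le_between in G.
  change (Re (z + h)%C) with (Re z + Re h); fold s; lra.
- apply csummable_scal, csummable_pow_q, Hz.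
- intros n h H; destruct (Hh h H) as [H1 H2].
  pose proof (pos_INR n) as Hn.
  assert (E : forall u, (cexp (- u) ^ n = cexp ((- INR n) * u))%C).
    intros u; rewrite <- cexp_nat; f_equal; ring.
  rewrite !E.
  replace (_ - _)%C with ((INR n ^ j)%R * (cexp ((- INR n) * (z + h)) - cexp ((- INR n) * z)
     - h * ((- INR n) * cexp ((- INR n) * z))))%C.
  2:{ simpl pow; rewrite RtoC_mult; ring. }
  rewrite Cmod_mult, Cmod_R, Rabs_pos_eq by (apply pow_le; lra).
  eapply Rle_trans; [apply Rmult_le_compat_l; [apply pow_le; lra|apply cexp_lin_taylor; lra]|].
  rewrite Cmod_opp, Cmod_R, Rabs_pos_eq by lra.
  replace (Re (- INR n * z)%C) with (- (INR n * s)) by (unfold s, Re; simpl; ring).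
  replace (INR n ^ j * (2 * INR n ^ 2 * exp (INR n * Cmod h) * exp (- (INR n * s)) * Cmod h ^ 2))
    with (2 * (INR n ^ S (S j) * (exp (INR n * Cmod h) * exp (- (INR n * s)))) * Cmod h ^ 2)
    by (simpl; ring).
  apply Rmult_le_compat_r; [apply pow2_ge_0|]; apply Rmult_le_compat_l; [lra|].
  apply Rmult_le_compat_l; [apply pow_le; lra|].
  rewrite <- exp_plus; apply exp_le; nra.
Qed.

(** Lipschitz summation, by repeated differentiation of the equality of [hfun_series] and [lsum2]:
    the series gains a factor - n, the lattice sum the next factor of the factorial with the same
    sign. *)
Lemma lipschitz_formula (j : nat) (z : C) : 0 < Re z ->
  powsum (S j) z = (INR (Factorial.fact (S j)) * lsum (S (S j)) z)%C.
Proof.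
revert z; induction j as [|j IH]; intros z Hz.
  rewrite lsum2 by (apply cexp_neq_1_Re; lra).
  rewrite <- hfun_series by exact Hz; unfold powsum.
  rewrite (csum_incr_1 _ (csummable_pow_q 1 z Hz)).
  rewrite (csum_ext _ (fun n => INR (S n) * cexp (- z) ^ S n)%C) by (intros; rewrite pow_1; reflexivity).
  simpl; rewrite Rmult_0_l; ring.
assert (D1 := cderiv_powsum (S j) z Hz).
destruct (cexp_latb z) as [c0 Hl]; [apply cexp_neq_1_Re; lra|].
assert (D2 := cderiv_scal (INR (Factorial.fact (S j))) _ _ _ (cderiv_lsum c0 z (S j) Hl)).
assert (D3 : cderiv (powsum (S j)) z
  (INR (Factorial.fact (S j)) * (- INR (S (S j)) * lsum (S (S (S j))) z))%C).
  eapply cderiv_ext_loc; [exact Hz| |exact D2].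
  intros h Hh; symmetry; apply IH.
  pose proof (re_le_Cmod h) as G; apply Rabs_le_between in G.
  change (Re (z + h)%C) with (Re z + Re h); lra.
pose proof (cderiv_unique _ _ _ _ D1 D3) as E.
replace (powsum (S (S j)) z) with (- - powsum (S (S j)) z)%C by ring.
rewrite E; rewrite (fact_simpl (S j)), mult_INR, RtoC_mult; ring.
Qed.

(** In the strip, the nonzero lattice points are at distance at least PI (2 k + 1) >= 3 (k + 1). The
    4 is two points per k times the bound 2 for the sum of inverse squares. *)
Lemma lsum_minus_pole (j : nat) (z : C) : 0 < Re z -> Rabs (Im z) <= PI ->
  Cmod (lsum (S (S j)) z - (/ z) ^ S (S j))%C <= 4 * (/ 3) ^ S (S j).
Proof.
intros Hz Hi.
destruct (cexp_latb z) as [c0 Hl]; [apply cexp_neq_1_Re; lra|].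
destruct (lsum_sym c0 z j Hl) as [S1 E]; rewrite E.
replace ((/ z) ^ S (S j) + csum (sterm (S (S j)) z) - (/ z) ^ S (S j))%C
  with (csum (sterm (S (S j)) z)) by ring.
assert (B : forall k, 3 * (INR k + 1) <= Cmod (z + INR (S k) * I2)%C /\
  3 * (INR k + 1) <= Cmod (z - INR (S k) * I2)%C).
  intros k; pose proof (pos_INR k); pose proof PI_gt.
  assert (Ei : Im (INR (S k) * I2)%C = 2 * PI * (INR k + 1)).
    rewrite S_INR; unfold I2; csimp; ring.
  apply Rabs_le_between in Hi.
  split; (eapply Rle_trans; [|apply im_le_Cmod]).
  - change (Im (z + INR (S k) * I2)%C) with (Im z + Im (INR (S k) * I2)%C); rewrite Ei.
    rewrite Rabs_pos_eq; nra.
  - change (Im (z - INR (S k) * I2)%C) with (Im z + - Im (INR (S k) * I2)%C); rewrite Ei.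
    rewrite Rabs_left1; nra.
apply Rle_trans with (Series (fun k => 2 * (/ 3) ^ S (S j) * / (INR k + 1) ^ 2)).
- apply Cmod_csum_le; [|apply ex_series_Rscal, ex_series_inv_sq].
  intros k; destruct (B k) as [B1 B2]; unfold sterm.
  eapply Rle_trans; [apply Cmod_triangle|].
  pose proof (Cmod_invpow_le _ 3 j k ltac:(lra) B1); pose proof (Cmod_invpow_le _ 3 j k ltac:(lra) B2); lra.
- rewrite Series_scal_l; pose proof Series_inv_sq_le.
  assert (0 <= (/ 3) ^ S (S j)) by (apply pow_le; lra); nra.
Qed.

Definition fco (j : nat) : R := aco (S j) / INR (Factorial.fact j).

(* Termwise, [yfun - PI] is the Laplace transform of [ffun]. *)
Definition ffun (x : R) : R := Series (fun j => fco j * x ^ j).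

Lemma fco_pos (j : nat) : 0 < fco j.
Proof. apply Rdiv_lt_0_compat; [apply aco_pos|apply INR_fact_lt_0]. Qed.

Lemma ex_series_ffun (x : R) : 0 <= x -> ex_series (fun j => fco j * x ^ j).
Proof.
intros Hx; apply ex_series_dom with (fun j => aco (S j) * x ^ j).
- intros j; assert (0 <= x ^ j) by (apply pow_le, Hx); pose proof (fco_pos j).
  rewrite Rabs_pos_eq by (apply Rmult_le_pos; lra).
  apply Rmult_le_compat_r; [lra|]; unfold fco.
  apply Rmult_le_reg_r with (INR (Factorial.fact j)); [apply INR_fact_lt_0|].
  unfold Rdiv; rewrite Rmult_assoc, Rinv_l by apply INR_fact_neq_0.
  apply Rmult_le_compat_l; [left; apply aco_pos|].
  change 1 with (INR 1); apply le_INR, Factorial.lt_O_fact.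
- destruct (Req_dec x 0) as [->|H].
    apply ex_series_incr_1, ex_series_ext with (fun _ => 0); [|exists 0; apply is_series_zero].
    intros n; simpl; ring.
  apply ex_series_ext with (fun j => / x * (aco (S j) * x ^ S j)).
    intros j; match goal with |- ?a = ?b => change (@eq R a b) end; simpl pow; field; exact H.
  apply ex_series_Rscal, (ex_series_shift (fun j => aco j * x ^ j) 1), ex_series_aco, Hx.
Qed.

(** Each term of the convergent series at 1 / s is at most its sum, so aco (j + 1) is at most a
    constant times s^(j+1); the 1 / j! in [fco] then sums to an exponential of arbitrarily small
    rate s. *)
Lemma ffun_growth (s : R) : 0 < s -> exists B, 0 <= B /\
  forall n : nat, ffun (INR n) <= B * exp (INR n * s).
Proof.
intros Hs.
pose proof (ex_series_aco (/ s) ltac:(left; apply Rinv_0_lt_compat; lra)) as Sa.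
set (B := Series (fun i => aco i * (/ s) ^ i)) in *.
assert (P : forall i, 0 <= aco i * (/ s) ^ i).
  intros i; apply Rmult_le_pos; [left; apply aco_pos|apply pow_le; left; apply Rinv_0_lt_compat; lra].
assert (HB : forall j, aco (S j) * (/ s) ^ S j <= B).
  intros j; pose proof (rfsum_le_Series _ (S (S j)) P Sa) as H; simpl rfsum in H.
  pose proof (rfsum_mono _ 0 j P (Nat.le_0_l j)) as H1; pose proof (P j).
  fold B in H; simpl in H, H1; simpl; simpl in H0; lra.
assert (B0 : 0 <= B) by (eapply Rle_trans; [apply (P 1%nat)|apply HB]).
exists (B * s); split; [apply Rmult_le_pos; lra|].
intros n; pose proof (pos_INR n) as Hn.
rewrite <- (is_series_unique _ _ (is_series_exp (INR n * s))), <- Series_scal_l.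
apply Series_le; [|apply ex_series_Rscal; eexists; apply is_series_exp].
intros j; pose proof (fco_pos j); assert (0 <= INR n ^ j) by (apply pow_le; lra).
split; [apply Rmult_le_pos; lra|].
pose proof (INR_fact_lt_0 j) as Hf.
replace (fco j * INR n ^ j)
  with (aco (S j) * (/ s) ^ S j * (s * ((INR n * s) ^ j / INR (Factorial.fact j)))).
2:{ unfold fco; rewrite Rpow_mult_distr, pow_inv; simpl pow; field; split; [lra|split; [apply pow_nonzero|]; lra]. }
rewrite (Rmult_assoc B); apply Rmult_le_compat_r; [|apply HB].
apply Rmult_le_pos; [lra|]; apply Rmult_le_pos; [apply pow_le, Rmult_le_pos; lra|].
left; apply Rinv_0_lt_compat, Hf.
Qed.

Lemma ffun_nonneg (x : R) : 0 <= x -> 0 <= ffun x.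
Proof.
intros Hx; apply Series_nonneg; [|apply ex_series_ffun, Hx].
intros j; pose proof (fco_pos j); apply Rmult_le_pos; [lra|apply pow_le, Hx].
Qed.

Lemma ex_series_ffun_q (s : R) : 0 < s -> ex_series (fun n => ffun (INR n) * exp (- (INR n * s))).
Proof.
intros Hs; destruct (ffun_growth (s / 2) ltac:(lra)) as [B [HB H]].
apply ex_series_dom with (fun n => B * exp (- (s / 2)) ^ n).
- intros n; pose proof (ffun_nonneg (INR n) (pos_INR n)); pose proof (exp_pos (- (INR n * s))).
  rewrite Rabs_pos_eq by (apply Rmult_le_pos; lra).
  rewrite <- exp_nat.
  replace (exp (INR n * - (s / 2))) with (exp (INR n * (s / 2)) * exp (- (INR n * s))).
    specialize (H n); apply Rmult_le_compat_r with (r := exp (- (INR n * s))) in H; lra.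
  rewrite <- exp_plus; f_equal; field.
- apply ex_series_Rscal, ex_series_geom.
  rewrite Rabs_pos_eq by (left; apply exp_pos); rewrite <- exp_0; apply exp_increasing; lra.
Qed.

Definition Fterm (z : C) (n : nat) : C := (ffun (INR n) * cexp (- z) ^ n)%C.

Lemma Cmod_Fterm (z : C) (n : nat) : Cmod (Fterm z n) = ffun (INR n) * exp (- (INR n * Re z)).
Proof.
unfold Fterm; rewrite Cmod_mult, Cmod_cexp_neg, Cmod_R, Rabs_pos_eq; [reflexivity|].
apply ffun_nonneg, pos_INR.
Qed.

Lemma csummable_Fterm (z : C) : 0 < Re z -> csummable (Fterm z).
Proof.
intros Hz; eapply csummable_dom; [intros n; right; apply Cmod_Fterm|apply ex_series_ffun_q, Hz].
Qed.

Lemma RtoC_rfsum (u : nat -> R) (m : nat) : RtoC (rfsum u m) = cfsum (fun k => RtoC (u k)) m.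
Proof. induction m as [|m IH]; simpl; [|rewrite RtoC_plus, IH]; reflexivity. Qed.

Lemma F_powsum_lim (z : C) : 0 < Re z ->
  clim (cfsum (fun j => fco j * powsum j z)%C) (csum (Fterm z)).
Proof.
intros Hz.
assert (Hc : forall j, csummable (fun n => fco j * ((INR n ^ j)%R * cexp (- z) ^ n))%C).
  intros j; apply csummable_scal, csummable_pow_q, Hz.
apply clim_ext with (fun m => csum (fun n => cfsum (fun j => fco j * ((INR n ^ j)%R * cexp (- z) ^ n))%C m)).
  intros m; rewrite <- (proj2 (csum_cfsum_swap _ m Hc)); apply cfsum_ext; intros j _.
  unfold powsum; rewrite csum_scal by apply (csummable_pow_q j z Hz); reflexivity.
assert (E : forall n m, cfsum (fun j => fco j * ((INR n ^ j)%R * cexp (- z) ^ n))%C m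
  = (rfsum (fun j => fco j * INR n ^ j)%R m * cexp (- z) ^ n)%C).
  intros n m; rewrite RtoC_rfsum, Cmult_comm, <- cfsum_scal; apply cfsum_ext; intros j _.
  rewrite RtoC_mult; ring.
assert (P : forall n j, 0 <= fco j * INR n ^ j).
  intros n j; pose proof (fco_pos j); apply Rmult_le_pos; [lra|apply pow_le, pos_INR].
apply tannery with (fun n => ffun (INR n) * exp (- (INR n * Re z))).
- apply ex_series_ffun_q, Hz.
- intros m n; rewrite E, Cmod_mult, Cmod_cexp_neg, Cmod_R, Rabs_pos_eq.
    apply Rmult_le_compat_r; [left; apply exp_pos|].
    apply rfsum_le_Series; [apply P|apply ex_series_ffun, pos_INR].
  apply (rfsum_mono _ 0 m (P n)); lia.
- intros n; unfold Fterm.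
  apply clim_ext with (fun m => cexp (- z) ^ n * rfsum (fun j => fco j * INR n ^ j)%R m)%C.
    intros m; rewrite E; ring.
  rewrite Cmult_comm; apply clim_scal.
  pose proof (rfsum_lim _ (ex_series_ffun (INR n) (pos_INR n))) as L.
  unfold clim.
  apply is_lim_seq_ext with (fun m => Rabs (rfsum (fun j => fco j * INR n ^ j) m - ffun (INR n))).
    intros m; rewrite <- RtoC_minus, Cmod_R; reflexivity.
  replace (Finite 0) with (Rbar_abs (Finite (ffun (INR n) - ffun (INR n)))).
    apply is_lim_seq_abs, is_lim_seq_minus'; [|apply is_lim_seq_const].
    apply rfsum_lim, ex_series_ffun, pos_INR.
  simpl; f_equal; rewrite Rminus_diag, Rabs_R0; reflexivity.
Qed.

Lemma one_minus_exp_ge (s : R) : 0 < s -> / (1 - exp (- s)) <= 1 + / s.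
Proof.
intros Hs; pose proof (exp_ineq1_le s) as H.
assert (E : exp s * exp (- s) = 1).
  rewrite <- exp_plus; replace (s + - s) with 0 by ring; apply exp_0.
pose proof (exp_pos (- s)).
assert (H1 : s / (1 + s) <= 1 - exp (- s)).
  apply Rmult_le_reg_r with (1 + s); [lra|].
  replace (s / (1 + s) * (1 + s)) with s by (field; lra); nra.
replace (1 + / s) with (/ (s / (1 + s))) by (field; lra).
apply Rinv_le_contravar; [apply Rdiv_lt_0_compat; lra|exact H1].
Qed.

(** By [lipschitz_formula] the j-th term of F is a lattice sum of which [yfun] keeps the pole at 0
    only; the other points contribute at most a multiple of the aco series at 1/3. The term j = 0, a
    plain geometric series, is estimated directly and is the source of 11 / Re z. *)
Lemma F_minus_y (z : C) : 0 < Re z -> Rabs (Im z) <= PI ->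
  Cmod (csum (Fterm z) - yfun z)%C <= 48 + 11 / Re z.
Proof.
intros Hz Hi; pose proof PI_RGT_0; pose proof PI_lt.
set (s := Re z) in *.
assert (Hs : s <= Cmod z) by (eapply Rle_trans; [apply Rle_abs|apply re_le_Cmod]).
assert (Is : 0 < / s) by (apply Rinv_0_lt_compat; lra).
set (e := fun j => 4 * (aco (S j) * (/ 3) ^ S j) + match j with O => aco 1 * (1 + 2 * / s) | _ => 0 end).
assert (He : forall j, Cmod (fco j * powsum j z - aco (S j) * (/ z) ^ S j)%C <= e j).
  intros j; unfold e, fco; pose proof (aco_pos (S j)) as Ha.
  assert (0 < (/ 3) ^ S j) by (apply pow_lt; lra).
  destruct j as [|j].
    assert (E0 : powsum 0 z = (/ (1 - cexp (- z)))%C).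
      unfold powsum; rewrite <- csum_geom by apply Cmod_q_lt_1, Hz.
      apply csum_ext; intros n; simpl; ring.
    rewrite E0; change (INR (Factorial.fact 0)) with 1.
    replace ((aco 1 / 1)%R * / (1 - cexp (- z)) - aco 1 * (/ z) ^ 1)%C
      with (aco 1 * (/ (1 - cexp (- z)) + - / z))%C.
    2:{ rewrite Rdiv_1_r, Cpow_1_r; ring. }
    rewrite Cmod_mult, Cmod_R, Rabs_pos_eq by lra.
    assert (Cmod (/ (1 - cexp (- z)) + - / z)%C <= 1 + 2 * / s).
      eapply Rle_trans; [apply Cmod_triangle|]; rewrite Cmod_opp.
      assert (Hr : exp (- s) < 1) by (rewrite <- exp_0; apply exp_increasing; lra).
      assert (Cmod (/ (1 - cexp (- z)))%C <= / (1 - exp (- s))).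
        apply Cmod_inv_le; [lra|].
        eapply Rle_trans; [|apply Cmod_one_minus_ge]; right; rewrite Cmod_cexp; reflexivity.
      assert (Cmod (/ z)%C <= / s) by (apply Cmod_inv_le; lra).
      pose proof (one_minus_exp_ge s Hz); lra.
    assert (aco 1 * Cmod (/ (1 - cexp (- z)) + - / z)%C <= aco 1 * (1 + 2 * / s)) by (apply Rmult_le_compat_l; lra).
    nra.
  rewrite Rplus_0_r, lipschitz_formula by exact Hz.
  pose proof (INR_fact_neq_0 (S j)) as Nf.
  replace ((aco (S (S j)) / INR (Factorial.fact (S j)))%R * (INR (Factorial.fact (S j)) * lsum (S (S j)) z)
     - aco (S (S j)) * (/ z) ^ S (S j))%C
    with (aco (S (S j)) * (lsum (S (S j)) z - (/ z) ^ S (S j)))%C.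
  2:{ rewrite RtoC_div by exact Nf; field; repeat split; try (apply z_neq_0, Hz); apply RtoC_neq_0, Nf. }
  rewrite Cmod_mult, Cmod_R, Rabs_pos_eq by lra.
  pose proof (lsum_minus_pole j z Hz Hi).
  replace (4 * (aco (S (S j)) * (/ 3) ^ S (S j))) with (aco (S (S j)) * (4 * (/ 3) ^ S (S j))) by ring.
  apply Rmult_le_compat_l; lra.
assert (Sa : ex_series (fun i => aco i * (/ 3) ^ i)) by (apply ex_series_aco; lra).
assert (Pa : forall i, 0 <= aco i * (/ 3) ^ i).
  intros i; apply Rmult_le_pos; [left; apply aco_pos|apply pow_le; lra].
assert (A3 : Series (fun i => aco i * (/ 3) ^ i) <= PI * 3).
  eapply Rle_trans; [apply Series_aco_le; lra|].
  apply Rmult_le_compat_l; [lra|].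
  eapply Rle_trans; [apply exp_le|apply exp_le_3]; nra.
assert (A1 : aco 1 <= 11 / 2).
  simpl; assert (PI * (PI ^ 2) <= 33); [simpl; nra|]; lra.
assert (Hj : forall m, rfsum e m <= 4 * (PI * 3) + 11 / 2 * (1 + 2 * / s) - PI).
  intros m; apply Rle_trans with (rfsum e (S m)).
    apply rfsum_mono; [|lia]; intros k; eapply Rle_trans; [apply Cmod_ge_0|apply He].
  assert (E : rfsum e (S m) = 4 * rfsum (fun i => aco (S i) * (/ 3) ^ S i) (S m) + aco 1 * (1 + 2 * / s)).
    clear; induction m as [|m IH]; [unfold e; cbn [rfsum]; ring|].
    change (rfsum e (S (S m))) with (rfsum e (S m) + e (S m)); rewrite IH; unfold e; cbn [rfsum]; ring.
  pose proof (rfsum_le_Series _ (1 + S m) Pa Sa) as B; rewrite rfsum_split in B.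
  change (rfsum (fun i => aco i * (/ 3) ^ i) 1) with (0 + PI * 1) in B.
  change (fun k => aco (1 + k) * (/ 3) ^ (1 + k)) with (fun i => aco (S i) * (/ 3) ^ S i) in B.
  rewrite E; pose proof (aco_pos 1); nra.
apply Cmod_clim_le with (fun m => cfsum (fun j => fco j * powsum j z)%C m - cfsum (fun i => aco i * (/ z) ^ i)%C (m + 1))%C.
- intros m; rewrite Nat.add_1_r, cfsum_split_l.
  replace (cfsum (fun j => fco j * powsum j z)%C m - (aco 0 * (/ z) ^ 0 + cfsum (fun k => aco (S k) * (/ z) ^ S k)%C m))%C
    with (cfsum (fun j => fco j * powsum j z - aco (S j) * (/ z) ^ S j)%C m + - PI)%C.
  2:{ unfold Cminus; rewrite cfsum_plus.
      rewrite (cfsum_ext (fun k => - (aco (S k) * (/ z) ^ S k))%C (fun k => - (1) * (aco (S k) * (/ z) ^ S k))%C) by (intros; ring).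
      rewrite cfsum_scal; simpl; ring. }
  eapply Rle_trans; [apply Cmod_triangle|].
  rewrite Cmod_opp, Cmod_R, (Rabs_pos_eq PI) by lra.
  pose proof (Cmod_cfsum (fun j => fco j * powsum j z - aco (S j) * (/ z) ^ S j)%C m) as B1.
  pose proof (rfsum_le _ e m (fun k _ => He k)) as B2; specialize (Hj m).
  replace (11 / s) with (11 * / s) by reflexivity; lra.
- apply clim_minus; [apply F_powsum_lim, Hz|].
  apply (clim_incr (cfsum (fun i => aco i * (/ z) ^ i)%C)), cfsum_lim, csummable_yfun.
Qed.

Lemma cderiv_is_derive (f : C -> C) (s t : R) (d : C) : cderiv f (s + t * Ci)%C d ->
  is_derive (fun u : R => Re (f (s + u * Ci)%C)) t (Re (Ci * d)%C) /\
  is_derive (fun u : R => Im (f (s + u * Ci)%C)) t (Im (Ci * d)%C).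
Proof.
intros [delta [K [Hd [HK H]]]].
assert (W : forall p : C -> R, (forall a b, p (a - b)%C = p a - p b) ->
  (forall (x : R) a, p (x * a)%C = x * p a) -> (forall a, Rabs (p a) <= Cmod a) ->
  is_derive (fun u : R => p (f (s + u * Ci)%C)) t (p (Ci * d)%C)).
  intros p Hp1 Hp2 Hp3; apply is_derive_Reals; intros eps He.
  assert (Hm : 0 < Rmin delta (eps / (K + 1))).
    apply Rmin_pos; [lra|apply Rdiv_lt_0_compat; lra].
  exists (mkposreal _ Hm); intros h Hh0 Hh; simpl in Hh.
  pose proof (Rmin_l delta (eps / (K + 1))); pose proof (Rmin_r delta (eps / (K + 1))).
  pose proof (Rabs_pos_lt h Hh0) as Ph.
  assert (Mh : Cmod (h * Ci)%C = Rabs h) by (rewrite Cmod_mult, Cmod_Ci, Cmod_R; ring).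
  specialize (H (h * Ci)%C); rewrite Mh in H.
  replace (s + t * Ci + h * Ci)%C with (s + (t + h)%R * Ci)%C in H by (rewrite RtoC_plus; ring).
  replace (h * Ci * d)%C with (h * (Ci * d))%C in H by ring.
  assert (Hq : Rabs h < eps / (K + 1)) by lra.
  apply Rmult_lt_compat_r with (r := K + 1) in Hq; [|lra].
  replace (eps / (K + 1) * (K + 1)) with eps in Hq by (field; lra).
  assert (Hf : Rabs (p (f (s + (t + h)%R * Ci)%C) - p (f (s + t * Ci)%C) - h * p (Ci * d)%C) <= K * Rabs h ^ 2).
    rewrite <- Hp2, <- !Hp1; eapply Rle_trans; [apply Hp3|]; apply H; lra.
  replace ((p (f (s + (t + h)%R * Ci)%C) - p (f (s + t * Ci)%C)) / h - p (Ci * d)%C)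
    with ((p (f (s + (t + h)%R * Ci)%C) - p (f (s + t * Ci)%C) - h * p (Ci * d)%C) / h) by (field; exact Hh0).
  unfold Rdiv; rewrite Rabs_mult, Rabs_inv.
  apply Rmult_lt_reg_r with (Rabs h); [exact Ph|].
  rewrite Rmult_assoc, Rinv_l, Rmult_1_r by lra.
  eapply Rle_lt_trans; [exact Hf|]; nra.
split; apply W.
- intros; unfold Re; simpl; ring.
- intros; unfold Re; simpl; ring.
- apply re_le_Cmod.
- intros; unfold Im; simpl; ring.
- intros; unfold Im; simpl; ring.
- apply im_le_Cmod.
Qed.

(** The constant c keeps the norm differentiable where u and v vanish together; [gronwall] takes it
    to be eps^2. *)
Lemma is_derive_norm (u v : R -> R) (x du dv c : R) : is_derive u x du -> is_derive v x dv ->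
  0 < u x ^ 2 + v x ^ 2 + c ->
  is_derive (fun t => sqrt (u t ^ 2 + v t ^ 2 + c)) x
    ((u x * du + v x * dv) / sqrt (u x ^ 2 + v x ^ 2 + c)).
Proof.
intros Du Dv P.
assert (Hs : is_derive (fun t => u t ^ 2 + v t ^ 2 + c) x (2 * (u x * du + v x * dv))).
  auto_derive; [repeat split; eexists; eassumption|].
  replace (Derive (fun t => u t) x) with du by (symmetry; apply is_derive_unique, Du).
  replace (Derive (fun t => v t) x) with dv by (symmetry; apply is_derive_unique, Dv).
  ring.
replace ((u x * du + v x * dv) / sqrt (u x ^ 2 + v x ^ 2 + c))
  with (scal (2 * (u x * du + v x * dv)) (/ (2 * sqrt (u x ^ 2 + v x ^ 2 + c)))).
  apply (is_derive_comp sqrt (fun t => u t ^ 2 + v t ^ 2 + c)); [|exact Hs].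
  apply is_derive_Reals, derivable_pt_lim_sqrt, P.
pose proof (sqrt_lt_R0 _ P); unfold scal; simpl; unfold mult; simpl; simpl in H; field; lra.
Qed.

(** * The major arc *)

(** The derivative of |D| along the line is the real part of conj D times i (al D + er), over |D|.
    The hypothesis on i al makes the first contribution nonpositive, so |D| grows at rate at most E,
    without an exponential factor. Zeros of D are handled by sqrt (|D|^2 + eps^2), with eps
    arbitrary. *)
Lemma gronwall (D al er : C -> C) (s T E : R) : 0 <= T -> D s = 0%C ->
  (forall t : R, 0 <= t <= T -> let z := (s + t * Ci)%C in
     cderiv D z (al z * D z + er z)%C /\ Re (Ci * al z)%C <= 0 /\ Cmod (er z) <= E) ->
  forall t : R, 0 <= t <= T -> Cmod (D (s + t * Ci)%C) <= E * t.
Proof.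
intros HT H0 H t Ht.
apply le_epsilon; intros eps He.
set (u := fun t : R => Re (D (s + t * Ci)%C)); set (v := fun t : R => Im (D (s + t * Ci)%C)).
set (g := fun t => sqrt (u t ^ 2 + v t ^ 2 + eps ^ 2)).
assert (Hg : E * 0 - g 0 <= E * t - g t).
  set (z := fun t : R => (s + t * Ci)%C).
  set (d := fun t : R => (Ci * (al (z t) * D (z t) + er (z t)))%C).
  apply (le_of_deriv (fun t => E * t - g t)
    (fun t => E - (u t * Re (d t) + v t * Im (d t)) / g t)); [lra| |].
  - intros x Hx; assert (Hx' : 0 <= x <= T) by lra.
    destruct (H x Hx') as [Hd _]; destruct (cderiv_is_derive _ _ _ _ Hd) as [Du Dv].
    fold (z x) in Du, Dv; change (Ci * (al (z x) * D (z x) + er (z x)))%C with (d x) in Du, Dv.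
    fold u in Du; fold v in Dv.
    assert (Pg : 0 < u x ^ 2 + v x ^ 2 + eps ^ 2).
      pose proof (pow2_ge_0 (u x)); pose proof (pow2_ge_0 (v x)); nra.
    apply (is_derive_minus (fun t => E * t) g x E).
      auto_derive; [easy|ring].
    apply is_derive_norm; assumption.
  - intros x Hx; assert (Hx' : 0 <= x <= T) by lra.
    destruct (H x Hx') as [_ [Ha Hb]]; fold (z x) in Ha, Hb.
    assert (Eg : g x ^ 2 = u x ^ 2 + v x ^ 2 + eps ^ 2).
      unfold g; rewrite pow2_sqrt; [reflexivity|].
      pose proof (pow2_ge_0 (u x)); pose proof (pow2_ge_0 (v x)); pose proof (pow2_ge_0 eps); lra.
    assert (Pg : 0 < g x).
      apply sqrt_lt_R0; pose proof (pow2_ge_0 (u x)); pose proof (pow2_ge_0 (v x)); nra.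
    assert (Em : Cmod (D (z x)) ^ 2 = u x ^ 2 + v x ^ 2) by apply Cmod2_alt.
    assert (Mg : Cmod (D (z x)) <= g x).
      pose proof (Cmod_ge_0 (D (z x))); pose proof (pow2_ge_0 eps); nra.
    assert (Hn : u x * Re (d x) + v x * Im (d x) <= g x * E).
      replace (u x * Re (d x) + v x * Im (d x)) with
        (Re (Ci * al (z x))%C * Cmod (D (z x)) ^ 2 + Re (Cconj (D (z x)) * (Ci * er (z x)))%C).
      2:{ rewrite Em; unfold d, u, v; fold (z x); csimp; ring. }
      pose proof (re_le_Cmod (Cconj (D (z x)) * (Ci * er (z x)))%C) as Hr.
      rewrite !Cmod_mult, Cmod_conj, Cmod_Ci in Hr.
      pose proof (Rle_abs (Re (Cconj (D (z x)) * (Ci * er (z x)))%C)).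
      pose proof (pow2_ge_0 (Cmod (D (z x)))); pose proof (Cmod_ge_0 (er (z x))).
      pose proof (Cmod_ge_0 (D (z x))).
      assert (Cmod (D (z x)) * (1 * Cmod (er (z x))) <= g x * E) by (apply Rmult_le_compat; lra).
      nra.
    apply Rmult_le_reg_r with (g x); [exact Pg|].
    rewrite Rmult_0_l, Rmult_minus_distr_r.
    unfold Rdiv; rewrite Rmult_assoc, Rinv_l, Rmult_1_r by lra; lra.
assert (G0 : g 0 = eps).
  unfold g, u, v; replace (s + 0 * Ci)%C with (RtoC s) by ring; rewrite H0; simpl.
  replace (0 * (0 * 1) + 0 * (0 * 1) + eps * (eps * 1)) with (eps ^ 2) by ring.
  apply sqrt_pow2; lra.
assert (Mt : Cmod (D (s + t * Ci)%C) <= g t).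
  unfold Cmod, g, u, v, Re, Im; apply sqrt_le_1_alt; pose proof (pow2_ge_0 eps); lra.
lra.
Qed.

Lemma Re_inv (z : C) : z <> 0%C -> Re (/ z)%C = Re z / Cmod z ^ 2.
Proof.
intros Nz; assert (Pz : 0 < Cmod z) by (apply Cmod_gt_0, Nz).
assert (Q : 0 < Cmod z ^ 2) by (apply pow_lt, Pz).
rewrite Cmod2_alt in *; destruct z as [x y]; unfold Re, Im in *; simpl in *; field; lra.
Qed.

Lemma Cmod_qdual (z : C) (k : nat) : z <> 0%C ->
  Cmod (qdual z k) = exp (- (2 * PI ^ 2 * (Re z / Cmod z ^ 2))) ^ k.
Proof.
intros Nz; unfold qdual; rewrite Cmod_cexp, <- exp_nat; f_equal.
rewrite <- Re_inv by exact Nz.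
replace (- (2 * PI ^ 2 * INR k / z))%C with ((- (2 * PI ^ 2 * INR k))%R * / z)%C.
  rewrite Re_scal; ring.
rewrite RtoC_opp, !RtoC_mult, RtoC_pow; field; exact Nz.
Qed.

(** For a dual nome of modulus at most 1/10, the denominators cost 100/81 and the geometric series
    10/9, together less than 2. *)
Lemma edual_sum_bound (z : C) (rho : R) : z <> 0%C ->
  exp (- (2 * PI ^ 2 * (Re z / Cmod z ^ 2))) <= rho -> rho <= / 10 ->
  Cmod (csum (fun k => edual z (S k))) <= 2 * PI ^ 2 / Cmod z ^ 2 * rho.
Proof.
intros Nz H1 H2; assert (Pz : 0 < Cmod z) by (apply Cmod_gt_0, Nz).
set (r := exp (- (2 * PI ^ 2 * (Re z / Cmod z ^ 2)))) in *.
assert (Hr : 0 < r) by apply exp_pos.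
assert (Hgeo : ex_series (fun k => r ^ k)) by (apply ex_series_geom; rewrite Rabs_pos_eq; lra).
assert (Q : 0 < PI ^ 2 / Cmod z ^ 2).
  apply Rdiv_lt_0_compat; apply pow_lt; [apply PI_RGT_0|exact Pz].
assert (B : forall k, Cmod (edual z (S k)) <= PI ^ 2 / Cmod z ^ 2 * (100 / 81 * r) * r ^ k).
  intros k; unfold edual; set (w := qdual z (S k)).
  assert (Ew : Cmod w = r * r ^ k) by (unfold w; rewrite Cmod_qdual by exact Nz; reflexivity).
  assert (Hk : 0 < r ^ k <= 1).
    split; [apply pow_lt, Hr|rewrite <- (pow1 k); apply pow_incr; lra].
  assert (G : 9 / 10 <= Cmod (1 + w)%C).
    pose proof (Cmod_gap 1 w) as G; rewrite Cmod_1, Ew in G; nra.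
  assert (N : (1 + w)%C <> 0%C) by (apply Cmod_gt_0; lra).
  rewrite Cmod_mult, Cmod_pow, Cmod_div by exact Nz.
  rewrite Cmod_R, Rabs_pos_eq by (left; apply PI_RGT_0).
  rewrite Cmod_div by (apply Cmult_neq_0; exact N); rewrite Cmod_mult, Ew.
  replace (PI ^ 2 / Cmod z ^ 2 * (100 / 81 * r) * r ^ k)
    with ((PI / Cmod z) ^ 2 * (r * r ^ k / (9 / 10 * (9 / 10)))) by (field; lra).
  apply Rmult_le_compat_l; [apply pow2_ge_0|].
  apply Rmult_le_compat_l; [nra|].
  apply Rinv_le_contravar; [lra|apply Rmult_le_compat; lra].
eapply Rle_trans; [apply Cmod_csum_le; [exact B|apply ex_series_Rscal, Hgeo]|].
rewrite Series_scal_l, Series_geom by (rewrite Rabs_pos_eq; lra).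
assert (I : / (1 - r) <= 10 / 9).
  replace (10 / 9) with (/ (9 / 10)) by field; apply Rinv_le_contravar; lra.
replace (2 * PI ^ 2 / Cmod z ^ 2 * rho) with (PI ^ 2 / Cmod z ^ 2 * (2 * rho)) by (field; lra).
rewrite Rmult_assoc; apply Rmult_le_compat_l; [lra|].
assert (0 < / (1 - r)) by (apply Rinv_0_lt_compat; lra); nra.
Qed.

Definition yR (s : R) : R := Series (fun i => aco i * (/ s) ^ i).

Lemma yfun_yR (s : R) : 0 < s -> yfun s = yR s.
Proof.
intros Hs; unfold yfun, yR; rewrite (csum_ext _ (fun i => RtoC (aco i * (/ s) ^ i))).
  apply C_eq; unfold csum; simpl; [reflexivity|apply Series_zero].
intros i; rewrite RtoC_mult, RtoC_pow, RtoC_inv by lra; reflexivity.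
Qed.

Lemma yR_pos (s : R) : 0 < s -> 0 < yR s.
Proof.
intros Hs; assert (0 < / s) by (apply Rinv_0_lt_compat; lra).
assert (P : forall i, 0 <= aco i * (/ s) ^ i).
  intros i; apply Rmult_le_pos; [left; apply aco_pos|apply pow_le; lra].
pose proof (rfsum_le_Series _ 1 P (ex_series_aco (/ s) ltac:(lra))) as H1.
unfold yR; simpl in H1; pose proof PI_RGT_0; lra.
Qed.

Definition ttail (K : nat) (s : R) : R :=
  Series (fun i => 2 * INR (S (K + i)) * exp (- (INR (S (K + i)) * s)) / (1 - exp (- s))).

Lemma ttail_lim (s : R) : 0 < s -> is_lim_seq (fun K => ttail K s) 0.
Proof.
intros Hs; apply (Series_tail_lim (fun i => 2 * INR (S i) * exp (- (INR (S i) * s)) / (1 - exp (- s)))).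
apply ex_series_tbound, Hs.
Qed.

Lemma tterm_tail (z : C) (K : nat) : 0 < Re z ->
  Cmod (csum (tterm z) - cfsum (tterm z) K)%C <= ttail K (Re z).
Proof.
intros Hz; rewrite (csum_cfsum _ K (csummable_tterm z Hz)).
match goal with |- Cmod ?u <= _ => replace u with (csum (fun k => tterm z (K + k)%nat)) by ring end.
apply Cmod_csum_le; [intros k; apply tterm_bound, Hz|].
apply (ex_series_shift (fun i => 2 * INR (S i) * exp (- (INR (S i) * Re z)) / (1 - exp (- Re z)))).
apply ex_series_tbound, Hz.
Qed.

Lemma vertical_mod (s t : R) :
  Re (s + t * Ci)%C = s /\ Im (s + t * Ci)%C = t /\ Cmod (s + t * Ci)%C ^ 2 = s ^ 2 + t ^ 2.
Proof.
assert (E1 : Re (s + t * Ci)%C = s) by (csimp; ring).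
assert (E2 : Im (s + t * Ci)%C = t) by (csimp; ring).
rewrite Cmod2_alt, E1, E2; auto.
Qed.

(** The ratio la makes D = gf K - la yfun vanish at the real point s. The two logarithmic equations
    share the coefficient [al], so D' = al D + er, where [er] collects the truncation of the
    product, the dual series and the source PI / (2 z) of [cderiv_yfun]. *)
Lemma major_arc (K : nat) (s rho : R) : 0 < s -> s <= 1 ->
  exp (- (50 / 169 * PI ^ 2 / s)) <= rho -> rho <= / 10 ->
  let G := gfR K (exp (- s)) in
  let la := G / yR s in
  forall t, 0 <= t <= 12 / 5 * s ->
  Cmod (gf K (cexp (- (s + t * Ci))) - la * yfun (s + t * Ci))%C
  <= ((ttail K s + 4 * PI ^ 2 / s ^ 2 * rho) * G + la * (PI / (2 * s))) * t.
Proof.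
intros Hs Hs1 Hrho Hrho2 G la t Ht.
pose proof PI_RGT_0 as HPI; pose proof PI_gt as HPI2.
pose proof (yR_pos s Hs) as Py.
assert (Hq : 0 < exp (- s) < 1).
  split; [apply exp_pos|rewrite <- exp_0; apply exp_increasing; lra].
assert (PG : 0 < G) by (apply gfR_pos, Hq).
assert (Pla : 0 < la) by (apply Rdiv_lt_0_compat; assumption).
set (al := fun z : C => (/ (2 * z) - PI ^ 2 / (4 * z ^ 2))%C).
set (er := fun z : C => ((csum (tterm z) - cfsum (tterm z) K - 2 * csum (fun k => edual z (S k)))
   * gf K (cexp (- z)) + la * (PI / (2 * z)))%C).
apply (gronwall (fun z => gf K (cexp (- z)) - la * yfun z)%C al er s (12 / 5 * s)); [lra| | |exact Ht].
- rewrite yfun_yR by exact Hs.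
  replace (cexp (- s)) with (RtoC (exp (- s))).
    rewrite gf_gfR by exact Hq; fold G; rewrite <- RtoC_mult, <- RtoC_minus.
    f_equal; unfold la; field; lra.
  apply C_eq; csimp; rewrite Ropp_0, ?cos_0, ?sin_0; ring.
- intros x Hx z; destruct (vertical_mod s x) as [Er [Ei Em]]; fold z in Er, Ei, Em.
  assert (Hz : 0 < Re z) by lra.
  pose proof (z_neq_0 z Hz) as Nz.
  assert (Pz : 0 < Cmod z) by (apply Cmod_gt_0, Nz).
  assert (Mz : s ^ 2 <= Cmod z ^ 2 <= 169 / 25 * s ^ 2) by (rewrite Em; nra).
  assert (Ps2 : 0 < s ^ 2) by (apply pow_lt, Hs).
  assert (Ms : s <= Cmod z) by (rewrite <- Er; eapply Rle_trans; [apply Rle_abs|apply re_le_Cmod]).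
  split; [|split].
  + pose proof (cderiv_gf K z Hz) as D1.
    pose proof (cderiv_scal (- la)%C _ _ _ (cderiv_yfun z Nz)) as D2.
    apply cderiv_ext with (fun u => gf K (cexp (- u)) + (- la) * yfun u)%C; [intros; ring|].
    match goal with |- cderiv _ _ ?g => replace g with
      (- cfsum (tterm z) K * gf K (cexp (- z))
       + - la * ((/ (2 * z) - PI ^ 2 / (4 * z ^ 2)) * yfun z - PI / (2 * z)))%C end.
      apply cderiv_plus; assumption.
    unfold er, al; rewrite (tterm_sum z Hz); ring.
  + assert (E : Re (Ci * al z)%C = x / (2 * (s ^ 2 + x ^ 2) ^ 2) * (s ^ 2 + x ^ 2 - PI ^ 2 * s)).
      assert (Ei2 : (/ z)%C = (s / (s ^ 2 + x ^ 2), - x / (s ^ 2 + x ^ 2))).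
        unfold z; apply C_eq; csimp; field; nra.
      assert (Eal : al z = ((/ 2)%R * / z - (PI ^ 2 / 4)%R * (/ z * / z))%C).
        unfold al; rewrite RtoC_inv, RtoC_div, RtoC_pow by lra; field; exact Nz.
      rewrite Eal, Ei2; csimp; field; nra.
    rewrite E.
    assert (0 <= x / (2 * (s ^ 2 + x ^ 2) ^ 2)).
      apply Rmult_le_pos; [lra|left; apply Rinv_0_lt_compat].
      assert (0 < (s ^ 2 + x ^ 2) ^ 2) by (apply pow_lt; nra); lra.
    (* The sign required by [gronwall]: |z|^2 <= 169/25 s^2 <= 9 s <= PI^2 s, as s <= 1. *)
    assert (s ^ 2 + x ^ 2 - PI ^ 2 * s <= 0).
      assert (9 <= PI ^ 2) by nra; assert (s ^ 2 <= s) by nra.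
      assert (9 * s <= PI ^ 2 * s) by (apply Rmult_le_compat_r; lra); lra.
    nra.
  + unfold er; eapply Rle_trans; [apply Cmod_triangle|].
    apply Rplus_le_compat.
    * rewrite Cmod_mult; apply Rmult_le_compat; try apply Cmod_ge_0.
      2:{ assert (Eq : Cmod (cexp (- z)) = exp (- s)).
            rewrite Cmod_cexp; f_equal; rewrite <- Er; unfold Re; simpl; ring.
          unfold G; rewrite <- Eq; apply Cmod_gf_le; rewrite Eq; exact Hq. }
      eapply Rle_trans; [apply Cmod_triangle|]; rewrite Cmod_opp, Cmod_mult, Cmod_R, Rabs_pos_eq by lra.
      pose proof (tterm_tail z K Hz) as T1; rewrite Er in T1.
      assert (T2 : Cmod (csum (fun k => edual z (S k))) <= 2 * PI ^ 2 / Cmod z ^ 2 * rho).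
        apply edual_sum_bound; [exact Nz| |exact Hrho2].
        eapply Rle_trans; [apply exp_le|exact Hrho].
        rewrite Er; apply Ropp_le_contravar.
        (* Re (1 / z) = s / |z|^2 is smallest at the end of the arc, where the triangle 5, 12, 13
           gives |z| = 13/5 s; hence 50/169 = 2 * 25/169. *)
        replace (50 / 169 * PI ^ 2 / s) with (2 * PI ^ 2 * (s / (169 / 25 * s ^ 2))) by (field; lra).
        apply Rmult_le_compat_l; [nra|]; apply Rmult_le_compat_l; [lra|].
        apply Rinv_le_contravar; lra.
      assert (T3 : 2 * PI ^ 2 / Cmod z ^ 2 * rho <= 2 * PI ^ 2 / s ^ 2 * rho).
        apply Rmult_le_compat_r; [eapply Rle_trans; [left; apply exp_pos|exact Hrho]|].
        apply Rmult_le_compat_l; [nra|apply Rinv_le_contravar; nra].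
      replace (4 * PI ^ 2 / s ^ 2 * rho) with (2 * (2 * PI ^ 2 / s ^ 2 * rho)) by (field; lra).
      lra.
    * rewrite Cmod_mult, Cmod_R, Rabs_pos_eq by lra.
      apply Rmult_le_compat_l; [lra|].
      rewrite Cmod_div by (apply Cmult_neq_0; [apply C2_neq_0|exact Nz]).
      rewrite Cmod_mult, !Cmod_R, !Rabs_pos_eq by lra.
      apply Rmult_le_compat_l; [lra|apply Rinv_le_contravar; lra].
Qed.

(** * Coefficients and the minor arc *)

Lemma csum_conj (a : nat -> C) : csum (fun n => Cconj (a n)) = Cconj (csum a).
Proof.
apply C_eq; unfold csum, Cconj; simpl; [reflexivity|].
apply (Series_opp (fun n => Im (a n))).
Qed.

Lemma Cconj_cexp (z : C) : Cconj (cexp z) = cexp (Cconj z).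
Proof. apply C_eq; unfold Cconj; csimp; rewrite ?cos_neg, ?sin_neg; ring. Qed.

Lemma cexp_root_neq_1 (y : R) : 0 < Rabs y < 2 * PI -> cexp (y * Ci)%C <> 1%C.
Proof.
intros Hy E.
pose proof (Cmod_cexp_m1_sqr (y * Ci)%C) as H; rewrite E in H.
replace (1 - 1)%C with (RtoC 0) in H by ring; rewrite Cmod_0 in H.
replace (Re (y * Ci)%C) with 0 in H by (csimp; ring).
replace (Im (y * Ci)%C) with y in H by (csimp; ring).
rewrite exp_0 in H.
assert (Hs : sin (y / 2) = 0) by nra.
destruct (Rle_or_lt 0 y) as [H0|H0].
- rewrite Rabs_pos_eq in Hy by lra; pose proof (sin_gt_0 (y / 2)); lra.
- rewrite Rabs_left in Hy by lra; pose proof (sin_gt_0 (- (y / 2))) as G; rewrite sin_neg in G; lra.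
Qed.

Lemma cfsum_geom (x : C) (m : nat) : ((1 - x) * cfsum (fun k => x ^ k) m = 1 - x ^ m)%C.
Proof. induction m as [|m IH]; simpl; [ring|rewrite Cmult_plus_distr_l, IH; simpl; ring]. Qed.

Lemma cfsum_const (c : C) (m : nat) : cfsum (fun _ => c) m = (INR m * c)%C.
Proof. induction m as [|m IH]; [simpl; ring|]. rewrite S_INR, RtoC_plus; simpl cfsum; rewrite IH; ring. Qed.

Lemma cfsum_single (u : nat -> C) (n m : nat) : (n < m)%nat ->
  (forall l, (l < m)%nat -> l <> n -> u l = 0%C) -> cfsum u m = u n.
Proof.
induction m as [|m IH]; intros Hn Hu; [lia|]; simpl cfsum.
destruct (Nat.eq_dec m n) as [E|E].
  rewrite E, (cfsum_ext u (fun _ => 0%C)), cfsum_const by (intros; apply Hu; lia); ring.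
rewrite IH by (try lia; intros; apply Hu; lia); rewrite (Hu m) by lia; ring.
Qed.

(* Averaging over the [N]-th roots of unity isolates the coefficient of index [n],
   up to the tail of the series beyond [N]. *)
Lemma coef_bound (g : nat -> R) (s B : R) :
  ex_series (fun n => Rabs (g n) * exp (- (INR n * s))) ->
  (forall t, 0 <= t <= PI -> Cmod (csum (fun n => g n * cexp (- (s + t * Ci)) ^ n)%C) <= B) ->
  forall n, Rabs (g n) * exp (- (INR n * s)) <= B.
Proof.
intros Hs HB n; pose proof PI_RGT_0.
set (G := fun t : R => csum (fun n => g n * cexp (- (s + t * Ci)) ^ n)%C).
assert (HG : forall t, 0 <= t <= 2 * PI -> Cmod (G t) <= B).
  (* The coefficients are real, so conjugation carries t to 2 PI - t. *)
  intros t Ht; destruct (Rle_or_lt t PI) as [H1|H1]; [apply HB; lra|].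
  rewrite <- Cmod_conj; unfold G; rewrite <- csum_conj.
  rewrite (csum_ext _ (fun n => g n * cexp (- (s + (2 * PI - t)%R * Ci)) ^ n)%C); [apply HB; lra|].
  intros k; rewrite Cmult_conj, Cpow_conj, Cconj_cexp; f_equal; [apply C_eq; simpl; ring|f_equal].
  replace (- (s + (2 * PI - t)%R * Ci))%C with (Cconj (- (s + t * Ci)) - INR 1 * I2)%C.
    rewrite cexp_shift_neg; reflexivity.
  apply C_eq; unfold I2, Cconj; csimp; ring.
apply le_epsilon; intros eps He.
destruct (proj2 (is_lim_seq_spec _ _) (Series_tail_lim _ Hs) (mkposreal _ He)) as [N0 HN0].
set (N := (N0 + S n)%nat); specialize (HN0 N ltac:(unfold N; lia)); simpl in HN0.
assert (HnN : (n < N)%nat) by (unfold N; lia).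
assert (PN : 0 < INR N) by (apply lt_0_INR; lia).
assert (NN : RtoC (INR N) <> 0%C) by (apply RtoC_neq_0; lra).
set (zeta := cexp ((- (2 * PI / INR N))%R * Ci)%C).
assert (Z1 : forall k, (zeta ^ k = cexp ((- (2 * PI * INR k / INR N))%R * Ci))%C).
  intros k; unfold zeta; rewrite <- cexp_nat; f_equal; rewrite Cmult_assoc, <- RtoC_mult; do 2 f_equal.
  field; lra.
assert (ZN : (zeta ^ N = 1)%C).
  unfold zeta; rewrite <- cexp_nat.
  replace (INR N * ((- (2 * PI / INR N))%R * Ci))%C with (0 - INR 1 * I2)%C.
    rewrite cexp_shift_neg; apply cexp_0.
  rewrite Cmult_assoc, <- RtoC_mult.
  replace (INR N * - (2 * PI / INR N)) with (- (2 * PI)) by (field; lra).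
  unfold I2; apply C_eq; csimp; ring.
assert (Zm : Cmod zeta = 1).
  unfold zeta; rewrite Cmod_cexp; replace (Re _) with 0 by (csimp; ring); apply exp_0.
set (r := RtoC (exp (- s))).
assert (Eq : forall k, cexp (- (s + (2 * PI * INR k / INR N)%R * Ci))%C = (r * zeta ^ k)%C).
  intros k; rewrite Z1; unfold r; rewrite cexp_decomp; f_equal.
    do 2 f_equal; unfold Re; simpl; ring.
  f_equal; rewrite RtoC_opp; unfold Im; simpl; apply C_eq; simpl; ring.
(* e l represents l - n modulo N by a natural number; the average c l is then 1 at l = n and 0 at
   every other l < N. *)
set (e := fun l => (l + (N - 1) * n)%nat).
set (c := fun l => (/ INR N * cfsum (fun k => (zeta ^ e l) ^ k) N)%C).
assert (Cn : c n = 1%C).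
  unfold c; replace (e n) with (N * n)%nat by (unfold e; nia).
  rewrite Cpow_mult_r, ZN, Cpow_1_l, (cfsum_ext _ (fun _ => 1%C)) by (intros; apply Cpow_1_l).
  rewrite cfsum_const; field; exact NN.
assert (Cl : forall l, (l < N)%nat -> l <> n -> c l = 0%C).
  intros l Hl Hne; unfold c.
  pose proof (cfsum_geom (zeta ^ e l) N) as Hg.
  rewrite <- Cpow_mult_r, Nat.mul_comm, Cpow_mult_r, ZN, Cpow_1_l in Hg.
  assert (Nz : (1 - zeta ^ e l)%C <> 0%C).
    apply Cminus_neq_0; intros E.
    assert (E2 : (zeta ^ n = zeta ^ l)%C).
      replace (zeta ^ n)%C with (zeta ^ e l * zeta ^ n)%C by (rewrite <- E; ring).
      rewrite <- Cpow_add_r; replace (e l + n)%nat with (l + N * n)%nat by (unfold e; nia).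
      rewrite Cpow_add_r, Cpow_mult_r, ZN, Cpow_1_l; ring.
    rewrite !Z1 in E2.
    apply (cexp_root_neq_1 (2 * PI * (INR l - INR n) / INR N)).
      assert (Hd : 0 < Rabs (INR l - INR n) < INR N).
        split; [apply Rabs_pos_lt; intros E3; apply Hne, INR_eq; lra|].
        apply lt_INR in Hl; apply lt_INR in HnN; pose proof (pos_INR l); pose proof (pos_INR n).
        apply Rabs_def1; lra.
      unfold Rdiv; rewrite !Rabs_mult, Rabs_inv, (Rabs_pos_eq 2), (Rabs_pos_eq PI), (Rabs_pos_eq (INR N)) by lra.
      set (D := Rabs (INR l - INR n)) in *.
      split.
        apply Rmult_lt_0_compat; [nra|apply Rinv_0_lt_compat; lra].
      apply Rmult_lt_reg_r with (INR N); [exact PN|].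
      rewrite Rmult_assoc, Rinv_l, Rmult_1_r by lra; nra.
    replace ((2 * PI * (INR l - INR n) / INR N)%R * Ci)%C
      with ((- (2 * PI * INR n / INR N))%R * Ci + - ((- (2 * PI * INR l / INR N))%R * Ci))%C.
      rewrite cexp_add, cexp_opp, E2; field; apply cexp_neq_0.
    replace (- ((- (2 * PI * INR l / INR N))%R * Ci))%C with ((2 * PI * INR l / INR N)%R * Ci)%C by (rewrite RtoC_opp; ring).
    rewrite <- Cmult_plus_distr_r, <- RtoC_plus; do 2 f_equal; field; lra.
  replace (cfsum (fun k => (zeta ^ e l) ^ k)%C N) with (RtoC 0); [ring|].
  replace (cfsum (fun k => (zeta ^ e l) ^ k)%C N)
    with (/ (1 - zeta ^ e l) * ((1 - zeta ^ e l) * cfsum (fun k => (zeta ^ e l) ^ k) N))%C by (field; exact Nz).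
  rewrite Hg; field; exact Nz.
assert (Cb : forall l, Cmod (c l) <= 1).
  intros l; unfold c; rewrite Cmod_mult, Cmod_inv, Cmod_R, Rabs_pos_eq by (try exact NN; lra).
  apply Rmult_le_reg_l with (INR N); [exact PN|].
  rewrite <- Rmult_assoc, Rinv_r, Rmult_1_l, Rmult_1_r by lra.
  eapply Rle_trans; [apply Cmod_cfsum|].
  rewrite (rfsum_ext _ (fun _ => 1)).
    clear; induction N as [|m IH]; [simpl; lra|rewrite S_INR; simpl rfsum; lra].
  intros k _; rewrite !Cmod_pow, Zm, !pow1; reflexivity.
assert (Cr : forall l, Cmod (r ^ l)%C = exp (- (INR l * s))).
  intros l; unfold r; rewrite Cmod_pow, Cmod_R, Rabs_pos_eq by (left; apply exp_pos).
  rewrite <- exp_nat; f_equal; ring.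
assert (Sg : csummable (fun l => g l * r ^ l)%C).
  apply csummable_dom with (2 := Hs); intros l; rewrite Cmod_mult, Cr, Cmod_R; lra.
assert (Sk : forall k, csummable (fun l => g l * (r * zeta ^ k) ^ l)%C).
  intros k; apply csummable_dom with (2 := Hs); intros l.
  rewrite Cpow_mult_l, !Cmod_mult, Cr, !Cmod_pow, Zm, !pow1, Cmod_R; lra.
set (av := (/ INR N * cfsum (fun k => zeta ^ (k * ((N - 1) * n)) * G (2 * PI * INR k / INR N)%R) N)%C).
assert (Hav : Cmod av <= B).
  unfold av; rewrite Cmod_mult, Cmod_inv, Cmod_R, Rabs_pos_eq by (try exact NN; lra).
  apply Rmult_le_reg_l with (INR N); [exact PN|].
  rewrite <- Rmult_assoc, Rinv_r, Rmult_1_l by lra.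
  eapply Rle_trans; [apply Cmod_cfsum|].
  apply Rle_trans with (rfsum (fun _ => B) N).
    apply rfsum_le; intros k Hk; rewrite Cmod_mult, Cmod_pow, Zm, pow1, Rmult_1_l.
    apply HG; apply lt_INR in Hk; pose proof (pos_INR k); split.
      apply Rmult_le_pos; [nra|left; apply Rinv_0_lt_compat; lra].
    apply Rmult_le_reg_r with (INR N); [exact PN|].
    replace (2 * PI * INR k / INR N * INR N) with (2 * PI * INR k) by (field; lra); nra.
  clear; induction N as [|m IH]; [simpl; lra|rewrite S_INR; simpl rfsum; lra].
assert (Ha : av = csum (fun l => g l * r ^ l * c l)%C).
  unfold av, G.
  rewrite (cfsum_ext _ (fun k => csum (fun l => zeta ^ (k * ((N - 1) * n)) * (g l * (r * zeta ^ k) ^ l)))%C).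
  2:{ intros k _; rewrite csum_scal by apply Sk; f_equal; apply csum_ext; intros l; rewrite Eq; reflexivity. }
  destruct (csum_cfsum_swap (fun k l => zeta ^ (k * ((N - 1) * n)) * (g l * (r * zeta ^ k) ^ l))%C N) as [S2 ->].
    intros k; apply csummable_scal, Sk.
  rewrite <- csum_scal by exact S2; apply csum_ext; intros l.
  rewrite (cfsum_ext _ (fun k => (g l * r ^ l) * (zeta ^ e l) ^ k)%C).
    rewrite (cfsum_scal _ (fun k => (zeta ^ e l) ^ k)%C); unfold c; ring.
  intros k _; rewrite Cpow_mult_l.
  replace ((zeta ^ e l) ^ k)%C with (zeta ^ (k * ((N - 1) * n)) * (zeta ^ k) ^ l)%C; [ring|].
  rewrite <- !Cpow_mult_r, <- Cpow_add_r; f_equal; unfold e; nia.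
assert (Sc : csummable (fun l => g l * r ^ l * c l)%C).
  apply csummable_dom with (2 := Hs); intros l; rewrite !Cmod_mult, Cr, Cmod_R.
  pose proof (Cb l); pose proof (Rabs_pos (g l)); pose proof (exp_pos (- (INR l * s))).
  assert (0 <= Rabs (g l) * exp (- (INR l * s))) by (apply Rmult_le_pos; lra); nra.
rewrite (csum_cfsum _ N Sc) in Ha.
assert (Ef : cfsum (fun l => g l * r ^ l * c l)%C N = (g n * r ^ n)%C).
  rewrite (cfsum_single _ n N HnN); [rewrite Cn; ring|].
  intros l Hl Hne; rewrite (Cl l Hl Hne); ring.
rewrite Ef in Ha.
rewrite Rminus_0_r in HN0.
assert (Ht : Cmod (csum (fun k => g (N + k)%nat * r ^ (N + k) * c (N + k)%nat)%C) <= eps).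
  eapply Rle_trans; [apply Cmod_csum_le with (b := fun k => Rabs (g (N + k)%nat) * exp (- (INR (N + k) * s)))|].
  - intros k; rewrite !Cmod_mult, Cr, Cmod_R.
    pose proof (Cb (N + k)%nat); pose proof (Rabs_pos (g (N + k)%nat)); pose proof (exp_pos (- (INR (N + k) * s))).
    assert (0 <= Rabs (g (N + k)%nat) * exp (- (INR (N + k) * s))) by (apply Rmult_le_pos; lra); nra.
  - apply (ex_series_shift (fun k => Rabs (g k) * exp (- (INR k * s)))), Hs.
  - eapply Rle_trans; [apply Rle_abs|]; lra.
rewrite <- Cr, <- Cmod_R, <- Cmod_mult.
replace (g n * r ^ n)%C with (av + - csum (fun k => g (N + k)%nat * r ^ (N + k) * c (N + k)%nat))%C by (rewrite Ha; ring).
eapply Rle_trans; [apply Cmod_triangle|]; rewrite Cmod_opp; lra.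
Qed.

(** The inequality between derivatives behind [factor_log], with v = t^2 and denominators cleared.
    The difference is v (1 - c) times a polynomial in c, nonnegative by completing a square for v <=
    1/2 and by direct estimate for larger v. *)
Lemma factor_slope (v c : R) : 0 <= v < 1 -> -1 <= c <= 1 ->
  c * (1 - v) ^ 2 + (1 - c) * (1 - v) * ((1 + v) ^ 2 - 4 * v * c ^ 2) <= (1 + v) ^ 2 - 4 * v * c ^ 2.
Proof.
intros Hv Hc.
assert (E : (1 + v) ^ 2 - 4 * v * c ^ 2
  - (c * (1 - v) ^ 2 + (1 - c) * (1 - v) * ((1 + v) ^ 2 - 4 * v * c ^ 2))
  = v * (1 - c) * ((1 + v) ^ 2 - 4 * v * c ^ 2 + 4 * c * (1 + c))) by ring.
assert (P : 0 <= (1 + v) ^ 2 - 4 * v * c ^ 2 + 4 * c * (1 + c)).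
  replace ((1 + v) ^ 2 - 4 * v * c ^ 2 + 4 * c * (1 + c))
    with ((1 + v) ^ 2 + 4 * c + 4 * c ^ 2 * (1 - v)) by ring.
  destruct (Rle_or_lt v (1 / 2)) as [H|H].
    assert (H1 : 0 <= (1 - v) * ((1 + v) ^ 2 + 4 * c + 4 * c ^ 2 * (1 - v))).
      replace ((1 - v) * ((1 + v) ^ 2 + 4 * c + 4 * c ^ 2 * (1 - v)))
        with (((1 - v) * (2 * c) + 1) ^ 2 + v * (1 - v - v ^ 2)) by ring.
      assert (0 <= v * (1 - v - v ^ 2)) by (apply Rmult_le_pos; nra).
      pose proof (pow2_ge_0 ((1 - v) * (2 * c) + 1)); lra.
    apply Rmult_le_reg_l with (1 - v); lra.
  replace ((1 + v) ^ 2 + 4 * c + 4 * c ^ 2 * (1 - v))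
    with ((1 - v) ^ 2 + 4 * (1 + c) * (1 - (1 - v) * (1 - c))) by ring.
  assert (0 <= 1 - (1 - v) * (1 - c)) by nra.
  pose proof (pow2_ge_0 (1 - v)); nra.
assert (0 <= v * (1 - c)) by (apply Rmult_le_pos; lra); nra.
Qed.

(** Here rho = |w| and c is the cosine of the argument of w, so the logarithms on the left give 2 ln
    |(1 + w) / (1 - w)|. Both sides vanish at rho = 0 and their slopes are compared by
    [factor_slope]. *)
Lemma factor_log (rho c : R) : 0 <= rho < 1 -> -1 <= c <= 1 ->
  ln (1 + 2 * c * rho + rho ^ 2) - ln (1 - 2 * c * rho + rho ^ 2) + 4 * rho * (1 - c)
  <= 2 * ln (1 + rho) - 2 * ln (1 - rho).
Proof.
intros Hr Hc.
set (h := fun t => 2 * ln (1 + t) - 2 * ln (1 - t)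
  - (ln (1 + 2 * c * t + t ^ 2) - ln (1 - 2 * c * t + t ^ 2) + 4 * t * (1 - c))).
assert (H : h 0 <= h rho).
  assert (Q : forall t, 0 <= t <= rho -> 0 < 1 + 2 * c * t + t ^ 2 /\ 0 < 1 - 2 * c * t + t ^ 2).
    intros t Ht; assert (0 < (1 - t) ^ 2) by (apply pow_lt; lra); split; nra.
  apply (le_of_deriv h (fun t => 2 / (1 + t) + 2 / (1 - t)
    - ((2 * c + 2 * t) / (1 + 2 * c * t + t ^ 2) - (- 2 * c + 2 * t) / (1 - 2 * c * t + t ^ 2) + 4 * (1 - c)))); [lra| |].
  - intros t Ht; destruct (Q t Ht) as [Q1 Q2]; unfold h; auto_derive.
      repeat split; lra.
    field; repeat split; lra.
  - intros t Ht; destruct (Q t Ht) as [Q1 Q2].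
    assert (Hv : 0 <= t ^ 2 < 1) by nra.
    pose proof (factor_slope (t ^ 2) c Hv Hc) as F.
    assert (Q3 : 0 < (1 + t ^ 2) ^ 2 - 4 * t ^ 2 * c ^ 2).
      replace ((1 + t ^ 2) ^ 2 - 4 * t ^ 2 * c ^ 2)
        with ((1 + 2 * c * t + t ^ 2) * (1 - 2 * c * t + t ^ 2)) by ring.
      apply Rmult_lt_0_compat; assumption.
    match goal with |- 0 <= ?g => replace g with
      (4 * ((1 + t ^ 2) ^ 2 - 4 * t ^ 2 * c ^ 2
        - (c * (1 - t ^ 2) ^ 2 + (1 - c) * (1 - t ^ 2) * ((1 + t ^ 2) ^ 2 - 4 * t ^ 2 * c ^ 2)))
       * / ((1 - t ^ 2) * ((1 + t ^ 2) ^ 2 - 4 * t ^ 2 * c ^ 2))) end.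
      apply Rmult_le_pos; [lra|left; apply Rinv_0_lt_compat, Rmult_lt_0_compat; lra].
    replace ((1 + t ^ 2) ^ 2 - 4 * t ^ 2 * c ^ 2)
      with ((1 + 2 * c * t + t ^ 2) * (1 - 2 * c * t + t ^ 2)) by ring.
    replace (1 - t ^ 2) with ((1 - t) * (1 + t)) by ring.
    field; repeat split; lra.
unfold h in H at 1.
replace (1 + 2 * c * 0 + 0 ^ 2) with 1 in H by ring; replace (1 - 2 * c * 0 + 0 ^ 2) with 1 in H by ring.
rewrite Rplus_0_r, Rminus_0_r, ln_1 in H; unfold h in H; lra.
Qed.

(** Only a gain linear in w is kept: over the powers w = q^i it sums to geometric series, which are
    explicit. *)
Lemma factor_bound (w : C) : Cmod w < 1 ->
  Cmod ((1 + w) / (1 - w))%C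
  <= (1 + Cmod w) / (1 - Cmod w) * exp (- (2 * (Cmod w - Re w))).
Proof.
intros Hw; pose proof (Cmod_ge_0 w) as H0; set (rho := Cmod w) in *.
pose proof (one_minus_neq_0 w Hw) as N1.
assert (N2 : (1 + w)%C <> 0%C).
  replace (1 + w)%C with (1 - - w)%C by ring; apply one_minus_neq_0; rewrite Cmod_opp; exact Hw.
assert (P1 : 0 < Cmod (1 - w)%C) by (apply Cmod_gt_0, N1).
assert (P2 : 0 < Cmod (1 + w)%C) by (apply Cmod_gt_0, N2).
rewrite Cmod_div by exact N1.
destruct (Req_dec rho 0) as [E0|E0].
  assert (Ew : w = 0%C) by (apply Cmod_eq_0, E0).
  rewrite E0, Ew; replace (1 + 0)%C with (RtoC 1) by ring; replace (1 - 0)%C with (RtoC 1) by ring.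
  rewrite Cmod_1; simpl Re; right.
  replace (- (2 * (0 - 0))) with 0 by ring; rewrite exp_0; field.
assert (Pr : 0 < rho) by lra.
set (c := Re w / rho).
assert (Ec : Re w = rho * c) by (unfold c; field; lra).
assert (Hc : -1 <= c <= 1).
  pose proof (re_le_Cmod w) as Hr; fold rho in Hr; rewrite Ec, Rabs_mult, Rabs_pos_eq in Hr by lra.
  apply Rabs_le_between; replace 1 with (/ rho * rho) by (field; lra).
  apply Rmult_le_reg_l with rho; [exact Pr|].
  replace (rho * (/ rho * rho)) with rho by (field; lra); exact Hr.
assert (M2 : rho ^ 2 = Re w ^ 2 + Im w ^ 2) by (unfold rho; apply Cmod2_alt).
assert (E1 : Cmod (1 + w)%C ^ 2 = 1 + 2 * c * rho + rho ^ 2).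
  rewrite Cmod2_alt, M2; replace (2 * c * rho) with (2 * Re w) by (rewrite Ec; ring); csimp; ring.
assert (E2 : Cmod (1 - w)%C ^ 2 = 1 - 2 * c * rho + rho ^ 2).
  rewrite Cmod2_alt, M2; replace (2 * c * rho) with (2 * Re w) by (rewrite Ec; ring); csimp; ring.
pose proof (factor_log rho c (conj H0 Hw) Hc) as F.
rewrite <- E1, <- E2 in F; simpl pow in F; rewrite !Rmult_1_r, !ln_mult in F by assumption.
assert (F2 : ln (Cmod (1 + w)%C) - ln (Cmod (1 - w)%C)
  <= ln (1 + rho) - ln (1 - rho) + - (2 * (rho - Re w))) by (rewrite Ec; lra).
apply exp_le in F2; unfold Rminus in F2.
rewrite !exp_plus, !exp_Ropp, !exp_ln in F2 by lra.
unfold Rdiv, Rminus in *; rewrite exp_Ropp; exact F2.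
Qed.

Lemma gf_minor (K : nat) (q : C) : 0 < Cmod q < 1 ->
  Cmod (gf K q) <= gfR K (Cmod q)
    * exp (- (2 * rfsum (fun i => Cmod q ^ S i - Re (q ^ S i)%C) K)).
Proof.
intros Hq; induction K as [|K IH].
  simpl; rewrite Cmod_1, Rmult_0_r, Ropp_0, exp_0; lra.
cbn [gf gfR rfsum]; rewrite Cmod_mult.
pose proof (factor_bound (q ^ S K)%C (Cmod_pow_lt_1 q K (proj2 Hq))) as F.
rewrite Cmod_pow in F.
rewrite Rmult_plus_distr_l, Ropp_plus_distr, exp_plus.
eapply Rle_trans; [apply Rmult_le_compat; [apply Cmod_ge_0|apply Cmod_ge_0|exact IH|exact F]|].
right; ring.
Qed.

Lemma rfsum_geom (r : R) (m : nat) : r <> 1 ->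
  rfsum (fun i => r ^ S i) m = (r - r ^ S m) / (1 - r).
Proof. intros H; induction m as [|m IH]; cbn [rfsum]; [|rewrite IH]; simpl; field; lra. Qed.

Lemma cfsum_geom_S (q : C) (m : nat) : (1 - q)%C <> 0%C ->
  cfsum (fun i => q ^ S i)%C m = ((q - q ^ S m) / (1 - q))%C.
Proof.
intros H; induction m as [|m IH]; cbn [cfsum].
  rewrite Cpow_1_r; field; exact H.
rewrite IH, (Cpow_S _ (S m)); field; exact H.
Qed.

Lemma Re_cfsum (u : nat -> C) (m : nat) : Re (cfsum u m) = rfsum (fun k => Re (u k)) m.
Proof. induction m as [|m IH]; simpl; [reflexivity|rewrite <- IH; reflexivity]. Qed.

Lemma rfsum_minus (u v : nat -> R) (m : nat) :
  rfsum (fun k => u k - v k) m = rfsum u m - rfsum v m.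
Proof. induction m as [|m IH]; simpl; [|rewrite IH]; ring. Qed.

(** This is sinh (s / 2) >= s / 2, squared and multiplied by 4 exp (- s). *)
Lemma sinh_sqr_ge (s : R) : 0 < s -> s ^ 2 * exp (- s) <= (1 - exp (- s)) ^ 2.
Proof.
intros Hs.
assert (H : s <= exp (s / 2) - exp (- (s / 2))).
  assert (G : exp 0 - exp (- 0) - 2 * 0 <= exp (s / 2) - exp (- (s / 2)) - 2 * (s / 2)).
    apply (le_of_deriv (fun t => exp t - exp (- t) - 2 * t) (fun t => exp t + exp (- t) - 2)); [lra| |].
    - intros t _; auto_derive; [easy|ring].
    - intros t _.
      assert (E : exp t * exp (- t) = 1).
        rewrite <- exp_plus; replace (t + - t) with 0 by ring; apply exp_0.
      pose proof (exp_pos t); pose proof (exp_pos (- t)).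
      pose proof (pow2_ge_0 (exp t - exp (- t))); nra.
  rewrite Ropp_0, exp_0 in G; lra.
assert (E1 : exp (- s) = exp (- (s / 2)) * exp (- (s / 2))) by (rewrite <- exp_plus; f_equal; field).
assert (E2 : exp (s / 2) * exp (- (s / 2)) = 1).
  rewrite <- exp_plus; replace (s / 2 + - (s / 2)) with 0 by ring; apply exp_0.
pose proof (exp_pos (- (s / 2))) as Pe.
replace ((1 - exp (- s)) ^ 2) with ((exp (s / 2) - exp (- (s / 2))) ^ 2 * exp (- s)).
  apply Rmult_le_compat_r; [left; apply exp_pos|apply pow_incr; lra].
rewrite E1; set (a := exp (s / 2)) in *; set (b := exp (- (s / 2))) in *.
replace ((a - b) ^ 2 * (b * b)) with ((a * b - b * b) ^ 2) by ring; rewrite E2; ring.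
Qed.

(** Up to truncation, the exponent of [gf_minor] is twice r / (1 - r) - Re (q / (1 - q)). The first
    term is at least 1 / s - 1. On this arc |1 - q| is at least r s / (39/100), with 39/100 just
    above 5/13, so the second is at most 39/100 / s. Hence 61/50 = 2 (1 - 39/100); the 3 is twice
    the lost 1 plus the truncation tails. *)
Lemma gf_minor_arc (K : nat) (s t : R) : 0 < s <= / 30 -> 12 / 5 * s <= t <= PI ->
  4 * (exp (- s) ^ S K / (1 - exp (- s))) <= 1 ->
  Cmod (gf K (cexp (- (s + t * Ci)))) <= gfR K (exp (- s)) * exp (3 - 61 / 50 / s).
Proof.
intros Hs Ht HK; set (q := cexp (- (s + t * Ci))%C); set (r := exp (- s)) in *.
assert (Hr : 0 < r < 1).
  split; [apply exp_pos|unfold r; rewrite <- exp_0; apply exp_increasing; lra].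
assert (Eq : Cmod q = r).
  unfold q, r; rewrite Cmod_cexp; f_equal; csimp; ring.
assert (N1 : (1 - q)%C <> 0%C) by (apply one_minus_neq_0; lra).
pose proof (gf_minor K q) as H; rewrite Eq in H; specialize (H Hr).
eapply Rle_trans; [exact H|].
apply Rmult_le_compat_l; [left; apply gfR_pos, Hr|].
apply exp_le.
assert (A1 : 1 - r <= Cmod (1 - q)%C) by (rewrite <- Eq; apply Cmod_one_minus_ge).
assert (A2 : Cmod (1 - q)%C ^ 2 = (1 - r) ^ 2 + 4 * r * sin (t / 2) ^ 2).
  rewrite <- Cmod_opp; replace (- (1 - q))%C with (q - 1)%C by ring.
  unfold q; rewrite Cmod_cexp_m1_sqr.
  replace (Re (- (s + t * Ci))%C) with (- s) by (csimp; ring).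
  replace (Im (- (s + t * Ci))%C) with (- t) by (csimp; ring).
  fold r; replace (- t / 2) with (- (t / 2)) by field; rewrite sin_neg; ring.
pose proof (sinh_sqr_ge s (proj1 Hs)) as A3; fold r in A3.
pose proof PI_gt; pose proof PI_lt.
(* t / 2 >= 6/5 s, and sin increases up to PI / 2; the cubic Taylor term costs less than s / 500
   because s <= 1/30. *)
assert (A4 : 599 / 500 * s <= sin (t / 2)).
  apply Rle_trans with (sin (6 / 5 * s)).
    eapply Rle_trans; [|apply sin_ge_cubic; lra].
    assert (s ^ 2 <= 1 / 900) by nra; nra.
  apply sin_incr_1; lra.
assert (A5 : (s / (39 / 100)) ^ 2 * r ^ 2 <= Cmod (1 - q)%C ^ 2).
  assert (Hs2 : (599 / 500 * s) ^ 2 <= sin (t / 2) ^ 2) by (apply pow_incr; lra).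
  rewrite A2; nra.
assert (A6 : r / Cmod (1 - q)%C <= 39 / 100 / s).
  assert (P1 : 0 < Cmod (1 - q)%C) by lra.
  assert (A7 : s / (39 / 100) * r <= Cmod (1 - q)%C).
    apply Rsqr_incr_0_var; [|lra]; rewrite !Rsqr_pow2, Rpow_mult_distr; exact A5.
  apply Rmult_le_reg_r with (Cmod (1 - q)%C * s); [apply Rmult_lt_0_compat; lra|].
  replace (r / Cmod (1 - q)%C * (Cmod (1 - q)%C * s)) with (r * s) by (field; lra).
  replace (39 / 100 / s * (Cmod (1 - q)%C * s)) with (39 / 100 * Cmod (1 - q)%C) by (field; lra).
  lra.
assert (A8 : / s - 1 <= r / (1 - r)).
  pose proof (exp_ineq1_le (- s)) as E; fold r in E.
  apply Rmult_le_reg_r with (s * (1 - r)); [apply Rmult_lt_0_compat; lra|].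
  replace ((/ s - 1) * (s * (1 - r))) with ((1 - s) * (1 - r)) by (field; lra).
  replace (r / (1 - r) * (s * (1 - r))) with (r * s) by (field; lra); nra.
rewrite rfsum_minus, rfsum_geom, <- (Re_cfsum (fun i => q ^ S i)%C), cfsum_geom_S by (try exact N1; lra).
assert (A9 : Re ((q - q ^ S K) / (1 - q))%C <= r / Cmod (1 - q)%C + r ^ S K / (1 - r)).
  eapply Rle_trans; [apply Rle_abs|]; eapply Rle_trans; [apply re_le_Cmod|].
  rewrite Cmod_div by exact N1.
  assert (B : Cmod (q - q ^ S K)%C <= r + r ^ S K).
    eapply Rle_trans; [apply Cmod_triangle|]; rewrite Cmod_opp, Cmod_pow, Eq; lra.
  assert (I : 0 < / Cmod (1 - q)%C <= / (1 - r)).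
    split; [apply Rinv_0_lt_compat; lra|apply Rinv_le_contravar; lra].
  pose proof (pow_S_bounds r K Hr).
  unfold Rdiv; nra.
assert (E : (r - r ^ S K) / (1 - r) = r / (1 - r) - r ^ S K / (1 - r)) by (field; lra).
rewrite E.
replace (61 / 50 / s) with (2 * (/ s - 39 / 100 / s)) by (field; lra).
lra.
Qed.

Definition rho_maj (s : R) : R := exp (- (50 / 169 * PI ^ 2 / s)).

(** The error of the coefficient bound relative to la. First comes the major arc, with the
    truncation tail already replaced by [rho_maj]; then the product and [yfun] on the minor arc,
    where |z| >= 13/5 s; last [F_minus_y], which enters on both arcs. *)
Definition err (s : R) : R :=
  12 / 5 * s * ((1 + 4 * PI ^ 2 / s ^ 2) * rho_maj s * (PI * exp (PI ^ 2 / 4 / s)) + PI / (2 * s))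
  + PI * exp (PI ^ 2 / 4 / s) * exp (3 - 61 / 50 / s)
  + PI * exp (PI ^ 2 / 4 * (5 / 13 / s)) + (48 + 11 / s).

Lemma yR_le (s : R) : 0 < s -> yR s <= PI * exp (PI ^ 2 / 4 / s).
Proof. intros Hs; apply Series_aco_le; left; apply Rinv_0_lt_compat, Hs. Qed.

(* [la] is the ratio of [gfR K] to [yR] at the saddle point. *)
Lemma opcount_approx (o : nat -> nat -> R) (s : R) (M : nat) : opcount o ->
  0 < s <= / 30 -> rho_maj s <= / 10 ->
  exists K la, (M <= K)%nat /\ 0 < la /\
    forall m, Rabs (o K m - la * ffun (INR m)) * exp (- (INR m * s)) <= la * err s.
Proof.
intros Ho Hs Hrho; pose proof PI_RGT_0 as HPI; pose proof PI_gt as HPI1; pose proof PI_lt as HPI2.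
set (r := exp (- s)).
assert (Hr : 0 < r < 1).
  split; [apply exp_pos|unfold r; rewrite <- exp_0; apply exp_increasing; lra].
assert (Prho : 0 < rho_maj s) by apply exp_pos.
destruct (proj2 (is_lim_seq_spec _ _) (ttail_lim s (proj1 Hs)) (mkposreal _ Prho)) as [K1 HK1].
assert (Pd : 0 < (1 - r) / 4) by lra.
assert (Lr : is_lim_seq (fun n => r ^ n) 0) by (apply is_lim_seq_geom; rewrite Rabs_pos_eq; lra).
destruct (proj2 (is_lim_seq_spec _ _) Lr (mkposreal _ Pd)) as [K2 HK2].
(* K1 puts the truncation tail below the dual nome bound for the major arc, K2 makes the geometric
   tail small for the minor arc, and M covers the coefficients of interest. *)
set (K := (M + K1 + K2)%nat).
specialize (HK1 K ltac:(unfold K; lia)); specialize (HK2 (S K) ltac:(unfold K; lia)).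
simpl pos in HK1, HK2; rewrite Rminus_0_r in HK1, HK2.
assert (T1 : ttail K s <= rho_maj s) by (pose proof (Rle_abs (ttail K s)); lra).
assert (T2 : 4 * (r ^ S K / (1 - r)) <= 1).
  pose proof (Rle_abs (r ^ S K)).
  apply Rmult_le_reg_r with (1 - r); [lra|].
  replace (4 * (r ^ S K / (1 - r)) * (1 - r)) with (4 * r ^ S K) by (field; lra); lra.
set (G := gfR K r); assert (PG : 0 < G) by (apply gfR_pos, Hr).
pose proof (yR_pos s (proj1 Hs)) as Py; pose proof (yR_le s (proj1 Hs)) as Hy.
set (la := G / yR s); assert (Pla : 0 < la) by (apply Rdiv_lt_0_compat; assumption).
assert (EG : G = la * yR s) by (unfold la; field; lra).
set (Y := PI * exp (PI ^ 2 / 4 / s)) in *.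
assert (HG : G <= la * Y) by (rewrite EG; apply Rmult_le_compat_l; lra).
exists K, la; split; [unfold K; lia|split; [exact Pla|]].
assert (So : ex_series (fun n => o K n * exp (- (INR n * s)))).
  apply ex_series_ext with (fun n => o K n * r ^ n); [|apply opcount_summable; assumption].
  intros n; unfold r; rewrite <- exp_nat; do 2 f_equal; ring.
pose proof (ex_series_ffun_q s (proj1 Hs)) as Sf.
apply coef_bound.
- apply ex_series_dom with (fun n => o K n * exp (- (INR n * s)) + la * (ffun (INR n) * exp (- (INR n * s)))).
  2:{ apply (ex_series_plus (fun n => o K n * exp (- (INR n * s)))
        (fun n => la * (ffun (INR n) * exp (- (INR n * s))))); [exact So|apply ex_series_Rscal, Sf]. }
  intros n; pose proof (exp_pos (- (INR n * s))).
  assert (0 <= o K n) by apply Ho; pose proof (ffun_nonneg (INR n) (pos_INR n)).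
  rewrite Rabs_mult, Rabs_Rabsolu, (Rabs_pos_eq (exp _)) by lra.
  replace (o K n * exp (- (INR n * s)) + la * (ffun (INR n) * exp (- (INR n * s))))
    with ((o K n + la * ffun (INR n)) * exp (- (INR n * s))) by ring.
  apply Rmult_le_compat_r; [lra|].
  assert (0 <= la * ffun (INR n)) by (apply Rmult_le_pos; lra).
  apply Rabs_le; lra.
- intros t Ht; set (z := (s + t * Ci)%C).
  destruct (vertical_mod s t) as [Er [Ei Em]]; fold z in Er, Ei, Em.
  assert (Hz : 0 < Re z) by lra.
  assert (Eq : Cmod (cexp (- z)) = r).
    unfold r; rewrite Cmod_cexp; f_equal; rewrite <- Er; unfold Re; simpl; ring.
  assert (Hq : 0 < Cmod (cexp (- z)) < 1) by (rewrite Eq; exact Hr).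
  assert (E : csum (fun n => (o K n - la * ffun (INR n))%R * cexp (- z) ^ n)%C
    = (gf K (cexp (- z)) - la * csum (Fterm z))%C).
    rewrite <- (opcount_gf o _ K Ho Hq), <- csum_scal, <- csum_minus by
      (try apply csummable_scal; try apply csummable_Fterm; try apply opcount_csummable; assumption).
    apply csum_ext; intros n; unfold Fterm; rewrite RtoC_minus, RtoC_mult; ring.
  rewrite E.
  assert (Fy : Cmod (csum (Fterm z) - yfun z)%C <= 48 + 11 / s).
    rewrite <- Er; apply F_minus_y; [exact Hz|rewrite Ei, Rabs_pos_eq; lra].
  assert (P1 : 0 <= 12 / 5 * s * ((1 + 4 * PI ^ 2 / s ^ 2) * rho_maj s * Y + PI / (2 * s))).
    assert (0 < PI ^ 2 / s ^ 2) by (apply Rdiv_lt_0_compat; apply pow_lt; lra).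
    assert (0 < Y) by lra.
    assert (0 < PI / (2 * s)) by (apply Rdiv_lt_0_compat; lra).
    assert (0 < (1 + 4 * PI ^ 2 / s ^ 2) * rho_maj s * Y).
      apply Rmult_lt_0_compat; [apply Rmult_lt_0_compat|]; [|exact Prho|lra].
      replace (4 * PI ^ 2 / s ^ 2) with (4 * (PI ^ 2 / s ^ 2)) by (field; lra); lra.
    apply Rmult_le_pos; lra.
  assert (P2 : 0 <= Y * exp (3 - 61 / 50 / s)).
    apply Rmult_le_pos; [lra|left; apply exp_pos].
  assert (P3 : 0 <= PI * exp (PI ^ 2 / 4 * (5 / 13 / s))).
    apply Rmult_le_pos; [lra|left; apply exp_pos].
  destruct (Rle_or_lt t (12 / 5 * s)) as [Hm|Hm].
  + pose proof (major_arc K s (rho_maj s) (proj1 Hs) ltac:(lra) ltac:(unfold rho_maj; lra) Hrho t (conj (proj1 Ht) Hm)) as A.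
    fold r in A; fold G in A; fold la in A; fold z in A.
    replace (gf K (cexp (- z)) - la * csum (Fterm z))%C
      with ((gf K (cexp (- z)) - la * yfun z) + - (la * (csum (Fterm z) - yfun z)))%C by ring.
    eapply Rle_trans; [apply Cmod_triangle|].
    rewrite Cmod_opp, (Cmod_mult la), Cmod_R, (Rabs_pos_eq la) by lra.
    assert (A2 : ((ttail K s + 4 * PI ^ 2 / s ^ 2 * rho_maj s) * G + la * (PI / (2 * s))) * t
      <= la * (12 / 5 * s * ((1 + 4 * PI ^ 2 / s ^ 2) * rho_maj s * Y + PI / (2 * s)))).
      assert (0 < PI ^ 2 / s ^ 2) by (apply Rdiv_lt_0_compat; apply pow_lt; lra).
      assert (B0 : 0 <= (1 + 4 * PI ^ 2 / s ^ 2) * rho_maj s).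
        apply Rmult_le_pos; [|lra].
        replace (4 * PI ^ 2 / s ^ 2) with (4 * (PI ^ 2 / s ^ 2)) by (field; lra); lra.
      assert (0 < PI / (2 * s)) by (apply Rdiv_lt_0_compat; lra).
      assert (B1 : (ttail K s + 4 * PI ^ 2 / s ^ 2 * rho_maj s) * G
        <= (1 + 4 * PI ^ 2 / s ^ 2) * rho_maj s * (la * Y)).
        apply Rle_trans with ((1 + 4 * PI ^ 2 / s ^ 2) * rho_maj s * G).
          apply Rmult_le_compat_r; lra.
        apply Rmult_le_compat_l; lra.
      assert (B2 : 0 <= la * Y) by lra.
      assert (B3 : 0 <= (1 + 4 * PI ^ 2 / s ^ 2) * rho_maj s * (la * Y)) by (apply Rmult_le_pos; lra).
      assert (B4 : 0 <= la * (PI / (2 * s))) by (apply Rmult_le_pos; lra).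
      apply Rle_trans with (((1 + 4 * PI ^ 2 / s ^ 2) * rho_maj s * (la * Y) + la * (PI / (2 * s))) * t).
        apply Rmult_le_compat_r; lra.
      apply Rle_trans with (((1 + 4 * PI ^ 2 / s ^ 2) * rho_maj s * (la * Y) + la * (PI / (2 * s))) * (12 / 5 * s)).
        apply Rmult_le_compat_l; lra.
      right; ring.
    assert (A3 : la * Cmod (csum (Fterm z) - yfun z)%C <= la * (48 + 11 / s)) by (apply Rmult_le_compat_l; lra).
    unfold err; fold Y.
    assert (0 <= la * (Y * exp (3 - 61 / 50 / s))) by (apply Rmult_le_pos; lra).
    assert (0 <= la * (PI * exp (PI ^ 2 / 4 * (5 / 13 / s)))) by (apply Rmult_le_pos; lra).
    lra.
  + pose proof (gf_minor_arc K s t Hs ltac:(lra) T2) as A.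
    fold r in A; fold G in A; fold z in A.
    assert (Hzm : 13 / 5 * s <= Cmod z).
      apply Rsqr_incr_0_var; [|apply Cmod_ge_0]; rewrite !Rsqr_pow2, Em; nra.
    assert (Yz : Cmod (yfun z) <= PI * exp (PI ^ 2 / 4 * (5 / 13 / s))).
      eapply Rle_trans; [apply Cmod_yfun_le|].
      apply Rmult_le_compat_l; [lra|]; apply exp_le, Rmult_le_compat_l; [nra|].
      replace (5 / 13 / s) with (/ (13 / 5 * s)) by (field; lra).
      apply Cmod_inv_le; lra.
    replace (gf K (cexp (- z)) - la * csum (Fterm z))%C
      with (gf K (cexp (- z)) + - (la * ((csum (Fterm z) - yfun z) + yfun z)))%C by ring.
    eapply Rle_trans; [apply Cmod_triangle|].
    rewrite Cmod_opp, Cmod_mult, Cmod_R, (Rabs_pos_eq la) by lra.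
    pose proof (Cmod_triangle (csum (Fterm z) - yfun z) (yfun z)) as T.
    assert (A3 : la * Cmod ((csum (Fterm z) - yfun z) + yfun z)%C
      <= la * ((48 + 11 / s) + PI * exp (PI ^ 2 / 4 * (5 / 13 / s)))) by (apply Rmult_le_compat_l; lra).
    assert (A4 : G * exp (3 - 61 / 50 / s) <= la * Y * exp (3 - 61 / 50 / s)).
      apply Rmult_le_compat_r; [left; apply exp_pos|exact HG].
    unfold err; fold Y.
    assert (0 <= la * (12 / 5 * s * ((1 + 4 * PI ^ 2 / s ^ 2) * rho_maj s * Y + PI / (2 * s)))) by (apply Rmult_le_pos; lra).
    lra.
Qed.

(** * Closed form of the main term *)

Lemma aco_fact (i : nat) : aco i = PI ^ (2 * i + 1) * INR (fact i) / INR (fact (2 * i + 1)).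
Proof.
induction i as [|i IH]; [simpl; field|].
cbn [aco]; rewrite IH.
replace (2 * S i + 1)%nat with (S (S (2 * i + 1))) by lia.
rewrite (fact_simpl i), (fact_simpl (S (2 * i + 1))), (fact_simpl (2 * i + 1)), !mult_INR.
rewrite !S_INR, plus_INR, mult_INR; simpl INR; simpl pow.
pose proof (INR_fact_neq_0 (2 * i + 1)); pose proof (pos_INR i).
field; repeat split; try assumption; lra.
Qed.

(** [ffun x] is PI / (2 x) times cosh t - sinh t / t. The coefficients of the latter are 1 / (2 n)!
    - 1 / (2 n + 1)! = 2 n / (2 n + 1)!; the one at n = 0 vanishes, and the others match [aco_fact]
    after a shift of the index. *)
Lemma ffun_closed (x : R) : 0 < x -> let t := PI * sqrt x in
  ffun x = PI / (4 * x) * (exp t * (1 - / t) + exp (- t) * (1 + / t)).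
Proof.
intros Hx t; pose proof PI_RGT_0; pose proof (sqrt_lt_R0 x Hx).
assert (Pt : 0 < t) by (apply Rmult_lt_0_compat; lra).
assert (Et : t ^ 2 = PI ^ 2 * x) by (unfold t; rewrite Rpow_mult_distr, pow2_sqrt; lra).
set (a := fun n => / INR (fact n)).
assert (Ea : forall u, PSeries a u = exp u) by (intros u; apply is_pseries_unique, is_exp_Reals).
assert (Sb : forall p, (forall n, (n <= p n)%nat) -> ex_series (fun n => a (p n) * (t ^ 2) ^ n)).
  intros p Hp; apply ex_series_dom with (fun n => (t ^ 2) ^ n / INR (fact n)).
    intros n; assert (0 <= (t ^ 2) ^ n) by (apply pow_le, pow2_ge_0).
    unfold a; pose proof (INR_fact_lt_0 n); pose proof (INR_fact_lt_0 (p n)).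
    assert (I : 0 < / INR (fact (p n)) <= / INR (fact n)).
      split; [apply Rinv_0_lt_compat; lra|apply Rinv_le_contravar; [lra|apply le_INR, fact_le, Hp]].
    rewrite Rabs_pos_eq by (apply Rmult_le_pos; lra); unfold Rdiv; nra.
  eexists; apply is_series_exp.
assert (S1 : ex_series (fun n => a (2 * n)%nat * (t ^ 2) ^ n)) by (apply (Sb (fun n => (2 * n)%nat)); intros; lia).
assert (S2 : ex_series (fun n => a (2 * n + 1)%nat * (t ^ 2) ^ n)) by (apply (Sb (fun n => (2 * n + 1)%nat)); intros; lia).
assert (OE : forall u, u ^ 2 = t ^ 2 -> exp u = Series (fun n => a (2 * n)%nat * (t ^ 2) ^ n)
   + u * Series (fun n => a (2 * n + 1)%nat * (t ^ 2) ^ n)).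
  intros u Eu; rewrite <- Ea, PSeries_odd_even; rewrite ?Eu; [reflexivity| |]; apply ex_pseries_R; assumption.
pose proof (OE t eq_refl) as E1; pose proof (OE (- t) ltac:(ring)) as E2.
assert (E3 : Series (fun n => a (2 * n)%nat * (t ^ 2) ^ n) - Series (fun n => a (2 * n + 1)%nat * (t ^ 2) ^ n)
  = 2 * x / PI * ffun x).
  rewrite <- Series_minus by assumption.
  rewrite Series_incr_1 by (apply (ex_series_minus _ _ S1 S2)).
  unfold ffun; rewrite <- Series_scal_l.
  match goal with |- ?u + _ = _ => replace u with 0 end.
  2:{ unfold a; simpl; field. }
  rewrite Rplus_0_l; apply Series_ext; intros n.
  unfold a, fco; rewrite aco_fact, Et.
  replace (2 * S n + 1)%nat with (S (2 * S n)) by lia.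
  rewrite (fact_simpl (2 * S n)), (fact_simpl n), !mult_INR, (S_INR (2 * S n)), (mult_INR 2), (S_INR n).
  replace (INR 2) with 2 by (simpl; ring).
  rewrite Rpow_mult_distr, <- pow_mult.
  replace (PI ^ S (2 * S n)) with (PI * PI ^ (2 * S n)) by reflexivity.
  pose proof (INR_fact_neq_0 (2 * S n)); pose proof (INR_fact_neq_0 n); pose proof (pos_INR n).
  rewrite <- (tech_pow_Rmult x n); field; repeat split; try assumption; lra.
set (Ce := Series (fun n => a (2 * n)%nat * (t ^ 2) ^ n)) in *.
set (De := Series (fun n => a (2 * n + 1)%nat * (t ^ 2) ^ n)) in *.
replace (ffun x) with (PI / (2 * x) * (Ce - De)) by (rewrite E3; field; lra).
rewrite E1, E2; field; lra.
Qed.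

(** * Third difference of the main term *)

Lemma incr_ge (f f' : R -> R) (u c : R) :
  (forall t, u <= t <= u + 1 -> is_derive f t (f' t)) ->
  (forall t, u <= t <= u + 1 -> c <= f' t) -> c <= f (u + 1) - f u.
Proof.
intros Hd Hc.
assert (H : f u - c * u <= f (u + 1) - c * (u + 1)); [|lra].
apply (le_of_deriv (fun t => f t - c * t) (fun t => f' t - c)); [lra| |].
- intros t Ht; apply (is_derive_minus f (fun t => c * t) t (f' t) c); [apply Hd, Ht|].
  auto_derive; [easy|ring].
- intros t Ht; specialize (Hc t Ht); lra.
Qed.

Lemma is_derive_shift (f : R -> R) (h t d : R) : is_derive f (t + h) d ->
  is_derive (fun u => f (u + h)) t d.
Proof.
intros H; replace d with (scal 1 d) by (unfold scal; simpl; unfold mult; simpl; ring).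
apply (is_derive_comp f (fun u => u + h)); [exact H|auto_derive; [easy|ring]].
Qed.

(** A third difference is a triple unit increment; [incr_ge] is applied at each level to the
    differences as functions of t, so no remainder term arises. *)
Lemma third_diff_ge (f f1 f2 f3 : R -> R) (a c : R) :
  (forall t, a <= t <= a + 3 ->
     is_derive f t (f1 t) /\ is_derive f1 t (f2 t) /\ is_derive f2 t (f3 t) /\ c <= f3 t) ->
  c <= f (a + 3) - 3 * f (a + 2) + 3 * f (a + 1) - f a.
Proof.
intros H.
assert (A2 : forall t, a <= t <= a + 2 -> c <= f2 (t + 1) - f2 t).
  intros t Ht; apply incr_ge with f3; intros x Hx; apply H; lra.
assert (A1 : forall t, a <= t <= a + 1 -> c <= (f1 (t + 1 + 1) - f1 (t + 1)) - (f1 (t + 1) - f1 t)).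
  intros t Ht; apply (incr_ge (fun x => f1 (x + 1) - f1 x) (fun x => f2 (x + 1) - f2 x)).
    intros x Hx; apply (is_derive_minus (fun x => f1 (x + 1)) f1).
      apply is_derive_shift; apply H; lra.
    apply H; lra.
  intros x Hx; apply A2; lra.
assert (A0 : c <= (f (a + 1 + 2) - 2 * f (a + 1 + 1) + f (a + 1)) - (f (a + 2) - 2 * f (a + 1) + f a)).
  apply (incr_ge (fun x => f (x + 2) - 2 * f (x + 1) + f x) (fun x => f1 (x + 2) - 2 * f1 (x + 1) + f1 x)).
    intros x Hx; apply (is_derive_plus (fun x => f (x + 2) - 2 * f (x + 1)) f).
      apply (is_derive_minus (fun x => f (x + 2)) (fun x => 2 * f (x + 1))).
        apply is_derive_shift; apply H; lra.
      apply (is_derive_scal (fun x => f (x + 1)) x 2), is_derive_shift; apply H; lra.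
    apply H; lra.
  intros x Hx; specialize (A1 x Hx); replace (x + 2) with (x + 1 + 1) by ring; lra.
replace (a + 1 + 2) with (a + 3) in A0 by ring; replace (a + 1 + 1) with (a + 2) in A0 by ring; lra.
Qed.

(* [exp (lmain x) / 4] is the growing exponential part of the closed form of [ffun x]. *)
Definition lmain (x : R) : R := PI * sqrt x + ln (PI * sqrt x - 1) - 3 * ln (sqrt x).

(** With w = sqrt x, the first two terms of [lmain] merge in the derivative into PI^2 / (2 (PI w -
    1)). Replacing PI w - 1 by PI w in the third derivative leaves (3 PI / 8 - 3 / w) / w^5, and w
    >= 49 makes the bracket at least 11/10; M bounds w from above. *)
Lemma lmain_third_diff (a M : R) : 49 ^ 2 <= a -> a + 3 <= M ^ 2 -> 0 < M ->
  11 / 10 / M ^ 5 <= lmain (a + 3) - 3 * lmain (a + 2) + 3 * lmain (a + 1) - lmain a.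
Proof.
intros Ha HM HM0; pose proof PI_gt as P1.
apply third_diff_ge with
  (fun x => PI ^ 2 / (2 * (PI * sqrt x - 1)) - 3 / (2 * sqrt x ^ 2))
  (fun x => - (PI ^ 3 / 4) / (sqrt x * (PI * sqrt x - 1) ^ 2) + 3 / (2 * sqrt x ^ 4))
  (fun x => PI ^ 3 / 8 * (/ (sqrt x ^ 3 * (PI * sqrt x - 1) ^ 2) + 2 * PI / (sqrt x ^ 2 * (PI * sqrt x - 1) ^ 3))
     - 3 / sqrt x ^ 6).
intros x Hx.
assert (Hw : 49 <= sqrt x).
  rewrite <- (sqrt_pow2 49) by lra; apply sqrt_le_1_alt; lra.
assert (HwM : sqrt x <= M).
  rewrite <- (sqrt_pow2 M) by lra; apply sqrt_le_1_alt; lra.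
assert (Pw : 1 < PI * sqrt x) by nra.
assert (Px : 0 < x) by lra.
split; [|split; [|split]].
- unfold lmain; auto_derive; [repeat split; lra|].
  field; lra.
- auto_derive; [repeat split; try lra; repeat apply Rmult_integral_contrapositive_currified; lra|].
  field; lra.
- auto_derive; [repeat split; try lra; repeat apply Rmult_integral_contrapositive_currified; lra|].
  field; lra.
- set (w := sqrt x) in *.
  assert (Pv : 0 < PI * w - 1 <= PI * w) by lra.
  assert (I1 : 1 / (PI ^ 2 * w ^ 5) <= / (w ^ 3 * (PI * w - 1) ^ 2)).
    replace (1 / (PI ^ 2 * w ^ 5)) with (/ (w ^ 3 * (PI * w) ^ 2)) by (field; lra).
    apply Rinv_le_contravar.
      apply Rmult_lt_0_compat; apply pow_lt; lra.
    apply Rmult_le_compat_l; [apply pow_le; lra|apply pow_incr; lra].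
  assert (I2 : 2 / (PI ^ 2 * w ^ 5) <= 2 * PI / (w ^ 2 * (PI * w - 1) ^ 3)).
    replace (2 / (PI ^ 2 * w ^ 5)) with (2 * PI * / (w ^ 2 * (PI * w) ^ 3)) by (field; lra).
    apply Rmult_le_compat_l; [lra|apply Rinv_le_contravar].
      apply Rmult_lt_0_compat; apply pow_lt; lra.
    apply Rmult_le_compat_l; [apply pow_le; lra|apply pow_incr; lra].
  assert (I3 : 3 * PI / 8 / w ^ 5 - 3 / w ^ 6
    <= PI ^ 3 / 8 * (/ (w ^ 3 * (PI * w - 1) ^ 2) + 2 * PI / (w ^ 2 * (PI * w - 1) ^ 3)) - 3 / w ^ 6).
    apply Rplus_le_compat_r.
    replace (3 * PI / 8 / w ^ 5) with (PI ^ 3 / 8 * (1 / (PI ^ 2 * w ^ 5) + 2 / (PI ^ 2 * w ^ 5))) by (field; lra).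
    apply Rmult_le_compat_l; [|lra].
    assert (0 < PI ^ 3) by (apply pow_lt; lra); lra.
  eapply Rle_trans; [|exact I3].
  replace (3 * PI / 8 / w ^ 5 - 3 / w ^ 6) with ((3 * PI / 8 - 3 / w) * / w ^ 5) by (field; lra).
  assert (3 / w <= 3 / 49) by (apply Rmult_le_compat_l; [lra|apply Rinv_le_contravar; lra]).
  apply Rmult_le_compat; [lra| |lra|].
    left; apply Rinv_0_lt_compat, pow_lt, HM0.
  apply Rinv_le_contravar; [apply pow_lt; lra|apply pow_incr; lra].
Qed.

Lemma exp_lmain (m : R) : 1 <= m ->
  exp (lmain m) = exp (PI * sqrt m) * (PI * sqrt m - 1) / sqrt m ^ 3.
Proof.
intros Hm; pose proof PI_gt.
assert (Hw : 1 <= sqrt m) by (rewrite <- sqrt_1; apply sqrt_le_1_alt, Hm).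
assert (0 < PI * sqrt m - 1) by nra.
assert (E : exp (3 * ln (sqrt m)) = sqrt m ^ 3).
  replace 3 with (INR 3) by (simpl; ring); rewrite exp_nat, exp_ln by lra; reflexivity.
unfold lmain, Rminus; rewrite !exp_plus, exp_Ropp, E, exp_ln by lra; reflexivity.
Qed.

(** With t = PI sqrt m, the decaying part of [ffun_closed] is exp (- 2 t) (t + 1) / (t - 1) relative
    to the growing one, and t >= 3 makes the quotient at most 2. *)
Lemma ffun_lmain (m : R) : 1 <= m ->
  exp (lmain m) / 4 <= ffun m <= exp (lmain m) / 4 * (1 + 2 * exp (- (2 * (PI * sqrt m)))).
Proof.
intros Hm; pose proof PI_gt as HP.
assert (Hw : 1 <= sqrt m) by (rewrite <- sqrt_1; apply sqrt_le_1_alt, Hm).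
rewrite exp_lmain, ffun_closed by lra.
set (w := sqrt m) in *; set (t := PI * w).
assert (Em : m = w ^ 2) by (unfold w; rewrite pow2_sqrt; lra).
assert (Ht : 313 / 100 <= t) by (unfold t; nra).
assert (E2 : exp (- t) = exp t * exp (- (2 * t))) by (rewrite <- exp_plus; f_equal; ring).
assert (Pe : 0 < exp (- (2 * t))) by apply exp_pos.
assert (Pt : 0 < exp t) by apply exp_pos.
assert (E : PI / (4 * m) * (exp t * (1 - / t) + exp (- t) * (1 + / t))
  = exp t * (t - 1) / w ^ 3 / 4 * (1 + exp (- (2 * t)) * ((t + 1) / (t - 1)))).
  assert (Ew : w = t / PI) by (unfold t; field; lra).
  rewrite E2, Em; clearbody t; rewrite Ew; field; repeat split; lra.
rewrite E.
assert (Q : 0 < exp t * (t - 1) / w ^ 3 / 4).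
  apply Rdiv_lt_0_compat; [|lra]; apply Rdiv_lt_0_compat; [|apply pow_lt; lra].
  apply Rmult_lt_0_compat; lra.
assert (F : 0 < (t + 1) / (t - 1) <= 2).
  split; [apply Rdiv_lt_0_compat; lra|].
  apply Rmult_le_reg_r with (t - 1); [lra|].
  replace ((t + 1) / (t - 1) * (t - 1)) with (t + 1) by (field; lra); lra.
assert (0 < exp (- (2 * t)) * ((t + 1) / (t - 1)) <= 2 * exp (- (2 * t))).
  split; [apply Rmult_lt_0_compat; lra|nra].
split.
  rewrite <- Rmult_1_r at 1; apply Rmult_le_compat_l; lra.
apply Rmult_le_compat_l; lra.
Qed.

(** * Numerical size of the error from n = 2500 on *)

Lemma exp_ge_cube (y : R) : 0 <= y -> y ^ 3 / 6 <= exp y.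
Proof.
intros Hy; pose proof (exp_ge_taylor y 3 Hy) as H; simpl in H.
assert (0 <= y ^ 2) by apply pow2_ge_0; simpl in *; lra.
Qed.

Lemma exp_le_neg_linear (y : R) : 0 <= y -> 1 - y <= exp (- y).
Proof. intros _; pose proof (exp_ineq1_le (- y)); lra. Qed.

Lemma lmain_lower (x m : R) : 50 <= x -> x ^ 2 - 1 <= m <= x ^ 2 + 2 ->
  29 / 10 * (exp (PI * x) / x ^ 2) <= exp (lmain m).
Proof.
intros Hx Hm; pose proof PI_gt as P1; pose proof PI_lt as P2.
rewrite exp_lmain by nra.
(* sqrt (x^2 - 1) is about x - 1 / (2 x), and 1 / (2 x) <= 1/100. *)
assert (W1 : x - 101 / 10000 <= sqrt m).
  rewrite <- (sqrt_pow2 (x - 101 / 10000)) by lra; apply sqrt_le_1_alt; nra.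
assert (W2 : sqrt m <= 1001 / 1000 * x).
  rewrite <- (sqrt_pow2 (1001 / 1000 * x)) by lra; apply sqrt_le_1_alt; nra.
set (w := sqrt m) in *.
assert (E1 : 967 / 1000 * exp (PI * x) <= exp (PI * w)).
  apply Rle_trans with (exp (PI * x) * exp (- (PI * (101 / 10000)))).
    rewrite Rmult_comm; apply Rmult_le_compat_l; [left; apply exp_pos|].
    pose proof (exp_le_neg_linear (PI * (101 / 10000))); lra.
  rewrite <- exp_plus; apply exp_le; nra.
assert (E2 : 31 / 10 / (1003 / 1000 * x ^ 2) <= (PI * w - 1) / w ^ 3).
  replace ((PI * w - 1) / w ^ 3) with ((PI - / w) / w ^ 2) by (field; lra).
  assert (/ w <= / 49) by (apply Rinv_le_contravar; lra).
  apply Rmult_le_compat; [lra| |lra|].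
    left; apply Rinv_0_lt_compat; nra.
  apply Rinv_le_contravar; [apply pow_lt; lra|nra].
pose proof (exp_pos (PI * x)) as Pe.
assert (Px : 0 < / x ^ 2) by (apply Rinv_0_lt_compat, pow_lt; lra).
unfold Rdiv at 3; rewrite Rmult_assoc; fold ((PI * w - 1) / w ^ 3).
apply Rle_trans with (967 / 1000 * exp (PI * x) * (31 / 10 / (1003 / 1000 * x ^ 2))).
  replace (967 / 1000 * exp (PI * x) * (31 / 10 / (1003 / 1000 * x ^ 2)))
    with (967 / 1000 * (31 / 10) / (1003 / 1000) * (exp (PI * x) / x ^ 2)) by (field; lra).
  apply Rmult_le_compat_r; [unfold Rdiv; nra|lra].
apply Rmult_le_compat; [lra| |exact E1|exact E2].
left; apply Rdiv_lt_0_compat; nra.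
Qed.

(** Pays a prefactor c out of the gap between the decay rate k and the target rate 19/25. *)
Lemma scaled_exp_le (x c k : R) (y : R) : y <= - (k * x) -> c <= exp (k * x - 19 / 25 * x) ->
  c * exp y <= exp (- (19 / 25 * x)).
Proof.
intros Hy Hc; apply Rle_trans with (exp (k * x - 19 / 25 * x) * exp (- (k * x))).
  apply Rle_trans with (exp (k * x - 19 / 25 * x) * exp y).
    apply Rmult_le_compat_r; [left; apply exp_pos|exact Hc].
  apply Rmult_le_compat_l; [left; apply exp_pos|apply exp_le, Hy].
rewrite <- exp_plus; apply exp_le; lra.
Qed.

(** At s = PI / (2 x) the size of the generating function is governed by exp (PI x / 2). The product
    on the minor arc decays slowest relative to it, at rate 61 / (25 PI), and 19/25 is chosen just
    below. It contributes 87, from exp 3 <= 27 and PI < 16/5; the four other terms contribute 1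
    each. *)
Lemma err_bound (x : R) : 50 <= x ->
  err (PI / (2 * x)) <= 91 * exp (- (19 / 25 * x)) * exp (PI * x / 2).
Proof.
intros Hx; pose proof PI_gt as P1; pose proof PI_lt as P2.
assert (Pe : 0 < exp (PI * x / 2)) by apply exp_pos.
apply Rmult_le_reg_r with (exp (- (PI * x / 2))); [apply exp_pos|].
assert (EE : exp (PI * x / 2) * exp (- (PI * x / 2)) = 1).
  rewrite <- exp_plus; replace (PI * x / 2 + - (PI * x / 2)) with 0 by ring; apply exp_0.
rewrite (Rmult_assoc _ (exp (PI * x / 2))), EE, Rmult_1_r.
unfold err, rho_maj.
replace (PI ^ 2 / 4 / (PI / (2 * x))) with (PI * x / 2) by (field; lra).
replace (50 / 169 * PI ^ 2 / (PI / (2 * x))) with (100 / 169 * PI * x) by (field; lra).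
replace (61 / 50 / (PI / (2 * x))) with (61 / 25 * x / PI) by (field; lra).
replace (PI ^ 2 / 4 * (5 / 13 / (PI / (2 * x)))) with (5 / 26 * PI * x) by (field; lra).
replace (4 * PI ^ 2 / (PI / (2 * x)) ^ 2) with (16 * x ^ 2) by (field; lra).
replace (PI / (2 * (PI / (2 * x)))) with x by (field; lra).
replace (11 / (PI / (2 * x))) with (22 * x / PI) by (field; lra).
set (E := exp (- (19 / 25 * x))).
set (h := exp (PI * x / 2)) in *; set (h' := exp (- (PI * x / 2))) in *.
assert (Ph : 0 < h') by apply exp_pos.
replace ((12 / 5 * (PI / (2 * x)) * ((1 + 16 * x ^ 2) * exp (- (100 / 169 * PI * x)) * (PI * h) + x)
    + PI * h * exp (3 - 61 / 25 * x / PI) + PI * exp (5 / 26 * PI * x) + (48 + 22 * x / PI)) * h')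
  with (6 / 5 * PI ^ 2 * (/ x + 16 * x) * exp (- (100 / 169 * PI * x)) * (h * h') + 6 / 5 * PI * h'
    + PI * exp (3 - 61 / 25 * x / PI) * (h * h') + PI * (exp (5 / 26 * PI * x) * h') + (48 + 22 * x / PI) * h')
  by (field; lra).
rewrite EE, !Rmult_1_r.
assert (T1 : 6 / 5 * PI ^ 2 * (/ x + 16 * x) * exp (- (100 / 169 * PI * x)) <= E).
  apply scaled_exp_le with (185 / 100); [nra|].
  apply Rle_trans with (200 * x).
    assert (/ x <= / 50) by (apply Rinv_le_contravar; lra).
    assert (PI ^ 2 <= 1024 / 100) by nra.
    assert (0 < / x) by (apply Rinv_0_lt_compat; lra).
    apply Rle_trans with (6 / 5 * (1024 / 100) * (/ x + 16 * x)); [|lra].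
    apply Rmult_le_compat_r; lra.
  eapply Rle_trans; [|apply exp_ge_cube; lra].
  assert (x ^ 2 >= 2500) by nra.
  assert ((185 / 100 * x - 19 / 25 * x) ^ 3 / 6 = (109 / 100) ^ 3 / 6 * x * x ^ 2) by field; nra.
assert (T2 : 6 / 5 * PI * h' <= E).
  apply scaled_exp_le with (156 / 100); [nra|].
  eapply Rle_trans; [|apply exp_ineq1_le]; lra.
assert (T3 : PI * exp (3 - 61 / 25 * x / PI) <= 87 * E).
  unfold Rminus; rewrite exp_plus.
  assert (H3 : exp 3 <= 27).
    replace 3 with (INR 3 * 1) by (simpl; ring); rewrite exp_nat.
    replace 27 with (3 ^ 3) by ring; apply pow_incr; split; [left; apply exp_pos|apply exp_le_3].
  assert (H4 : exp (- (61 / 25 * x / PI)) <= E).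
    apply exp_le, Ropp_le_contravar.
    apply Rmult_le_reg_r with PI; [lra|].
    replace (61 / 25 * x / PI * PI) with (61 / 25 * x) by (field; lra); nra.
  pose proof (exp_pos 3); pose proof (exp_pos (- (61 / 25 * x / PI))).
  apply Rle_trans with (PI * (27 * E)).
    apply Rmult_le_compat_l; [lra|]; apply Rmult_le_compat; lra.
  assert (0 < E) by apply exp_pos; nra.
assert (T4 : PI * (exp (5 / 26 * PI * x) * h') <= E).
  unfold h'; rewrite <- exp_plus; apply scaled_exp_le with (96 / 100); [nra|].
  eapply Rle_trans; [|apply exp_ineq1_le]; lra.
assert (T5 : (48 + 22 * x / PI) * h' <= E).
  apply scaled_exp_le with (156 / 100); [nra|].
  apply Rle_trans with (48 + 8 * x).
    apply Rplus_le_compat_l; apply Rmult_le_reg_r with PI; [lra|].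
    replace (22 * x / PI * PI) with (22 * x) by (field; lra); nra.
  eapply Rle_trans; [|apply exp_ge_cube; lra].
  assert (x ^ 2 >= 2500) by nra.
  assert ((156 / 100 * x - 19 / 25 * x) ^ 3 / 6 = (8 / 10) ^ 3 / 6 * x * x ^ 2) by field; nra.
lra.
Qed.

Definition eps (x : R) : R := 200 * x ^ 2 * exp (- (19 / 25 * x)).

(** The power x^7 combines x^2 from [eps] and x^5 from the third difference. As x / 50 <= exp (x /
    50 - 1), the comparison reduces to x = 50, where 19/25 x = 38 and exp 38 >= (27/10)^38 is
    enough. *)
Lemma eps_small (x : R) : 50 <= x -> 9 * eps x <= 109 / 100 / x ^ 5.
Proof.
intros Hx; unfold eps.
assert (Hu : x / 50 <= exp (x / 50 - 1)) by (pose proof (exp_ineq1_le (x / 50 - 1)); lra).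
assert (H7 : (x / 50) ^ 7 <= exp (7 * (x / 50 - 1))).
  replace (7 * (x / 50 - 1)) with (INR 7 * (x / 50 - 1)) by (simpl; ring); rewrite exp_nat; apply pow_incr; lra.
assert (He : 27 / 10 <= exp 1).
  pose proof (exp_ge_taylor 1 5 ltac:(lra)) as T; simpl in T; lra.
assert (H38 : (27 / 10) ^ 38 <= exp 38).
  replace 38 with (INR 38 * 1) by (simpl; ring); rewrite exp_nat; apply pow_incr; lra.
assert (H : 1800 * x ^ 7 <= 109 / 100 * exp (19 / 25 * x)).
  replace (x ^ 7) with (50 ^ 7 * (x / 50) ^ 7) by field.
  apply Rle_trans with (1800 * (50 ^ 7 * exp (7 * (x / 50 - 1)))).
    apply Rmult_le_compat_l; [lra|]; apply Rmult_le_compat_l; [lra|exact H7].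
  replace (exp (19 / 25 * x)) with (exp (7 * (x / 50 - 1)) * exp (31 / 50 * x + 7)).
    assert (exp 38 <= exp (31 / 50 * x + 7)) by (apply exp_le; lra).
    pose proof (exp_pos (7 * (x / 50 - 1))).
    assert (1800 * 50 ^ 7 <= 109 / 100 * exp (31 / 50 * x + 7)).
      apply Rle_trans with (109 / 100 * (27 / 10) ^ 38); lra.
    nra.
  rewrite <- exp_plus; f_equal; field.
assert (EE : exp (19 / 25 * x) * exp (- (19 / 25 * x)) = 1).
  rewrite <- exp_plus; replace (19 / 25 * x + - (19 / 25 * x)) with 0 by ring; apply exp_0.
assert (P5 : 0 < x ^ 5) by (apply pow_lt; lra).
apply Rmult_le_reg_r with (x ^ 5); [exact P5|].
replace (109 / 100 / x ^ 5 * x ^ 5) with (109 / 100) by (field; lra).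
apply Rmult_le_compat_r with (r := exp (- (19 / 25 * x))) in H; [|left; apply exp_pos].
rewrite (Rmult_assoc (109 / 100)), EE, Rmult_1_r in H.
eapply Rle_trans; [|exact H]; right; ring.
Qed.

(** The saddle point is that of x and not of m, which costs exp (2 s) <= 107/100. With 91 from
    [err_bound] and 10/29 from [lmain_lower] the error is at most 34 x^2 z E, plus z E / 2 from the
    decaying exponential; four times the total stays below 200 x^2 z E. *)
Lemma opcount_lmain (o : nat -> nat -> R) (x la : R) (K m : nat) : 50 <= x -> 0 < la ->
  Rabs (o K m - la * ffun (INR m)) * exp (- (INR m * (PI / (2 * x)))) <= la * err (PI / (2 * x)) ->
  x ^ 2 - 1 <= INR m <= x ^ 2 + 2 ->
  Rabs (o K m - la / 4 * exp (lmain (INR m))) <= eps x * (la / 4 * exp (lmain (INR m))).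
Proof.
intros Hx Pla H Hm; pose proof PI_gt as P1; pose proof PI_lt as P2.
set (s := PI / (2 * x)) in *; set (M := INR m) in *; set (E := exp (lmain M)).
pose proof (err_bound x Hx) as He; fold s in He.
pose proof (lmain_lower x M Hx Hm) as HE; fold E in HE.
assert (Hm1 : 1 <= M) by nra.
destruct (ffun_lmain M Hm1) as [F1 F2]; fold E in F1, F2.
set (z := exp (- (19 / 25 * x))) in *.
assert (Pz : 0 < z) by apply exp_pos.
assert (PE : 0 < E) by apply exp_pos.
assert (Ph : 0 < exp (PI * x)) by apply exp_pos.
assert (Px : 2500 <= x ^ 2) by nra.
assert (Hs : exp (M * s) <= 107 / 100 * exp (PI * x / 2)).
  apply Rle_trans with (exp (PI * x / 2) * exp (8 / 125)).
    rewrite <- exp_plus; apply exp_le.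
    apply Rle_trans with ((x ^ 2 + 2) * s).
      apply Rmult_le_compat_r; [left; apply Rdiv_lt_0_compat; lra|lra].
    unfold s; replace ((x ^ 2 + 2) * (PI / (2 * x))) with (PI * x / 2 + PI / x) by (field; lra).
    apply Rplus_le_compat_l, Rmult_le_reg_r with x; [lra|].
    replace (PI / x * x) with PI by (field; lra); lra.
  rewrite Rmult_comm; apply Rmult_le_compat_r; [left; apply exp_pos|].
  pose proof (exp_le_neg_linear (8 / 125) ltac:(lra)) as L; rewrite exp_Ropp in L.
  pose proof (exp_pos (8 / 125)) as Q.
  apply Rmult_le_compat_r with (r := exp (8 / 125)) in L; [|lra].
  rewrite Rinv_l in L by lra; lra.
assert (Hd : Rabs (o K m - la * ffun M) <= la * (err s * exp (M * s))).
  apply Rmult_le_compat_r with (r := exp (M * s)) in H; [|left; apply exp_pos].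
  rewrite Rmult_assoc, <- exp_plus in H.
  replace (- (M * s) + M * s) with 0 in H by ring; rewrite exp_0, Rmult_1_r in H; lra.
assert (Eh : exp (PI * x / 2) * exp (PI * x / 2) = exp (PI * x)).
  rewrite <- exp_plus; f_equal; field.
assert (Hx2 : exp (PI * x) <= 10 / 29 * x ^ 2 * E).
  apply Rmult_le_compat_l with (r := 10 / 29 * x ^ 2) in HE; [|lra].
  replace (10 / 29 * x ^ 2 * (29 / 10 * (exp (PI * x) / x ^ 2))) with (exp (PI * x)) in HE by (field; lra).
  exact HE.
assert (B1 : err s * exp (M * s) <= 34 * x ^ 2 * z * E).
  apply Rle_trans with (91 * z * exp (PI * x / 2) * (107 / 100 * exp (PI * x / 2))).
    apply Rle_trans with (91 * z * exp (PI * x / 2) * exp (M * s)).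
      apply Rmult_le_compat_r; [left; apply exp_pos|exact He].
    apply Rmult_le_compat_l; [|exact Hs].
    apply Rmult_le_pos; [lra|left; apply exp_pos].
  replace (91 * z * exp (PI * x / 2) * (107 / 100 * exp (PI * x / 2)))
    with (91 * (107 / 100) * z * (exp (PI * x / 2) * exp (PI * x / 2))) by ring.
  rewrite Eh.
  apply Rle_trans with (91 * (107 / 100) * z * (10 / 29 * x ^ 2 * E)).
    apply Rmult_le_compat_l; [nra|exact Hx2].
  assert (0 < x ^ 2 * z * E) by (repeat apply Rmult_lt_0_compat; lra).
  nra.
assert (B2 : exp (- (2 * (PI * sqrt M))) <= z).
  apply exp_le.
  assert (W1 : x - 1 <= sqrt M).
    rewrite <- (sqrt_pow2 (x - 1)) by lra; apply sqrt_le_1_alt; nra.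
  nra.
replace (o K m - la / 4 * E) with ((o K m - la * ffun M) + la * (ffun M - E / 4)) by field.
eapply Rle_trans; [apply Rabs_triang|].
rewrite (Rabs_pos_eq (la * _)) by (apply Rmult_le_pos; lra).
assert (B3 : ffun M - E / 4 <= E / 4 * (2 * z)).
  assert (E / 4 * (2 * exp (- (2 * (PI * sqrt M)))) <= E / 4 * (2 * z)) by (apply Rmult_le_compat_l; lra).
  lra.
assert (B4 : la * (ffun M - E / 4) <= la * (E / 4 * (2 * z))) by (apply Rmult_le_compat_l; lra).
assert (B5 : la * (err s * exp (M * s)) <= la * (34 * x ^ 2 * z * E)) by (apply Rmult_le_compat_l; lra).
unfold eps; fold z.
assert (B6 : la * (E * z) * 1 <= la * (E * z) * x ^ 2).
  apply Rmult_le_compat_l; [|lra].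
  apply Rmult_le_pos; [lra|apply Rmult_le_pos; lra].
assert (0 <= la * (E * z) * x ^ 2).
  apply Rmult_le_pos; [apply Rmult_le_pos; [lra|apply Rmult_le_pos; lra]|lra].
lra.
Qed.

(** The relative errors of the four values compound to ((1 + e) / (1 - e))^4, which is 1 + 8 e to
    first order; the 9 absorbs the higher orders. *)
Lemma quartic_gap (e : R) : 0 < e <= / 50 -> (1 + e) ^ 4 < (1 + 9 * e) * (1 - e) ^ 4.
Proof.
intros He.
assert (H1 : (1 + e) ^ 4 <= 1 + 4 * e + 7 * e ^ 2).
  replace ((1 + e) ^ 4) with (1 + 4 * e + 6 * e ^ 2 + e ^ 2 * (4 * e + e ^ 2)) by ring.
  assert (e ^ 2 * (4 * e + e ^ 2) <= e ^ 2 * 1) by (apply Rmult_le_compat_l; nra); lra.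
assert (H2 : 1 - 4 * e <= (1 - e) ^ 4).
  replace ((1 - e) ^ 4) with (1 - 4 * e + e ^ 2 * (6 - 4 * e + e ^ 2)) by ring.
  assert (0 <= e ^ 2 * (6 - 4 * e + e ^ 2)) by (apply Rmult_le_pos; nra); lra.
nra.
Qed.

Lemma opcount_ineq (o : nat -> nat -> R) (n : nat) : opcount o -> (2500 <= n)%nat ->
  exists K, (n + 2 <= K)%nat /\
    o K (n - 1)%nat * o K (n + 1)%nat ^ 3 < o K n ^ 3 * o K (n + 2)%nat.
Proof.
intros Ho Hn; pose proof PI_gt as P1; pose proof PI_lt as P2.
set (x := sqrt (INR n)).
assert (HN : 2500 <= INR n).
  replace 2500 with (INR 2500) by (rewrite INR_IZR_INZ; reflexivity); apply le_INR, Hn.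
assert (Hx : 50 <= x).
  unfold x; rewrite <- (sqrt_pow2 50) by lra; apply sqrt_le_1_alt; lra.
assert (Ex : x ^ 2 = INR n) by (unfold x; apply pow2_sqrt; lra).
set (s := PI / (2 * x)).
assert (Hs : 0 < s <= / 30).
  split; [apply Rdiv_lt_0_compat; lra|].
  apply Rmult_le_reg_r with (2 * x); [lra|].
  unfold s; replace (PI / (2 * x) * (2 * x)) with PI by (field; lra); lra.
assert (Hrho : rho_maj s <= / 10).
  unfold rho_maj, s; replace (50 / 169 * PI ^ 2 / (PI / (2 * x))) with (100 / 169 * PI * x) by (field; lra).
  rewrite exp_Ropp; apply Rinv_le_contravar; [lra|].
  eapply Rle_trans; [|apply exp_ineq1_le]; nra.
(* One application serves all four indices, so they share K and la; this is what lets la cancel. *)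
destruct (opcount_approx o s (n + 2) Ho Hs Hrho) as [K [la [HK [Pla H]]]].
exists K; split; [exact HK|].
assert (G : forall m : nat, x ^ 2 - 1 <= INR m <= x ^ 2 + 2 ->
  la / 4 * exp (lmain (INR m)) * (1 - eps x) <= o K m <= la / 4 * exp (lmain (INR m)) * (1 + eps x)).
  intros m Hm; pose proof (opcount_lmain o x la K m Hx Pla (H m) Hm) as B.
  apply Rabs_le_between in B; lra.
assert (Ha : INR (n - 1) = x ^ 2 - 1) by (rewrite minus_INR, Ex by lia; reflexivity).
assert (Hc : INR (n + 1) = x ^ 2 - 1 + 2) by (rewrite plus_INR, Ex; simpl; ring).
assert (Hd : INR (n + 2) = x ^ 2 - 1 + 3) by (rewrite plus_INR, Ex; simpl; ring).
assert (Hb : INR n = x ^ 2 - 1 + 1) by (rewrite Ex; ring).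
pose proof (G (n - 1)%nat ltac:(lra)) as Ga; pose proof (G n ltac:(lra)) as Gb.
pose proof (G (n + 1)%nat ltac:(lra)) as Gc; pose proof (G (n + 2)%nat ltac:(lra)) as Gd.
rewrite Ha in Ga; rewrite Hb in Gb; rewrite Hc in Gc; rewrite Hd in Gd.
set (a := x ^ 2 - 1) in *.
assert (Pe : 0 < eps x) by (unfold eps; apply Rmult_lt_0_compat; [nra|apply exp_pos]).
pose proof (eps_small x Hx) as Es.
assert (P5 : 109 <= x ^ 5).
  apply Rle_trans with (50 ^ 5); [lra|apply pow_incr; lra].
assert (Es2 : eps x <= / 50).
  assert (109 / 100 / x ^ 5 <= 109 / 100 / 109) by (apply Rmult_le_compat_l; [lra|apply Rinv_le_contravar; lra]).
  lra.
assert (D : 9 * eps x <= lmain (a + 3) - 3 * lmain (a + 2) + 3 * lmain (a + 1) - lmain a).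
  (* For x >= 50, 2001/2000 x is at least sqrt (x^2 + 2), and its fifth power costs less than the
     step from 11/10 to 109/100. *)
  eapply Rle_trans; [|apply (lmain_third_diff a (2001 / 2000 * x)); unfold a; nra].
  eapply Rle_trans; [exact Es|].
  replace (11 / 10 / (2001 / 2000 * x) ^ 5) with (11 / 10 / (2001 / 2000) ^ 5 * / x ^ 5) by (field; lra).
  apply Rmult_le_compat_r; [left; apply Rinv_0_lt_compat; lra|].
  apply Rmult_le_reg_r with ((2001 / 2000) ^ 5); [lra|].
  replace (11 / 10 / (2001 / 2000) ^ 5 * (2001 / 2000) ^ 5) with (11 / 10) by field; lra.
set (e := eps x) in *.
set (Ea := exp (lmain a)) in *; set (Eb := exp (lmain (a + 1))) in *.
set (Ec := exp (lmain (a + 2))) in *; set (Ed := exp (lmain (a + 3))) in *.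
assert (PEa : 0 < Ea) by apply exp_pos; assert (PEb : 0 < Eb) by apply exp_pos.
assert (PEc : 0 < Ec) by apply exp_pos; assert (PEd : 0 < Ed) by apply exp_pos.
assert (DE : Ea * Ec ^ 3 * (1 + 9 * e) <= Eb ^ 3 * Ed).
  replace (Eb ^ 3 * Ed) with
    (Ea * Ec ^ 3 * exp (lmain (a + 3) - 3 * lmain (a + 2) + 3 * lmain (a + 1) - lmain a)).
    apply Rmult_le_compat_l.
      apply Rmult_le_pos; [lra|apply pow_le; lra].
    eapply Rle_trans; [|apply exp_ineq1_le]; lra.
  unfold Ea, Eb, Ec, Ed; rewrite <- !exp_nat, <- !exp_plus; f_equal; simpl; ring.
set (A := la / 4) in *.
assert (PA : 0 < A) by (unfold A; lra).
assert (U : o K (n - 1)%nat * o K (n + 1)%nat ^ 3 <= A ^ 4 * (Ea * Ec ^ 3) * (1 + e) ^ 4).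
  replace (A ^ 4 * (Ea * Ec ^ 3) * (1 + e) ^ 4) with (A * Ea * (1 + e) * (A * Ec * (1 + e)) ^ 3) by ring.
  apply Rmult_le_compat; [apply Ho|apply pow_le, Ho|apply Ga|].
  apply pow_incr; split; [apply Ho|apply Gc].
assert (L : A ^ 4 * (Eb ^ 3 * Ed) * (1 - e) ^ 4 <= o K n ^ 3 * o K (n + 2)%nat).
  replace (A ^ 4 * (Eb ^ 3 * Ed) * (1 - e) ^ 4) with ((A * Eb * (1 - e)) ^ 3 * (A * Ed * (1 - e))) by ring.
  assert (0 <= A * Eb * (1 - e)) by (repeat apply Rmult_le_pos; lra).
  apply Rmult_le_compat; [apply pow_le; lra|repeat apply Rmult_le_pos; lra| |apply Gd].
  apply pow_incr; split; [lra|apply Gb].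
eapply Rle_lt_trans; [exact U|]; eapply Rlt_le_trans; [|exact L].
assert (PQ : 0 < A ^ 4 * (Ea * Ec ^ 3)).
  apply Rmult_lt_0_compat; [apply pow_lt, PA|apply Rmult_lt_0_compat; [exact PEa|apply pow_lt, PEc]].
apply Rlt_le_trans with (A ^ 4 * (Ea * Ec ^ 3) * ((1 + 9 * e) * (1 - e) ^ 4)).
  apply Rmult_lt_compat_l; [exact PQ|apply quartic_gap; lra].
replace (A ^ 4 * (Ea * Ec ^ 3) * ((1 + 9 * e) * (1 - e) ^ 4))
  with (A ^ 4 * (1 - e) ^ 4 * (Ea * Ec ^ 3 * (1 + 9 * e))) by ring.
replace (A ^ 4 * (Eb ^ 3 * Ed) * (1 - e) ^ 4) with (A ^ 4 * (1 - e) ^ 4 * (Eb ^ 3 * Ed)) by ring.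
apply Rmult_le_compat_l; [|exact DE].
apply Rmult_le_pos; apply pow_le; lra.
Qed.

(** * Gauss's recurrence *)

Definition theta (n : nat) (r : R) : R :=
  1 + 2 * rfsum (fun j => (-1) ^ S j * r ^ (S j * S j)) n.

Definition shanks_term (n s : nat) (r : R) : R :=
  (-1) ^ s * (2 / (1 + r ^ s)) * gfR s r * r ^ (s * n).

Lemma rpow_lt_1 (r : R) (n : nat) : 0 < r < 1 -> 0 < r ^ n <= 1.
Proof.
intros H; split; [apply pow_lt; lra|rewrite <- (pow1 n); apply pow_incr; lra].
Qed.

(** From n to n + 1, [shanks] multiplies its left side by a new factor of [gfR] but the term s of
    its right side by r^s. This sums the discrepancy; at p = n it matches the new square in [theta]
    and the new last term. *)
Lemma shanks_tele (n p : nat) (r : R) : 0 < r < 1 ->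
  rfsum (fun s => shanks_term (S n) s r * ((1 + r ^ S n) / (1 - r ^ S n) - r ^ s)) (S p)
  = (-1) ^ p * (2 * gfR p r * r ^ (S p * S n) / (1 - r ^ S n)).
Proof.
intros Hr; pose proof (pow_S_bounds r n Hr) as Hn.
induction p as [|p IH].
  unfold shanks_term; cbn [rfsum gfR]; rewrite Nat.mul_0_l, Nat.mul_1_l, !pow_O; field; lra.
cbn [rfsum] in *; rewrite IH; unfold shanks_term; cbn [gfR].
pose proof (pow_S_bounds r p Hr) as Hp.
replace (r ^ (S (S p) * S n)) with (r ^ (S p * S n) * r ^ S n)
  by (rewrite <- pow_add; f_equal; lia).
replace ((-1) ^ S p) with (- (-1) ^ p) by (simpl; ring).
field; lra.
Qed.

(* Shanks's finite form of Gauss's identity [theta * gf = 1]. *)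
Lemma shanks (n : nat) (r : R) : 0 < r < 1 ->
  theta n r * gfR n r = rfsum (fun s => shanks_term (S n) s r) (S n).
Proof.
intros Hr; induction n as [|n IH].
  unfold theta, shanks_term; simpl; field.
pose proof (pow_S_bounds r n Hr) as Hn.
assert (E : theta (S n) r = theta n r + 2 * ((-1) ^ S n * r ^ (S n * S n))).
  unfold theta; cbn [rfsum]; ring.
rewrite E; cbn [gfR].
replace ((theta n r + 2 * ((-1) ^ S n * r ^ (S n * S n))) * (gfR n r * ((1 + r ^ S n) / (1 - r ^ S n))))
  with (theta n r * gfR n r * ((1 + r ^ S n) / (1 - r ^ S n))
    + 2 * ((-1) ^ S n * r ^ (S n * S n)) * (gfR n r * ((1 + r ^ S n) / (1 - r ^ S n)))) by ring.
rewrite IH, <- rfsum_scal_r.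
pose proof (shanks_tele n n r Hr) as T.
change (rfsum (fun s => shanks_term (S (S n)) s r) (S (S n)))
  with (rfsum (fun s => shanks_term (S (S n)) s r) (S n) + shanks_term (S (S n)) (S n) r).
rewrite (rfsum_ext (fun s => shanks_term (S (S n)) s r)
  (fun s => shanks_term (S n) s r * ((1 + r ^ S n) / (1 - r ^ S n))
    - shanks_term (S n) s r * ((1 + r ^ S n) / (1 - r ^ S n) - r ^ s))).
2:{ intros s _; unfold shanks_term.
    replace (r ^ (s * S (S n))) with (r ^ (s * S n) * r ^ s) by (rewrite <- pow_add; f_equal; lia).
    ring. }
assert (Em : forall u v m, rfsum (fun k => u k - v k) m = rfsum u m - rfsum v m).
  intros u v m; induction m as [|m IHm]; simpl; [|rewrite IHm]; ring.
rewrite Em, T; unfold shanks_term; cbn [gfR].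
replace (r ^ (S n * S (S n))) with (r ^ (S n * S n) * r ^ S n) by (rewrite <- pow_add; f_equal; lia).
replace ((-1) ^ S n) with (- (-1) ^ n) by (simpl; ring).
field; lra.
Qed.

Lemma gfR_le (n : nat) (r : R) : 0 < r <= / 2 -> gfR n r <= 3 ^ n.
Proof.
intros Hr; induction n as [|n IH]; cbn [gfR]; [simpl; lra|].
assert (Hr1 : 0 < r < 1) by lra.
pose proof (pow_S_bounds r n Hr1) as Hn; pose proof (gfR_pos n r Hr1).
assert (Hh : r ^ S n <= / 2).
  pose proof (rpow_lt_1 r n Hr1); simpl; nra.
replace (3 ^ S n) with (3 ^ n * 3) by (simpl; ring).
apply Rmult_le_compat; [lra|left; apply Rdiv_lt_0_compat; lra|exact IH|].
apply Rmult_le_reg_r with (1 - r ^ S n); [lra|].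
replace ((1 + r ^ S n) / (1 - r ^ S n) * (1 - r ^ S n)) with (1 + r ^ S n) by (field; lra); lra.
Qed.

(** In [shanks] the term s = 0 is 1, and each later one contains r^(s (n + 1)). *)
Lemma theta_gf_near_1 (n : nat) : exists C, forall r, 0 < r <= / 2 ->
  Rabs (theta n r * gfR n r - 1) <= C * r ^ S n.
Proof.
exists (rfsum (fun s => 2 * 3 ^ S s) n); intros r Hr.
assert (Hr1 : 0 < r < 1) by lra.
rewrite shanks by exact Hr1.
replace (S n) with (1 + n)%nat by lia; rewrite rfsum_split.
replace (rfsum (fun s => shanks_term (1 + n) s r) 1) with 1.
2:{ unfold shanks_term; simpl; field. }
match goal with |- Rabs (1 + ?u - 1) <= _ => replace (1 + u - 1) with u by ring end.
rewrite <- rfsum_scal_r.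
assert (Ra : forall u m, Rabs (rfsum u m) <= rfsum (fun k => Rabs (u k)) m).
  intros u m; induction m as [|m IH]; simpl; [rewrite Rabs_R0; lra|].
  eapply Rle_trans; [apply Rabs_triang|lra].
eapply Rle_trans; [apply Ra|]; apply rfsum_le; intros s _; unfold shanks_term.
pose proof (gfR_le (1 + s) r Hr) as G; pose proof (gfR_pos (1 + s) r Hr1) as G0.
pose proof (rpow_lt_1 r (1 + s) Hr1) as P1; pose proof (rpow_lt_1 r ((1 + s) * (1 + n)) Hr1) as P2.
rewrite !Rabs_mult, pow_1_abs, Rmult_1_l.
rewrite (Rabs_pos_eq (gfR _ _)), (Rabs_pos_eq (r ^ _)), Rabs_pos_eq by
  (try lra; left; apply Rdiv_lt_0_compat; lra).
assert (D : 0 < 2 / (1 + r ^ (1 + s)) <= 2).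
  split; [apply Rdiv_lt_0_compat; lra|].
  replace 2 with (2 / 1) at 2 by field; apply Rmult_le_compat_l; [lra|apply Rinv_le_contravar; lra].
assert (P3 : r ^ ((1 + s) * (1 + n)) <= r ^ (1 + n)).
  replace ((1 + s) * (1 + n))%nat with ((1 + n) + s * (1 + n))%nat by lia; rewrite pow_add.
  pose proof (rpow_lt_1 r (s * (1 + n)) Hr1); pose proof (rpow_lt_1 r (1 + n) Hr1); nra.
change (3 ^ S s) with (3 ^ (1 + s)).
apply Rmult_le_compat; [apply Rmult_le_pos; lra|lra| |exact P3].
apply Rmult_le_compat; lra.
Qed.

Lemma coef_zero (N : nat) : forall (t : nat -> R) (C : R),
  ex_series (fun m => Rabs (t m) * (/ 2) ^ m) ->
  (forall r, 0 < r <= / 2 -> Rabs (Series (fun m => t m * r ^ m)) <= C * r ^ N) ->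
  forall m, (m < N)%nat -> t m = 0.
Proof.
induction N as [|N IH]; intros t C St Ht m Hm; [lia|].
assert (Sr : forall r, 0 < r <= / 2 -> ex_series (fun m => t m * r ^ m)).
  intros r Hr; apply ex_series_dom with (2 := St); intros k.
  rewrite Rabs_mult; apply Rmult_le_compat_l; [apply Rabs_pos|].
  rewrite Rabs_pos_eq by (apply pow_le; lra); apply pow_incr; lra.
assert (St1 : ex_series (fun m => Rabs (t (S m)) * (/ 2) ^ m)).
  apply ex_series_ext with (fun m => 2 * (Rabs (t (S m)) * (/ 2) ^ S m)).
    intros k; match goal with |- ?a = ?b => change (@eq R a b) end; simpl; field.
  apply ex_series_Rscal, (ex_series_shift (fun m => Rabs (t m) * (/ 2) ^ m) 1), St.
set (B := Series (fun m => Rabs (t (S m)) * (/ 2) ^ m)).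
assert (E : forall r, 0 < r <= / 2 ->
  Series (fun m => t m * r ^ m) = t O + r * Series (fun m => t (S m) * r ^ m)).
  intros r Hr; rewrite Series_incr_1 by (apply Sr, Hr); rewrite <- Series_scal_l.
  f_equal; [simpl; ring|apply Series_ext; intros k; simpl; ring].
assert (HB : forall r, 0 < r <= / 2 -> Rabs (Series (fun m => t (S m) * r ^ m)) <= B).
  intros r Hr.
  assert (D : forall k, Rabs (t (S k) * r ^ k) <= Rabs (t (S k)) * (/ 2) ^ k).
    intros k; rewrite Rabs_mult; apply Rmult_le_compat_l; [apply Rabs_pos|].
    rewrite Rabs_pos_eq by (apply pow_le; lra); apply pow_incr; lra.
  eapply Rle_trans; [apply Series_Rabs|].
    apply ex_series_dom with (2 := St1); intros k; rewrite Rabs_Rabsolu; apply D.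
  apply Series_le; [intros k; split; [apply Rabs_pos|apply D]|exact St1].
assert (T0 : t O = 0).
  destruct (Req_dec (t O) 0) as [H0|H0]; [exact H0|exfalso].
  assert (P0 : 0 < Rabs (t O)) by (apply Rabs_pos_lt, H0).
  assert (B0 : 0 <= B) by (eapply Rle_trans; [apply Rabs_pos|apply (HB (/ 2)); lra]).
  (* The bounds give |t 0| <= r (|C| + B); the r built from D makes the right side less than |t 0| /
     2. *)
  set (D := Rabs C + B + Rabs (t O) + 1).
  assert (PD : Rabs (t O) < D) by (unfold D; pose proof (Rabs_pos C); lra).
  set (r := Rabs (t O) / (2 * D)).
  assert (Hr : 0 < r <= / 2).
    split; [apply Rdiv_lt_0_compat; lra|].
    apply Rmult_le_reg_r with (2 * D); [lra|].
    unfold r; replace (Rabs (t O) / (2 * D) * (2 * D)) with (Rabs (t O)) by (field; lra); lra.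
  specialize (Ht r Hr); rewrite E in Ht by exact Hr; specialize (HB r Hr).
  set (X := Series (fun m => t (S m) * r ^ m)) in *.
  assert (H1 : Rabs (t O) <= Rabs (t O + r * X) + r * Rabs X).
    replace (t O) with ((t O + r * X) + - (r * X)) at 1 by ring.
    eapply Rle_trans; [apply Rabs_triang|]; rewrite Rabs_Ropp, (Rabs_mult r), (Rabs_pos_eq r) by lra; lra.
  assert (H2 : C * r ^ S N <= Rabs C * r).
    pose proof (rpow_lt_1 r N ltac:(lra)) as Hp; pose proof (Rle_abs C); pose proof (Rabs_pos C).
    simpl; apply Rle_trans with (Rabs C * (r * r ^ N)); [apply Rmult_le_compat_r; [nra|lra]|].
    apply Rmult_le_compat_l; [lra|nra].
  assert (H3 : r * Rabs X <= r * B) by (apply Rmult_le_compat_l; lra).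
  assert (H4 : r * D = Rabs (t O) / 2) by (unfold r; field; lra).
  assert (H5 : r * (Rabs C + B) < r * D) by (apply Rmult_lt_compat_l; unfold D in *; lra).
  lra.
destruct m as [|m]; [exact T0|].
apply (IH (fun m => t (S m)) C St1); [|lia].
intros r Hr; specialize (Ht r Hr); rewrite E, T0, Rplus_0_l, Rabs_mult, (Rabs_pos_eq r) in Ht by lra.
apply Rmult_le_reg_l with r; [lra|]; simpl in Ht; lra.
Qed.

Definition rshift (k : nat) (u : nat -> R) (n : nat) : R :=
  if Nat.ltb n k then 0 else u (n - k)%nat.

Lemma Series_rshift (k : nat) (u : nat -> R) (r : R) : ex_series (fun n => u n * r ^ n) ->
  ex_series (fun n => rshift k u n * r ^ n) /\
  Series (fun n => rshift k u n * r ^ n) = r ^ k * Series (fun n => u n * r ^ n).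
Proof.
intros Hu.
assert (E : forall n, rshift k u (k + n)%nat * r ^ (k + n) = r ^ k * (u n * r ^ n)).
  intros n; unfold rshift; replace (Nat.ltb (k + n) k) with false.
    rewrite pow_add; replace (k + n - k)%nat with n by lia; ring.
  symmetry; apply Nat.ltb_ge; lia.
assert (S1 : ex_series (fun n => rshift k u n * r ^ n)).
  apply (ex_series_incr_n _ k), ex_series_ext with (fun n => r ^ k * (u n * r ^ n)).
    intros n; symmetry; apply E.
  apply ex_series_Rscal, Hu.
split; [exact S1|].
rewrite (Series_rfsum _ k S1), (Series_ext _ _ E), Series_scal_l.
rewrite (rfsum_ext _ (fun _ => 0)).
  replace (rfsum (fun _ => 0) k) with 0; [ring|].
  clear; induction k as [|k IH]; simpl; lra.
intros n Hn; unfold rshift; replace (Nat.ltb n k) with true; [ring|].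
symmetry; apply Nat.ltb_lt, Hn.
Qed.

Lemma opcount_Series (o : nat -> nat -> R) (r : R) (K : nat) : opcount o -> 0 < r < 1 ->
  Series (fun n => o K n * r ^ n) = gfR K r.
Proof.
intros Ho Hr.
assert (Hq : 0 < Cmod r < 1) by (rewrite Cmod_R, Rabs_pos_eq; lra).
pose proof (opcount_gf o r K Ho Hq) as E; rewrite gf_gfR in E by exact Hr.
apply (f_equal Re) in E; change (Re (RtoC (gfR K r))) with (gfR K r) in E; rewrite <- E.
unfold csum; simpl; apply Series_ext; intros n; rewrite <- RtoC_pow; simpl; ring.
Qed.

(** By [theta_gf_near_1], theta n * gfR n - 1 is of order r^(n+1), so [coef_zero] kills its
    coefficients up to n; the one of index m >= 1 is the recurrence. *)
Lemma gauss_recurrence (o : nat -> nat -> R) (n m : nat) : opcount o -> (1 <= m <= n)%nat ->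
  o n m = - (2 * rfsum (fun j => (-1) ^ S j * rshift (S j * S j) (o n) m) n).
Proof.
intros Ho Hm.
set (th := fun p k => o n k + 2 * rfsum (fun j => (-1) ^ S j * rshift (S j * S j) (o n) k) p).
assert (Hth : forall p r, 0 < r < 1 ->
  ex_series (fun k => th p k * r ^ k) /\ Series (fun k => th p k * r ^ k) = theta p r * gfR n r).
  intros p r Hr; pose proof (opcount_summable o r n Ho Hr) as So.
  pose proof (opcount_Series o r n Ho Hr) as Eo.
  induction p as [|p [IH1 IH2]].
    split.
      apply ex_series_ext with (2 := So); intros k; unfold th; simpl.
      match goal with |- ?a = ?b => change (@eq R a b) end; ring.
    rewrite <- Eo; unfold theta; simpl; rewrite Rmult_0_r, Rplus_0_r, Rmult_1_l.
    apply Series_ext; intros k; unfold th; simpl; ring.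
  destruct (Series_rshift (S p * S p) (o n) r So) as [R1 R2].
  assert (Ek : forall k, th (S p) k * r ^ k
    = th p k * r ^ k + 2 * (-1) ^ S p * (rshift (S p * S p) (o n) k * r ^ k)).
    intros k; unfold th; cbn [rfsum]; ring.
  split.
    apply ex_series_ext with (fun k => th p k * r ^ k + 2 * (-1) ^ S p * (rshift (S p * S p) (o n) k * r ^ k)).
      intros k; symmetry; apply Ek.
    apply (ex_series_plus (fun k => th p k * r ^ k)); [exact IH1|apply ex_series_Rscal, R1].
  rewrite (Series_ext _ _ Ek), Series_plus, Series_scal_l, R2, IH2, Eo
    by (try apply ex_series_Rscal; assumption).
  unfold theta; cbn [rfsum]; ring.
set (t := fun k => match k with O => th n O - 1 | _ => th n k end).
assert (Et : forall r, 0 < r < 1 -> ex_series (fun k => t k * r ^ k) /\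
  Series (fun k => t k * r ^ k) = theta n r * gfR n r - 1).
  intros r Hr; destruct (Hth n r Hr) as [S1 E1].
  assert (S2 : ex_series (fun k => t (S k) * r ^ S k)).
    apply (ex_series_incr_1 (fun k => th n k * r ^ k)), S1.
  assert (S3 : ex_series (fun k => t k * r ^ k)) by (apply ex_series_incr_1, S2).
  split; [exact S3|].
  rewrite <- E1, (Series_incr_1 _ S3), (Series_incr_1 _ S1); simpl; ring.
(* The terms at 3/4 tend to 0, hence are bounded, and the ratio 2/3 gives absolute convergence at
   1/2. *)
assert (Sa : ex_series (fun k => Rabs (t k) * (/ 2) ^ k)).
  apply ex_series_ext with (fun k => Rabs (t k * (3 / 4) ^ k) * (2 / 3) ^ k).
    intros k; rewrite Rabs_mult, (Rabs_pos_eq ((3 / 4) ^ k)) by (apply pow_le; lra).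
    rewrite Rmult_assoc, <- Rpow_mult_distr; do 2 f_equal; field.
  destruct (Et (3 / 4) ltac:(lra)) as [S1 _].
  apply ex_series_lim_0 in S1.
  destruct (filterlim_bounded (K := R_AbsRing) (V := R_NormedModule) _ (ex_intro _ 0 S1)) as [Bd HBd].
  apply ex_series_dom with (fun k => Bd * (2 / 3) ^ k).
    intros k; rewrite Rabs_mult, Rabs_Rabsolu, (Rabs_pos_eq ((2 / 3) ^ k)) by (apply pow_le; lra).
    apply Rmult_le_compat_r; [apply pow_le; lra|apply HBd].
  apply ex_series_Rscal, ex_series_geom; rewrite Rabs_pos_eq; lra.
destruct (theta_gf_near_1 n) as [C HC].
assert (Z : t m = 0).
  apply (coef_zero (S n) t C Sa); [|lia].
  intros r Hr; destruct (Et r ltac:(lra)) as [_ ->]; apply HC, Hr.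
destruct m as [|m]; [lia|]; unfold t, th in Z; lra.
Qed.

(* A table is a list [u (n - 1); ...; u 0]; the terms [u (n - k ^ 2)] of the recurrence sit at
   positions [k ^ 2 - 1], reached by successive skips of 3, 5, 7, ... *)
Fixpoint square_sum (fuel : nat) (l : list Z) (step : nat) (plus : bool) (acc : Z) : Z :=
  match fuel, l with
  | S fuel, cons x _ =>
      square_sum fuel (skipn step l) (S (S step)) (negb plus) (if plus then acc + x else acc - x)%Z
  | _, _ => acc
  end.

Fixpoint gauss_table (n : nat) : list Z :=
  match n with
  | O => cons 1%Z nil
  | S n => let l := gauss_table n in cons (2 * square_sum (length l) l 3 true 0)%Z l
  end.

(* Only the 60 leading bits are compared, rounded in the safe direction. *)
Definition scaled (e x : Z) : Z := Z.shiftr (x * 2 ^ 60) e.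

Fixpoint table_check (l : list Z) (k : nat) : bool :=
  match k, l with
  | O, _ => true
  | S k, cons d (cons c (cons b (cons a _)) as t) =>
      let e := Z.log2 a in
      if Z.ltb ((scaled e a + 1) * (scaled e c + 1) ^ 3) ((scaled e b) ^ 3 * scaled e d)
      then table_check t k else false
  | _, _ => false
  end.

Definition tabulates (u : nat -> R) (l : list Z) (n : nat) : Prop :=
  length l = n /\ forall i, (i < n)%nat -> IZR (nth i l 0%Z) = u (n - 1 - i)%nat.

(** The loop invariant after k squares: the list stands at position (k + 1)^2 - 1, the next skip is
    2 k + 3 = (k + 2)^2 - (k + 1)^2, and the sign is the parity of k. *)
Lemma square_sum_spec (u : nat -> R) (l : list Z) (n : nat) : tabulates u l n ->
  forall fuel k acc,
  IZR (square_sum fuel (skipn (S k * S k - 1) l) (2 * k + 3) (Nat.even k) acc)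
  = IZR acc + rfsum (fun j => (-1) ^ (k + j) * rshift (S (k + j) * S (k + j)) u n) fuel.
Proof.
intros [Hl Hu] fuel; induction fuel as [|fuel IH]; intros k acc; [simpl; ring|].
destruct (skipn (S k * S k - 1) l) as [|x t] eqn:E.
  assert (Hn : (n <= S k * S k - 1)%nat).
    pose proof (length_skipn (S k * S k - 1) l) as L; rewrite E, Hl in L; simpl in L; lia.
  rewrite (rfsum_ext _ (fun _ => 0)).
    simpl; clear; induction fuel as [|m IHm]; simpl in *; lra.
  intros j _; unfold rshift; replace (Nat.ltb n (S (k + j) * S (k + j))) with true; [ring|].
  symmetry; apply Nat.ltb_lt; nia.
replace (S fuel) with (1 + fuel)%nat by lia; rewrite rfsum_split.
cbn [rfsum]; rewrite Rplus_0_l.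
assert (Hn : (S k * S k - 1 < n)%nat).
  pose proof (length_skipn (S k * S k - 1) l) as L; rewrite E, Hl in L; simpl in L; lia.
assert (Ex : IZR x = u (n - S k * S k)%nat).
  replace (n - S k * S k)%nat with (n - 1 - (S k * S k - 1))%nat by nia.
  rewrite <- Hu, <- (firstn_skipn (S k * S k - 1) l), E by exact Hn.
  rewrite app_nth2; rewrite length_firstn, Hl, Nat.min_l by lia; [|lia].
  rewrite Nat.sub_diag; reflexivity.
change (1 + fuel)%nat with (S fuel); cbn [square_sum]; rewrite <- E, skipn_skipn.
replace (2 * k + 3 + (S k * S k - 1))%nat with (S (S k) * S (S k) - 1)%nat by nia.
replace (S (S (2 * k + 3))) with (2 * S k + 3)%nat by lia.
replace (negb (Nat.even k)) with (Nat.even (S k)) by (rewrite Nat.even_succ, <- Nat.negb_even; reflexivity).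
rewrite IH.
replace (IZR (if Nat.even k then acc + x else acc - x))
  with (IZR acc + (-1) ^ k * IZR x).
  rewrite (rfsum_ext (fun j => (-1) ^ (S k + j) * rshift (S (S k + j) * S (S k + j)) u n)
    (fun j => (-1) ^ (k + (1 + j)) * rshift (S (k + (1 + j)) * S (k + (1 + j))) u n)).
    rewrite Nat.add_0_r, Ex; unfold rshift at 2; replace (Nat.ltb n (S k * S k)) with false; [ring|].
    symmetry; apply Nat.ltb_ge; lia.
  intros j _; replace (S k + j)%nat with (k + (1 + j))%nat by lia; reflexivity.
destruct (Nat.Even_or_Odd k) as [[h ->]|[h ->]].
  rewrite Nat.even_mul, pow_1_even; cbn [Nat.even orb]; rewrite plus_IZR; ring.
replace (2 * h + 1)%nat with (S (2 * h)) by lia.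
rewrite pow_1_odd, Nat.even_succ, <- Nat.negb_even, Nat.even_mul; cbn [Nat.even orb negb].
rewrite minus_IZR; ring.
Qed.

Lemma gauss_table_spec (u : nat -> R) (n : nat) : u O = 1 ->
  (forall m, (1 <= m)%nat ->
    u m = - (2 * rfsum (fun j => (-1) ^ S j * rshift (S j * S j) u m) m)) ->
  tabulates u (gauss_table n) (S n).
Proof.
intros u_0 u_rec.
induction n as [|n IH].
  split; [reflexivity|]; intros i Hi; replace i with O by lia; symmetry; exact u_0.
cbn [gauss_table]; cbv zeta; split; [simpl; f_equal; apply IH|].
intros [|i] Hi.
  change (nth 0 (?a :: ?l) 0%Z) with a.
  pose proof (square_sum_spec u _ _ IH (S n) O 0%Z) as E; simpl skipn in E.
  rewrite (proj1 IH); cbn [nth]; rewrite mult_IZR.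
  change (2 * 0 + 3)%nat with 3%nat in E; change (Nat.even 0) with true in E; rewrite E.
  replace (S (S n) - 1 - 0)%nat with (S n) by lia; rewrite (u_rec (S n)) by lia.
  rewrite (rfsum_ext _ (fun j => (-1) ^ S j * rshift (S j * S j) u (S n) * -1)).
    rewrite rfsum_scal_r; ring.
  intros j _; simpl; ring.
simpl nth; rewrite (proj2 IH) by lia; f_equal; lia.
Qed.

Lemma scaled_bounds (e x : Z) : (0 <= e)%Z ->
  IZR (scaled e x) * IZR (2 ^ e) <= IZR x * IZR (2 ^ 60) < (IZR (scaled e x) + 1) * IZR (2 ^ e).
Proof.
intros He; unfold scaled; rewrite Z.shiftr_div_pow2 by exact He.
rewrite <- plus_IZR, <- !mult_IZR.
assert (P : (0 < 2 ^ e)%Z) by (apply Z.pow_pos_nonneg; lia).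
pose proof (Z.div_mod (x * 2 ^ 60) (2 ^ e) ltac:(lia)).
pose proof (Z.mod_pos_bound (x * 2 ^ 60) (2 ^ e) P).
split; [apply IZR_le|apply IZR_lt]; lia.
Qed.

(** With p = 2^e and q = 2^60, [scaled_bounds] puts x q between consecutive multiples of p. Rounding
    a and c up and b and d down, the integer test implies the inequality multiplied by q^4. *)
Lemma table_check_spec (u : nat -> R) (l : list Z) (n k : nat) : (forall m, 0 <= u m) ->
  tabulates u l n -> table_check l k = true ->
  forall i, (i < k)%nat -> (i + 4 <= n)%nat /\
  u (n - 4 - i)%nat * u (n - 2 - i)%nat ^ 3 < u (n - 3 - i)%nat ^ 3 * u (n - 1 - i)%nat.
Proof.
intros u_ge0; revert l n; induction k as [|k IH]; intros l n [Hl Hu] C i Hi; [lia|].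
destruct l as [|d [|c [|b [|a t]]]]; try discriminate.
cbn [table_check] in C; cbv zeta in C; match type of C with (if ?x then _ else _) = _ => destruct x eqn:E end; [|discriminate].
simpl in Hl; destruct i as [|i].
  split; [lia|]; clear IH C; apply Z.ltb_lt, IZR_lt in E.
  pose proof (Hu 3%nat ltac:(lia)) as Ea; pose proof (Hu 2%nat ltac:(lia)) as Eb.
  pose proof (Hu 1%nat ltac:(lia)) as Ec; pose proof (Hu 0%nat ltac:(lia)) as Ed; simpl nth in *.
  replace (n - 1 - 3)%nat with (n - 4 - 0)%nat in Ea by lia.
  replace (n - 1 - 2)%nat with (n - 3 - 0)%nat in Eb by lia.
  replace (n - 1 - 1)%nat with (n - 2 - 0)%nat in Ec by lia.
  rewrite <- Ea, <- Eb, <- Ec, <- Ed.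
  set (e := Z.log2 a) in *; assert (He : (0 <= e)%Z) by apply Z.log2_nonneg.
  pose proof (scaled_bounds e a He) as Ba; pose proof (scaled_bounds e b He) as Bb.
  pose proof (scaled_bounds e c He) as Bc; pose proof (scaled_bounds e d He) as Bd.
  assert (Pa : 0 <= IZR a) by (rewrite Ea; apply u_ge0); assert (Pb : 0 <= IZR b) by (rewrite Eb; apply u_ge0).
  assert (Pc : 0 <= IZR c) by (rewrite Ec; apply u_ge0); assert (Pd : 0 <= IZR d) by (rewrite Ed; apply u_ge0).
  assert (Ps : forall x, 0 <= IZR x -> 0 <= IZR (scaled e x)).
    intros x Hx; apply IZR_le; unfold scaled; apply Z.shiftr_nonneg; apply le_IZR in Hx; lia.
  pose proof (Ps b Pb) as Pb'; pose proof (Ps d Pd) as Pd'; pose proof (Ps a Pa) as Pa'; pose proof (Ps c Pc) as Pc'.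
  clear Ps Ea Eb Ec Ed.
  rewrite !mult_IZR, !plus_IZR in E; change 3%Z with (Z.of_nat 3) in E.
  rewrite <- !pow_IZR, plus_IZR in E.
  assert (P : 0 < IZR (2 ^ e)) by (apply IZR_lt, Z.pow_pos_nonneg; lia).
  set (p := IZR (2 ^ e)) in *; set (q := IZR (2 ^ 60)) in *.
  assert (Q : 0 < q) by (apply IZR_lt; reflexivity).
  apply Rmult_lt_reg_r with (q ^ 4); [apply pow_lt, Q|].
  apply Rle_lt_trans with (((IZR (scaled e a) + 1) * p) * ((IZR (scaled e c) + 1) * p) ^ 3).
    replace (IZR a * IZR c ^ 3 * q ^ 4) with ((IZR a * q) * (IZR c * q) ^ 3) by ring.
    apply Rmult_le_compat; [apply Rmult_le_pos; lra|apply pow_le, Rmult_le_pos; lra|lra|].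
    apply pow_incr; split; [apply Rmult_le_pos; lra|lra].
  apply Rlt_le_trans with ((IZR (scaled e b) * p) ^ 3 * (IZR (scaled e d) * p)).
    match goal with |- ?x < ?y =>
      replace x with (((IZR (scaled e a) + 1) * (IZR (scaled e c) + 1) ^ 3) * p ^ 4) by ring;
      replace y with ((IZR (scaled e b) ^ 3 * IZR (scaled e d)) * p ^ 4) by ring end.
    apply Rmult_lt_compat_r; [apply pow_lt, P|exact E].
  replace (IZR b ^ 3 * IZR d * q ^ 4) with ((IZR b * q) ^ 3 * (IZR d * q)) by ring.
  apply Rmult_le_compat; [apply pow_le, Rmult_le_pos; lra|apply Rmult_le_pos; lra| |lra].
  apply pow_incr; split; [apply Rmult_le_pos; lra|lra].
destruct (IH (c :: b :: a :: t)%list (n - 1)%nat) with (i := i) as [H1 H2]; [|exact C|lia|].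
  split; [simpl; lia|]; intros j Hj; specialize (Hu (S j) ltac:(lia)); simpl nth in *; rewrite Hu; f_equal; lia.
split; [lia|].
replace (n - 4 - S i)%nat with (n - 1 - 4 - i)%nat by lia.
replace (n - 3 - S i)%nat with (n - 1 - 3 - i)%nat by lia.
replace (n - 2 - S i)%nat with (n - 1 - 2 - i)%nat by lia.
replace (n - 1 - S i)%nat with (n - 1 - 1 - i)%nat by lia.
exact H2.
Qed.

(** The table holds the values at 0, ..., 2502. Its windows of four start with n = 2500, and the
    2483 checked ones go down to n = 18. *)
Lemma gauss_table_check : table_check (gauss_table 2502) 2483 = true.
Proof. vm_compute; reflexivity. Qed.

Lemma opcount_ineq_small (o : nat -> nat -> R) (u : nat -> R) (n : nat) : opcount o ->
  (forall K n, (n <= K)%nat -> o K n = u n) -> (18 <= n < 2501)%nat ->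
  u (n - 1)%nat * u (n + 1)%nat ^ 3 < u n ^ 3 * u (n + 2)%nat.
Proof.
intros Ho Hu Hn.
assert (U0 : u O = 1) by (rewrite <- (Hu O O) by lia; apply (proj1 Ho)).
assert (Up : forall m, 0 <= u m) by (intros m; rewrite <- (Hu m m) by lia; apply Ho).
assert (Ur : forall m, (1 <= m)%nat ->
  u m = - (2 * rfsum (fun j => (-1) ^ S j * rshift (S j * S j) u m) m)).
  intros m Hm; rewrite <- (Hu m m) at 1 by lia.
  rewrite (gauss_recurrence o m m Ho) by lia.
  do 2 f_equal; apply rfsum_ext; intros j _; f_equal; unfold rshift.
  destruct (Nat.ltb _ _); [reflexivity|apply Hu; lia].
destruct (table_check_spec u _ _ _ Up (gauss_table_spec u 2502 U0 Ur) gauss_table_check (2500 - n)%nat)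
  as [_ H]; [lia|].
replace (2503 - 4 - (2500 - n))%nat with (n - 1)%nat in H by lia.
replace (2503 - 3 - (2500 - n))%nat with n in H by lia.
replace (2503 - 2 - (2500 - n))%nat with (n + 1)%nat in H by lia.
replace (2503 - 1 - (2500 - n))%nat with (n + 2)%nat in H by lia.
exact H.
Qed.

(** Stated for arbitrary counts, so that the combinatorial part has only to supply the recurrence
    and the stabilisation for K >= m. *)
Lemma opcount_nat_ineq (s : nat -> nat -> nat) (p : nat -> nat) (n : nat) :
  opcount (fun K m => INR (s K m)) -> (forall K m, (m <= K)%nat -> s K m = p m) ->
  (18 <= n)%nat ->
  (p (n - 1) * (p (n + 1) * p (n + 1) * p (n + 1)) < p n * p n * p n * p (n + 2))%nat.
Proof.
intros Hs Hp Hn; apply INR_lt; rewrite !mult_INR.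
assert (H : INR (p (n - 1)%nat) * INR (p (n + 1)%nat) ^ 3 < INR (p n) ^ 3 * INR (p (n + 2)%nat)).
  destruct (Nat.lt_ge_cases n 2500) as [H|H].
    apply (opcount_ineq_small _ (fun m => INR (p m)) n Hs); [|lia].
    intros K m Hm; rewrite Hp by exact Hm; reflexivity.
  destruct (opcount_ineq _ n Hs H) as [K [HK I]]; rewrite !Hp in I by lia; exact I.
simpl in H; lra.
Qed.

Local Close Scope R_scope.

Require Import Defs.
From mathcomp Require Import all_boot all_order all_algebra zify ring.
Set Implicit Arguments.
Unset Strict Implicit.
Unset Printing Implicit Defensive.
Import Order.TTheory GRing.Theory Num.Theory.

(** * Enumeration of overpartitions *)

(** Under a new head k, a tail entry remains a first occurrence only if its part differs from k; the
    extra condition on the tail is thus that no k in it is overlined. *)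
Lemma no_overlined_eq (k : nat) (t : seq (nat * bool)) :
  ((k, true) \notin t) =
  all (fun i => overlined_at t i ==> (nth 0 (parts t) i != k)) (iota 0 (size t)).
Proof.
elim: t => //= -[j b] t IHt; rewrite inE negb_or IHt (iotaDl 1 0) all_map; congr (_ && _).
by rewrite xpair_eqE /overlined_at /=; case: b; rewrite ?andbT ?andbF // eq_sym.
Qed.

(** Peels off the largest part, which comes first; its own overline b is free, the head being a
    first occurrence. *)
Lemma is_overpartition_cons (n k : nat) (b : bool) (t : seq (nat * bool)) :
  is_overpartition n ((k, b) :: t) =
  [&& 0 < k, k <= n, all (fun x => x.1 <= k) t, (k, true) \notin t & is_overpartition (n - k) t].
Proof.
have geq_tr : transitive geq by move=> x y z /= yx zy; apply: leq_trans yx.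
rewrite /is_overpartition /is_partition /= (path_sortedE geq_tr) implybT /= no_overlined_eq.
rewrite (iotaDl 1 0) all_map.
have -> : all (preim (addn 1) (fun i => overlined_at ((k, b) :: t) i ==>
    first_occurrence (k :: parts t) i)) (iota 0 (size t)) =
  all (fun i => overlined_at t i ==> (nth 0 (parts t) i != k)) (iota 0 (size t)) &&
  all (fun i => overlined_at t i ==> first_occurrence (parts t) i) (iota 0 (size t)).
  rewrite -all_predI; apply: eq_all => i /=.
  rewrite /overlined_at /first_occurrence /= inE negb_or.
  by case: (nth false _ i).
have -> : (k + sumn (parts t) == n) = (k <= n) && (sumn (parts t) == n - k).
  apply/eqP/andP => [<-|[kn /eqP->]]; last exact: subnKC.
  by rewrite leq_addr addKn.
have -> : all (geq k) (parts t) = all (fun x => x.1 <= k) t by rewrite /parts /unzip1 all_map.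
move: (all _ t) (sorted _ _) (all _ (parts t)) (k <= n) (sumn _ == _) (0 < k) => u1 u2 u3 u4 u5 u6.
move: (all _ _) (all _ _) => u7 u8.
by case: u1; case: u2; case: u3; case: u4; case: u5; case: u6; case: u7; case: u8.
Qed.

Lemma is_overpartition_nil (n : nat) : is_overpartition n [::] = (n == 0).
Proof. by rewrite /is_overpartition /is_partition /= andbT eq_sym. Qed.

(* [put f k m n] adds any number of non-overlined parts [k] to the members of the family [f], the
   total being [n]; [m] bounds the number of added parts. *)
Fixpoint put (f : nat -> seq (seq (nat * bool))) (k m n : nat) : seq (seq (nat * bool)) :=
  f n ++ if m is m'.+1 then
           if k <= n then [seq (k, false) :: t | t <- put f k m' (n - k)] else [::]
         else [::].

(** The first copy of the part K + 1 may be overlined or not; the later copies come from [put] and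
    are plain. The truncated difference n - (K + 1) is read only when K + 1 <= n. *)
Fixpoint ops (K n : nat) : seq (seq (nat * bool)) :=
  if K is K'.+1 then
    let u := put (ops K') K'.+1 n (n - K'.+1) in
    ops K' n ++
      if K'.+1 <= n then [seq (K'.+1, true) :: t | t <- u] ++ [seq (K'.+1, false) :: t | t <- u]
      else [::]
  else if n == 0 then [:: [::]] else [::].

Lemma putS f k m n :
  put f k m.+1 n = f n ++ if k <= n then [seq (k, false) :: t | t <- put f k m (n - k)] else [::].
Proof. by []. Qed.

Lemma opsS K n :
  ops K.+1 n = ops K n ++
    if K.+1 <= n then [seq (K.+1, true) :: t | t <- put (ops K) K.+1 n (n - K.+1)] ++
                      [seq (K.+1, false) :: t | t <- put (ops K) K.+1 n (n - K.+1)]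
    else [::].
Proof. by []. Qed.

Definition bounded_op (K n : nat) (s : seq (nat * bool)) : bool :=
  is_overpartition n s && all (fun x => x.1 <= K) s.

Lemma mem_map_cons (x y : nat * bool) (t : seq (nat * bool)) u :
  (x :: t \in [seq y :: t | t <- u]) = (x == y) && (t \in u).
Proof.
apply/mapP/andP => [[t' t'u [-> ->]]|[/eqP-> tu]]; first by [].
by exists t.
Qed.

Lemma nil_map_cons (y : nat * bool) u : ([::] \in [seq y :: t | t <- u]) = false.
Proof. by apply/mapP => -[]. Qed.

Lemma bounded_op_cons K n j b t :
  bounded_op K n ((j, b) :: t) =
  [&& 0 < j, j <= n, j <= K, (j, true) \notin t & bounded_op j (n - j) t].
Proof.
rewrite /bounded_op is_overpartition_cons /=.
case: (leqP j K) => [jK|_]; last by rewrite ?andbF.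
case a: (all (fun x => x.1 <= j) t) => /=; last by rewrite ?andbF.
have -> : all (fun x => x.1 <= K) t by apply: sub_all a => x /leq_trans; apply.
by rewrite !andbT.
Qed.

Lemma bounded_op_notin K n j b t : K < j -> bounded_op K n t -> (j, b) \notin t.
Proof.
move=> Kj /andP[_ /allP h]; apply/negP => /h /=; by rewrite leqNgt Kj.
Qed.

Lemma mem_put K m n s : (forall n s, (s \in ops K n) = bounded_op K n s) ->
  n <= m -> (s \in put (ops K) K.+1 m n) = bounded_op K.+1 n s && ((K.+1, true) \notin s).
Proof.
move=> IH; elim: m n s => [|m IHm] n s nm.
  move: nm; rewrite leqn0 => /eqP-> /=; rewrite cats0 IH.
  case: s => [|[j b] t]; first by rewrite /bounded_op.
  by rewrite !bounded_op_cons; case: j.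
rewrite /= mem_cat IH; case: s => [|[j b] t].
  by rewrite /bounded_op; case: ifP; rewrite ?nil_map_cons ?orbF ?andbT.
have -> : ((j, b) :: t \in if K < n then [seq (K.+1, false) :: t | t <- put (ops K) K.+1 m (n - K.+1)]
    else [::]) = [&& j == K.+1, ~~ b, K < n & (t \in put (ops K) K.+1 m (n - K.+1))].
  case: (K < n); rewrite ?mem_map_cons ?in_nil ?andbF //= xpair_eqE.
  by case: b; rewrite ?andbF ?andbT.
rewrite inE negb_or xpair_eqE !bounded_op_cons IHm; last by rewrite leq_subLR addSn; apply: leq_trans nm _; rewrite ltnS leq_addl.
have [->|jk] := eqVneq j K.+1.
  rewrite ltnn leqnn ltn0Sn.
  by case: b; case: (K < n); case: (_ \notin t); case: (bounded_op _ _ _).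
rewrite orbF [j <= K.+1]leq_eqVlt (negbTE jk) ltnS.
case: (leqP j K) => [jK|_]; rewrite ?andbF //=.
case h : (bounded_op j (n - j) t); rewrite ?andbF //=.
by rewrite (@bounded_op_notin j _ K.+1 true _ _ h) ?ltnS // !andbT.
Qed.

Lemma mem_ops K n s : (s \in ops K n) = bounded_op K n s.
Proof.
elim: K n s => [|K IH] n s.
  rewrite /=; case: s => [|[j b] t]; last first.
    by rewrite bounded_op_cons; case: (n == 0); case: j => [|j]; rewrite ?ltn0 ?andbF.
  by rewrite /bounded_op is_overpartition_nil andbT; case: eqP.
rewrite /= mem_cat IH; case: s => [|[j b] t].
  by rewrite /bounded_op; case: ifP; rewrite ?mem_cat ?nil_map_cons ?orbF.
have -> : ((j, b) :: t \in if K < n then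
      [seq (K.+1, true) :: t | t <- put (ops K) K.+1 n (n - K.+1)] ++
      [seq (K.+1, false) :: t | t <- put (ops K) K.+1 n (n - K.+1)] else [::]) =
    [&& j == K.+1, K < n & (t \in put (ops K) K.+1 n (n - K.+1))].
  case: (K < n); rewrite ?mem_cat ?mem_map_cons ?in_nil ?andbF //= !xpair_eqE.
  by case: b; case: eqP; case: (t \in _).
rewrite !bounded_op_cons (mem_put _ IH) ?leq_subr //.
have [->|jk] := eqVneq j K.+1.
  rewrite ltnn leqnn ltn0Sn.
  by case: (K < n); case: (_ \notin t); case: (bounded_op _ _ _).
by rewrite orbF [j <= K.+1]leq_eqVlt (negbTE jk) ltnS.
Qed.

Lemma uniq_put K m n : (forall n, uniq (ops K n)) -> uniq (put (ops K) K.+1 m n).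
Proof.
move=> IH; elim: m n => [|m IHm] n; first by rewrite /= cats0.
rewrite /= cat_uniq IH /=; case: ifP => // _; apply/andP; split; last first.
  by rewrite map_inj_uniq // => x y [].
apply/hasPn => _ /mapP[t _ ->]; rewrite mem_ops.
by apply/negP => /andP[_] /=; rewrite ltnn.
Qed.

Lemma uniq_ops K n : uniq (ops K n).
Proof.
elim: K n => [|K IH] n /=; first by case: ifP.
rewrite cat_uniq IH; case: ifP => // _; rewrite cat_uniq.
rewrite !map_inj_uniq ?uniq_put //; try by move=> x y [].
rewrite andbT /=; apply/andP; split; apply/hasPn => x.
  rewrite mem_cat => /orP[] /mapP[t _ ->]; rewrite mem_ops;
  by apply/negP => /andP[_] /=; rewrite ltnn.
by move=> /mapP[t _ ->]; apply/negP => /mapP[t' _ []].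
Qed.

(** * Recurrence for the counts *)

Lemma size_put K k m m' n : 0 < k -> n <= m -> n <= m' ->
  size (put (ops K) k m n) = size (put (ops K) k m' n).
Proof.
move=> k0; elim: m m' n => [|m IHm] [|m'] n.
- by [].
- by rewrite leqn0 => /eqP-> _ /=; rewrite leqNgt k0.
- by move=> _; rewrite leqn0 => /eqP-> /=; rewrite leqNgt k0.
move=> nm nm' /=; rewrite !size_cat; case: ifP => //= _; rewrite !size_map (IHm m') //.
  by rewrite leq_subLR; apply: leq_trans nm _; rewrite -add1n leq_add2r.
by rewrite leq_subLR; apply: leq_trans nm' _; rewrite -add1n leq_add2r.
Qed.

Lemma size_ops_lt K n : n < K.+1 -> size (ops K.+1 n) = size (ops K n).
Proof. by move=> nK; rewrite /= size_cat leqNgt nK addn0. Qed.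

(** With x = q^(K+1), [put] divides the generating function of [ops K] by 1 - x, and [ops K.+1]
    multiplies it by (1 + x) / (1 - x); the identity is (1 + x) / (1 - x) + 1 = 2 / (1 - x). *)
Lemma size_opsS K n :
  size (ops K.+1 n) + size (ops K n) = 2 * size (put (ops K) K.+1 n n).
Proof.
rewrite opsS; case: n => [|n]; first by rewrite /= !cats0 mul2n addnn.
rewrite putS !size_cat; case: ifP => Kn; last by rewrite /= !addn0 mul2n addnn.
rewrite size_cat !size_map (@size_put K K.+1 n.+1 n) ?leq_subr //; last by rewrite subSS leq_subr.
by rewrite mulnDr !mul2n -!addnn addnAC.
Qed.

(** Removing the first copy of K + 1, overlined or plain, leaves a member of [put] of total n;
    [size_opsS] trades twice their number for sizes of [ops]. *)
Lemma size_ops_rec K n :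
  size (ops K.+1 (K.+1 + n)) = size (ops K (K.+1 + n)) + size (ops K.+1 n) + size (ops K n).
Proof.
rewrite -addnA size_opsS opsS size_cat leq_addr size_cat !size_map addKn.
by rewrite (@size_put K K.+1 (K.+1 + n) n) ?leq_addl // mul2n addnn.
Qed.

(** Two enumerations without repetition that have the same members; [overpartition_bounded] supplies
    a bounded preimage of each member of [ops n n]. *)
Lemma pbar_size n : pbar n = size (ops n n).
Proof.
have -> : pbar n = size [seq forget_bounds (bseqval t) | t <- enum (overpartitions n)].
  by rewrite size_map -cardE.
apply/perm_size/uniq_perm; rewrite ?uniq_ops //.
  rewrite map_inj_uniq ?enum_uniq // => x y /forget_bounds_inj; exact: val_inj.
move=> s; rewrite mem_ops; apply/mapP/andP => [[t]|[ops_s _]].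
  rewrite mem_enum inE => ops_t ->; split=> //; apply/allP => _ /mapP[[i b] _ ->] /=.
  by rewrite -ltnS.
by have [t tP <-] := overpartition_bounded ops_s; exists t; rewrite // mem_enum.
Qed.

Lemma pbar_size_le K n : n <= K -> pbar n = size (ops K n).
Proof.
move=> nK; rewrite -(subnK nK); elim: (K - n) => [|d IH]; first exact: pbar_size.
by rewrite IH addSn size_ops_lt // ltnS leq_addl.
Qed.

Lemma opcount_size_ops : opcount (fun K n => INR (size (ops K n))).
Proof.
split; first by case.
split; first by move=> K n; exact: pos_INR.
split=> [K n /ssrnat.ltP nK|K n]; first by rewrite size_ops_lt.
by rewrite !plusE size_ops_rec -!plusE !plus_INR.
Qed.

Lemma pbar_gt0 n : 0 < n -> 0 < pbar n.
Proof.
move=> n0; rewrite pbar_size -has_predT; apply/hasP; exists [:: (n, false)] => //.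
by rewrite mem_ops bounded_op_cons /bounded_op subnn is_overpartition_nil n0 leqnn.
Qed.

Lemma pbar_ratio n : 18 <= n ->
  pbar n.-1 * (pbar n.+1 * pbar n.+1 * pbar n.+1) < pbar n * pbar n * pbar n * pbar n.+2.
Proof.
move=> /ssrnat.leP n18; have pE K m : (m <= K)%coq_nat -> size (ops K m) = pbar m.
  by move=> /ssrnat.leP mK; rewrite (pbar_size_le mK).
have /ssrnat.ltP := opcount_nat_ineq _ _ _ opcount_size_ops pE n18.
by rewrite !plusE !multE !minusE addn1 addn2 subn1.
Qed.

(* AM-GM: [(c b^2 + a b d)^2 >= 4 a b^3 c d > 4 a^2 c^4]. *)
Lemma third_difference_pos (a b c d : nat) : 0 < a -> 0 < c ->
  a * (c * c * c) < b * b * b * d -> 2 * a * (c * c) < c * (b * b) + a * b * d.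
Proof.
move=> a0 c0 abcd; rewrite ltnNge; apply/negP => le_sum.
have lt_sq : (2 * a * (c * c)) * (2 * a * (c * c)) < 4 * ((c * (b * b)) * (a * b * d)).
  have -> : (2 * a * (c * c)) * (2 * a * (c * c)) = (4 * (a * c)) * (a * (c * c * c)) by ring.
  have -> : 4 * ((c * (b * b)) * (a * b * d)) = (4 * (a * c)) * (b * b * b * d) by ring.
  by rewrite ltn_pmul2l // !muln_gt0 a0.
have := leq_mul le_sum le_sum; have := (nat_AGM2 (c * (b * b)) (a * b * d)).1; move: lt_sq.
move: (2 * a * (c * c)) (c * (b * b)) (a * b * d) => z x y; rewrite -mulnn; lia.
Qed.

Local Open Scope ring_scope.
Unset Implicit Arguments.

Theorem theorem2p5 (n : nat) (hn : (18 <= n)%N) :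
  (pbar n.+1)%:Z * (pbar n)%:Z ^+ 2
    - 2 * (pbar n.-1)%:Z * (pbar n.+1)%:Z ^+ 2
    + (pbar n.-1)%:Z * (pbar n)%:Z * (pbar n.+2)%:Z > 0.
Proof.
have := @third_difference_pos (pbar n.-1) (pbar n) (pbar n.+1) (pbar n.+2).
rewrite !pbar_gt0 ?pbar_ratio //; last by lia.
by move=> /(_ isT isT isT); rewrite !expr2; lia.
Qed.
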